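(* Let $\delta\in\{1,2\}$. Then every nonnegative integer $n$ can be written as $p_5(w)+p_5(x)+2p_5(y)+3\delta\, p_5(z)$ with $w,x,y,z$ nonnegative integers.
   Context: For $k\in\mathbb{Z}$, $p_5(k)=k(3k-1)/2$ (pentagonal numbers when $k\ge 0$). *)

(* Defs.v *)
From Stdlib Require Import ZArith.
Open Scope Z_scope.
(* generalized pentagonal numbers p_5(k) = k(3k-1)/2 for k : Z (exact division) *)
Definition p5 (k : Z) : Z := k * (3 * k - 1) / 2.

(* Main.v *)
(* If w + x + 2y + 3dz = b and w^2 + x^2 + 2y^2 + 3dz^2 = a with 3a = 2n + b, then the pentagonal sum
   is n, and b^2 >= (3 + 3d) a forces w, x, y, z >= 0 (Cauchy).  With S = 4 + 3d and N = S a - b^2 > 0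
   the two equations become 4N = 3d r^2 + S (q^2 + 2t^2) with congruence conditions on r, q, t.  For
   large n the admissible interval for b is long enough to prescribe a mod 4, 3 not dividing N and
   p not dividing b, where p = 7 for d = 1 and p = 5 for d = 2.
   A rational solution of 3x^2 + p (q^2 + 2t^2) = 2m X^2 comes from Legendre's theorem on
   a x^2 + b y^2 = c z^2, with q^2 + 2t^2 replaced by l y^2 for a prime l = 3 mod 8 whose quadratic
   symbols are prescribed.  Such a prime is found by Mertens' method, which only needs real characters;
   L(1, f) <> 0 is shown by Monsky's argument.  The descent of Aubry, Davenport and Cassels on a
   euclidean slice of the form makes the solution integral, and explicit rational similitudes then
   move it to one satisfying the congruences.
   For small n, every integer in [3794, 8000) is of the form p5 w + p5 x + 2 p5 y, and subtracting
   3d p5 z leads into this interval. *)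
Require Import Defs.
From Stdlib Require Import ZArith Lia Zwf List Classical.
Open Scope Z_scope.

(** * From rational to integral solutions *)

(** The form [x^2 + xy + 2y^2 + 7z^2] is not euclidean: [7z^2] alone reaches 7/4 after rounding.
    Fixing one coordinate modulo [p] and dividing by [p] gives a form that is, at the price of an
    inhomogeneous polynomial, hence the linear term in the descent. The rational equation is
    quaternary whereas Legendre's theorem is ternary; requiring [q^2 + 2t^2 = l y^2] removes a
    variable, and the freedom in [l] takes the place of a local-global principle in four variables.
    The class 3 modulo 8 serves twice: -2 is then a square modulo [l], and the prescribed value -1
    of the character modulo 4 makes the weight vanish at even powers of primes, so that they need no
    estimate. That [p] does not divide [b] makes [6m] a nonzero square modulo [p]; that 3 does not
    divide [N] keeps the symbols modulo 3 nonzero. The one remaining symbol, at [l], is supplied by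
    reciprocity. From 250000 on the interval for [b] contains the 48 consecutive integers that its
    congruences require. *)

Lemma nearest (p s : Z) : 0 < s -> exists k, -s <= 2 * (p - s * k) <= s.
Proof.
  intros Hs. exists ((2 * p + s) / (2 * s)).
  pose proof (Z.div_mod (2 * p + s) (2 * s)). pose proof (Z.mod_pos_bound (2 * p + s) (2 * s)).
  nia.
Qed.

Lemma square_le (x s : Z) : - s <= x <= s -> 0 <= x * x <= s * s.
Proof. nia. Qed.

Lemma square_eq0 (x : Z) : x * x = 0 -> x = 0.
Proof. nia. Qed.

(* The line through the rational point and a nearby lattice point meets the quadric in a second
   rational point, whose denominator is T = h(d) / t < t. *)
Lemma aubry_davenport_cassels (a b e f g k l1 l2 l3 M : Z) :
  let h x y z := a * x * x + b * y * y + e * z * z + f * x * y + g * y * z + k * x * z in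
  let l x y z := l1 * x + l2 * y + l3 * z in
  (forall x y z t, 0 < t -> exists x0 y0 z0,
     let dx := x - t * x0 in let dy := y - t * y0 in let dz := z - t * z0 in
     0 <= h dx dy dz < t * t /\ (h dx dy dz = 0 -> dx = 0 /\ dy = 0 /\ dz = 0)) ->
  (exists x y z t, t <> 0 /\ h x y z + t * l x y z = M * t * t) ->
  exists x y z, h x y z + l x y z = M.
Proof.
  intros h l Hround (x & y & z & t & Ht & E).
  assert (exists x y z t, 0 < t /\ h x y z + t * l x y z = M * t * t) as H.
  { destruct (Z_lt_le_dec 0 t) as [H|H]; [now exists x, y, z, t|].
    exists (- x), (- y), (- z), (- t). split; [lia|]. replace (M * - t * - t) with (M * t * t) by ring.
    rewrite <- E. unfold h, l. ring. }
  clear x y z t Ht E. destruct H as (x & y & z & t & Ht & E).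
  revert x y z E. induction t as [t IH] using (well_founded_induction (Zwf_well_founded 0)).
  intros x y z E. destruct (Hround x y z t Ht) as (x0 & y0 & z0 & [Hb1 Hb2] & H0).
  cbv zeta in *.
  set (dx := x - t * x0) in *; set (dy := y - t * y0) in *; set (dz := z - t * z0) in *.
  set (B := 2 * a * x0 * dx + 2 * b * y0 * dy + 2 * e * z0 * dz + f * (x0 * dy + y0 * dx)
        + g * (y0 * dz + z0 * dy) + k * (x0 * dz + z0 * dx)).
  set (P := h x0 y0 z0 + l x0 y0 z0).
  set (T := M * t - t * P - B - l dx dy dz).
  assert (HT : h dx dy dz = t * T).
  { assert (h x y z + t * l x y z = t * t * P + t * B + t * l dx dy dz + h dx dy dz) by
      (unfold P, B, h, l, dx, dy, dz; ring).
    unfold T. rewrite E in H. nia. }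
  destruct (Z.eq_dec T 0) as [HT0|HT0].
  - exists x0, y0, z0. fold P. rewrite HT, HT0 in H0.
    destruct H0 as (e1 & e2 & e3); [ring|].
    assert (B = 0) by (unfold B; rewrite e1, e2, e3; ring).
    assert (l dx dy dz = 0) by (unfold l; rewrite e1, e2, e3; ring).
    unfold T in HT0. nia.
  - rewrite HT in Hb1, Hb2. assert (HT1 : 0 < T < t) by nia.
    apply (IH T) with (x := T * x0 + (P - M) * dx) (y := T * y0 + (P - M) * dy)
      (z := T * z0 + (P - M) * dz); [unfold Zwf; lia|lia|].
    transitivity (T * T * P + (P - M) * (T * (B + l dx dy dz) + (P - M) * h dx dy dz)).
    { unfold P, B, h, l. ring. }
    rewrite HT. replace (B + l dx dy dz) with (M * t - t * P - T) by (unfold T; ring). ring.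
Qed.

(** Euclidean because [4h = w^2 + 7dy^2 + 4dz^2] with [w = 2dx + dy]: rounding [y] and [z] first and
    [x] last gives [|w| <= t] and [|dy|, |dz| <= t/2], so [h <= 15/16 t^2]. *)
Lemma adc_seven (c M : Z) :
  (exists u v z t, t <> 0 /\ u * u + u * v + 2 * v * v + z * z - t * c * v = M * t * t) ->
  exists u v z, u * u + u * v + 2 * v * v + z * z - c * v = M.
Proof.
  intros (u & v & z & t & Ht & E).
  destruct (aubry_davenport_cassels 1 2 1 1 0 0 0 (- c) 0 M) as (u' & v' & z' & E').
  - clear. intros x y z t Ht.
    destruct (nearest y t Ht) as [y0 Hy]. destruct (nearest z t Ht) as [z0 Hz].
    destruct (nearest (2 * x + (y - t * y0)) (2 * t)) as [x0 Hx]; [lia|].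
    exists x0, y0, z0. cbv zeta.
    set (dy := y - t * y0) in *; set (dz := z - t * z0) in *.
    replace (2 * x + dy - 2 * t * x0) with (2 * (x - t * x0) + dy) in Hx by ring.
    set (dx := x - t * x0) in *. clearbody dx dy dz.
    set (w := 2 * dx + dy) in *.
    set (h := _ + _).
    assert (E : 4 * h = w * w + 7 * (dy * dy) + 4 * (dz * dz)) by (unfold h, w; ring).
    assert (Hw : 0 <= w * w <= t * t) by (apply square_le; lia).
    apply square_le in Hy, Hz. clearbody h.
    assert (0 < t * t) by (clear - Ht; nia).
    split; [lia|]. intros ->.
    assert (dy = 0) by (apply square_eq0; lia). assert (dz = 0) by (apply square_eq0; lia).
    assert (w = 0) by (apply square_eq0; lia). unfold w in *. lia.
  - exists u, v, z, t. split; [assumption|]. rewrite <- E. ring.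
  - exists u', v', z'. rewrite <- E'. ring.
Qed.

(** Completing squares gives [12h = 3w^2 + v^2 + 20dz^2]; rounding [z], then [y], then [x] gives
    [|dz| <= t/2], [|v| <= 3t/2], [|w| <= t], so [h <= 41/48 t^2]. *)
Lemma adc_five (c M : Z) :
  (exists x y z t, t <> 0 /\
     x * x + y * y + 2 * z * z + x * y + y * z + x * z + t * c * (y + z) = M * t * t) ->
  exists x y z, x * x + y * y + 2 * z * z + x * y + y * z + x * z + c * (y + z) = M.
Proof.
  intros (x & y & z & t & Ht & E).
  destruct (aubry_davenport_cassels 1 1 2 1 1 1 0 c c M) as (x' & y' & z' & E').
  - clear. intros x y z t Ht. destruct (nearest z t Ht) as [z0 Hz].
    destruct (nearest (3 * y + (z - t * z0)) (3 * t)) as [y0 Hy]; [lia|].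
    destruct (nearest (2 * x + (y - t * y0) + (z - t * z0)) (2 * t)) as [x0 Hx]; [lia|].
    exists x0, y0, z0. cbv zeta. set (dz := z - t * z0) in *.
    replace (3 * y + dz - 3 * t * y0) with (3 * (y - t * y0) + dz) in Hy by ring.
    set (dy := y - t * y0) in *.
    replace (2 * x + dy + dz - 2 * t * x0) with (2 * (x - t * x0) + dy + dz) in Hx by ring.
    set (dx := x - t * x0) in *. clearbody dx dy dz.
    set (w := 2 * dx + dy + dz) in *. set (v := 3 * dy + dz) in *.
    set (h := _ + _).
    assert (E : 12 * h = 3 * (w * w) + v * v + 20 * (dz * dz)) by (unfold h, v, w; ring).
    assert (Hw : 0 <= w * w <= t * t) by (apply square_le; lia).
    apply square_le in Hy, Hz. clearbody h.
    assert (0 < t * t) by (clear - Ht; nia).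
    split; [lia|]. intros ->. assert (dz = 0) by (apply square_eq0; lia).
    assert (w = 0) by (apply square_eq0; lia). assert (v = 0) by (apply square_eq0; lia).
    unfold v, w in *. lia.
  - exists x, y, z, t. split; [assumption|]. rewrite <- E. ring.
  - exists x', y', z'. rewrite <- E'. ring.
Qed.

Lemma mod_comb a b x y m : m <> 0 ->
  (a * (x * x) + b * (y * y)) mod m
  = (a * ((x mod m) * (x mod m)) + b * ((y mod m) * (y mod m))) mod m.
Proof.
  intros Hm. pose proof (Z.div_mod x m Hm) as Hx. pose proof (Z.div_mod y m Hm) as Hy.
  set (r := x mod m) in *. set (s := y mod m) in *.
  set (k := x / m) in *. set (l := y / m) in *. clearbody r s k l. subst x y.
  rewrite <- (Z_mod_plus_full (a * (r * r) + _)
    (a * (2 * k * r + m * k * k) + b * (2 * l * s + m * l * l))).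
  f_equal. ring.
Qed.

Lemma sum_squares_mod7 x y k : x * x + y * y = 7 * k -> x mod 7 = 0 /\ y mod 7 = 0.
Proof.
  intros E. pose proof (mod_comb 1 1 x y 7 ltac:(easy)) as H.
  replace (1 * (x * x) + 1 * (y * y)) with (k * 7) in H by lia. rewrite Z_mod_mult in H.
  pose proof (Z.mod_pos_bound x 7). pose proof (Z.mod_pos_bound y 7).
  assert (x mod 7 = 0 \/ x mod 7 = 1 \/ x mod 7 = 2 \/ x mod 7 = 3
    \/ x mod 7 = 4 \/ x mod 7 = 5 \/ x mod 7 = 6) as Hx by lia.
  assert (y mod 7 = 0 \/ y mod 7 = 1 \/ y mod 7 = 2 \/ y mod 7 = 3
    \/ y mod 7 = 4 \/ y mod 7 = 5 \/ y mod 7 = 6) as Hy by lia.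
  destruct Hx as [Hx|[Hx|[Hx|[Hx|[Hx|[Hx|Hx]]]]]]; destruct Hy as [Hy|[Hy|[Hy|[Hy|[Hy|[Hy|Hy]]]]]];
    rewrite Hx, Hy in H; try discriminate H; auto.
Qed.

Lemma square_mod7 x k : x * x = 7 * k -> x mod 7 = 0.
Proof. intros E. apply (sum_squares_mod7 x 0 k). lia. Qed.

Lemma square_double_mod5 x y k : x * x + 2 * (y * y) = 5 * k -> x mod 5 = 0 /\ y mod 5 = 0.
Proof.
  intros E. pose proof (mod_comb 1 2 x y 5 ltac:(easy)) as H.
  replace (1 * (x * x) + 2 * (y * y)) with (k * 5) in H by lia. rewrite Z_mod_mult in H.
  pose proof (Z.mod_pos_bound x 5). pose proof (Z.mod_pos_bound y 5).
  assert (x mod 5 = 0 \/ x mod 5 = 1 \/ x mod 5 = 2 \/ x mod 5 = 3 \/ x mod 5 = 4) as Hx by lia.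
  assert (y mod 5 = 0 \/ y mod 5 = 1 \/ y mod 5 = 2 \/ y mod 5 = 3 \/ y mod 5 = 4) as Hy by lia.
  destruct Hx as [Hx|[Hx|[Hx|[Hx|Hx]]]]; destruct Hy as [Hy|[Hy|[Hy|[Hy|Hy]]]];
    rewrite Hx, Hy in H; try discriminate H; auto.
Qed.

Lemma multiple_of_mod0 x m : 0 < m -> x mod m = 0 -> exists y, x = m * y.
Proof. intros Hm H. exists (x / m). pose proof (Z.div_mod x m). lia. Qed.

Ltac divlia := Z.to_euclidean_division_equations; lia.

Lemma square_congr (p a b k : Z) : p = 3 \/ p = 5 \/ p = 7 -> a * a = b * b + p * k ->
  exists e s, (e = 1 \/ e = -1) /\ a = e * b + p * s.
Proof.
  intros Hp E.
  assert (M : ((a - b) mod p) * ((a + b) mod p) mod p = 0).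
  { rewrite <- Zmult_mod. replace ((a - b) * (a + b)) with (k * p) by lia. apply Z_mod_mult. }
  assert ((a - b) mod p = 0 \/ (a + b) mod p = 0) as [C|C].
  { pose proof (Z.mod_pos_bound (a - b) p ltac:(lia)).
    pose proof (Z.mod_pos_bound (a + b) p ltac:(lia)).
    set (u := (a - b) mod p) in *. set (v := (a + b) mod p) in *. clearbody u v. clear E.
    assert (u = 0 \/ u = 1 \/ u = 2 \/ u = 3 \/ u = 4 \/ u = 5 \/ u = 6) as Cu by lia.
    destruct Hp as [-> | [-> | ->]]; decompose [or] Cu; subst u; divlia. }
  - apply multiple_of_mod0 in C as [s Hs]; [|lia]. exists 1, s. lia.
  - apply multiple_of_mod0 in C as [s Hs]; [|lia]. exists (-1), s. lia.
Qed.

Lemma inverse_mod7 t : t mod 7 <> 0 -> exists u q, u * t = 7 * q + 1.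
Proof.
  intros H. pose proof (Z.mod_pos_bound t 7). pose proof (Z.div_mod t 7).
  assert (t mod 7 = 1 \/ t mod 7 = 2 \/ t mod 7 = 3
    \/ t mod 7 = 4 \/ t mod 7 = 5 \/ t mod 7 = 6) as C by lia.
  destruct C as [C|[C|[C|[C|[C|C]]]]].
  - exists 1, (t / 7). lia.
  - exists 4, (4 * (t / 7) + 1). lia.
  - exists 5, (5 * (t / 7) + 2). lia.
  - exists 2, (2 * (t / 7) + 1). lia.
  - exists 3, (3 * (t / 7) + 2). lia.
  - exists 6, (6 * (t / 7) + 5). lia.
Qed.

Lemma inverse_mod5 t : t mod 5 <> 0 -> exists u q, u * t = 5 * q + 1.
Proof.
  intros H. pose proof (Z.mod_pos_bound t 5). pose proof (Z.div_mod t 5).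
  assert (t mod 5 = 1 \/ t mod 5 = 2 \/ t mod 5 = 3 \/ t mod 5 = 4) as C by lia.
  destruct C as [C|[C|[C|C]]].
  - exists 1, (t / 5). lia.
  - exists 3, (3 * (t / 5) + 1). lia.
  - exists 2, (2 * (t / 5) + 1). lia.
  - exists 4, (4 * (t / 5) + 3). lia.
Qed.

(** The form is anisotropic at 7: if 7 divides [t], then it divides [2x + y], and dividing by 7
    leaves [x^2 + z^2 = 0] modulo 7, where -1 is not a square. So a factor 7 cancels from all
    coordinates. *)
Lemma denominator_prime_to_7 M : forall t x y z, t <> 0 ->
    x * x + x * y + 2 * y * y + 7 * z * z = M * t * t ->
  exists x y z t, t mod 7 <> 0 /\ x * x + x * y + 2 * y * y + 7 * z * z = M * t * t.
Proof.
  intros t. induction t as [t IH] using (well_founded_induction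
    (well_founded_ltof Z Z.abs_nat)).
  intros x y z Ht E. destruct (Z.eq_dec (t mod 7) 0) as [H|H]; [|now exists x, y, z, t].
  destruct (multiple_of_mod0 t 7 eq_refl H) as [s ->].
  assert (exists w, 2 * x + y = 7 * w) as [w Hw].
  { apply multiple_of_mod0; [easy|].
    apply (square_mod7 _ (4 * (7 * M * s * s) - 4 * z * z - y * y)). lia. }
  assert (y = 7 * w - 2 * x) by lia. subst y. clear Hw H.
  destruct (sum_squares_mod7 x z (x * w - 2 * w * w + M * s * s)) as [Hx Hz].
  2:{ destruct (multiple_of_mod0 x 7 eq_refl Hx) as [x' ->].
      destruct (multiple_of_mod0 z 7 eq_refl Hz) as [z' ->].
      apply (IH s) with (x := x') (y := w - 2 * x') (z := z'); [unfold ltof; lia|lia|lia]. }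
  lia.
Qed.

(* The norm form x^2 + xy + 2y^2 of Z[(1 + sqrt(-7))/2] is (x + 4y)^2 modulo sqrt(-7).  For c with
   c t = x + 4y mod 7 the difference with c t is divisible by sqrt(-7); with c fixed, the quotient
   and z satisfy an equation in a euclidean form. *)
Lemma integral_seven M :
  (exists x y z t, t <> 0 /\ x * x + x * y + 2 * y * y + 7 * z * z = M * t * t) ->
  exists x y z, x * x + x * y + 2 * y * y + 7 * z * z = M.
Proof.
  intros (x0 & y0 & z0 & t0 & Ht0 & E0).
  destruct (denominator_prime_to_7 M t0 x0 y0 z0 Ht0 E0) as (x & y & z & t & Ht & E).
  clear x0 y0 z0 t0 Ht0 E0.
  destruct (inverse_mod7 t Ht) as (u & q & Hu).
  assert (t <> 0) as Ht0 by (intros ->; now apply Ht).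
  set (c := u * (x + 4 * y)).
  assert (Hc : c * t = x + 4 * y + 7 * (q * (x + 4 * y))).
  { unfold c. replace (u * (x + 4 * y) * t) with ((u * t) * (x + 4 * y)) by ring. rewrite Hu. ring. }
  clearbody c. set (r := q * (x + 4 * y)) in *. clearbody r.
  (* [M = c^2] modulo 7: multiply the equation by [u^2] and use [(u t)^2 = 1 + 7 (7 q^2 + 2 q)]. *)
  assert (exists M', M = c * c + 7 * M') as [M' ->].
  { exists (M * (- (7 * q * q + 2 * q)) - c * c * (- (7 * q * q + 2 * q))
      + u * u * (z * z - (x * y + 2 * (y * y)) - (2 * (x + 4 * y) * r + 7 * r * r))).
    assert (M * (u * t * (u * t)) - c * c * (u * t * (u * t)) =
      7 * (u * u * (z * z - (x * y + 2 * (y * y)) - (2 * (x + 4 * y) * r + 7 * r * r)))) as H.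
    { replace (M * (u * t * (u * t))) with (u * u * (M * t * t)) by ring.
      replace (c * c * (u * t * (u * t))) with (u * u * ((c * t) * (c * t))) by ring.
      rewrite <- E, Hc. ring. }
    rewrite Hu in H. lia. }
  destruct (adc_seven c M') as (u1 & v1 & z1 & E1).
  (* With omega = (1 + sqrt(-7)) / 2 this solves [x + y omega = c t + sqrt(-7) (u + v omega)] for
     [u] and [v]; the integral witness below is the same substitution with [t = 1]. *)
  - exists (c * t - x - 4 * (y + 2 * r)), (y + 2 * r), z, t. split; [assumption|].
    apply (Z.mul_cancel_l _ _ 7); [easy|].
    replace (7 * (M' * t * t)) with ((c * c + 7 * M') * t * t - (c * t) * (c * t)) by ring.
    rewrite <- E. replace (t * c * (y + 2 * r)) with ((c * t) * (y + 2 * r)) by ring.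
    rewrite Hc. ring.
  - exists (c - u1 - 4 * v1), (2 * u1 + v1), z1. rewrite <- E1. ring.
Qed.

(** Anisotropy at 5: 5 divides [x], and then [y^2 + 2z^2 = 0] modulo 5, where -2 is not a square. *)
Lemma denominator_prime_to_5 M : forall t x y z, t <> 0 ->
    x * x + 5 * (y * y) + 10 * (z * z) = M * t * t ->
  exists x y z t, t mod 5 <> 0 /\ x * x + 5 * (y * y) + 10 * (z * z) = M * t * t.
Proof.
  intros t. induction t as [t IH] using (well_founded_induction
    (well_founded_ltof Z Z.abs_nat)).
  intros x y z Ht E. destruct (Z.eq_dec (t mod 5) 0) as [H|H]; [|now exists x, y, z, t].
  destruct (multiple_of_mod0 t 5 eq_refl H) as [s ->].
  assert (exists w, x = 5 * w) as [w ->].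
  { apply multiple_of_mod0; [easy|].
    apply (square_double_mod5 x 0 (5 * M * s * s - y * y - 2 * z * z)). lia. }
  destruct (square_double_mod5 y z (M * s * s - w * w)) as [Hy Hz]; [lia|].
  destruct (multiple_of_mod0 y 5 eq_refl Hy) as [y' ->].
  destruct (multiple_of_mod0 z 5 eq_refl Hz) as [z' ->].
  apply (IH s) with (x := w) (y := y') (z := z'); [unfold ltof; lia|lia|lia].
Qed.

(* R = 2 c t + 5 (y + z) / 2, A = (y - 3 z) / 2, B = x + (y + z) / 2, where c is fixed by its class
   modulo 5. *)
Lemma integral_five N :
  (exists R A B t, t <> 0 /\ R * R + 5 * (A * A) + 10 * (B * B) = 6 * N * t * t) ->
  exists c x y z,
    3 * N = 2 * (c * c)
      + 5 * (x * x + y * y + 2 * z * z + x * y + y * z + x * z + c * (y + z)).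
Proof.
  intros (R0 & A0 & B0 & t0 & Ht0 & E0).
  destruct (denominator_prime_to_5 _ t0 R0 A0 B0 Ht0 E0) as (R & A & B & t & Ht & E).
  clear R0 A0 B0 t0 Ht0 E0.
  destruct (inverse_mod5 t Ht) as (u & q & Hu).
  assert (t <> 0) as Ht0 by (intros ->; now apply Ht).
  set (c := 3 * u * R). set (r := R + 6 * q * R).
  assert (Hc : 2 * (c * t) = R + 5 * r).
  { unfold c. replace (2 * (3 * u * R * t)) with (6 * (u * t) * R) by ring.
    rewrite Hu. unfold r. ring. }
  clearbody c r.
  assert (exists M', 3 * N = 2 * (c * c) + 5 * M') as [M' HM].
  { set (K := u * u * (A * A + 2 * (B * B) - 2 * R * r - 5 * r * r)
      - (6 * N - 4 * c * c) * (5 * q * q + 2 * q)).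
    exists (3 * K - (3 * N - 2 * c * c)).
    assert (6 * N * (u * t * (u * t)) - 4 * (c * c) * (u * t * (u * t)) =
      5 * (u * u * (A * A + 2 * (B * B) - 2 * R * r - 5 * r * r))) as H.
    { replace (6 * N * (u * t * (u * t))) with (u * u * (6 * N * t * t)) by ring.
      replace (4 * (c * c) * (u * t * (u * t)))
        with (u * u * ((2 * (c * t)) * (2 * (c * t)))) by ring.
      rewrite <- E, Hc. ring. }
    rewrite Hu in H. unfold K. lia. }
  destruct (adc_five c M') as (x & y & z & E1).
  - exists (4 * B + 4 * r), (2 * A - 6 * r), (- 2 * A - 2 * r), (4 * t). split; [lia|].
    apply (Z.mul_cancel_l _ _ 10); [easy|].
    replace (10 * (M' * (4 * t) * (4 * t))) 
      with (32 * (2 * (c * c) + 5 * M') * t * t - 16 * ((2 * (c * t)) * (2 * (c * t)))) by ring.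
    rewrite <- HM. replace (32 * (3 * N) * t * t) with (16 * (6 * N * t * t)) by ring. rewrite <- E.
    match goal with |- 10 * (?h + 4 * t * c * ?w) = _ =>
      replace (10 * (h + 4 * t * c * w)) with (10 * h + 20 * w * (2 * (c * t))) by ring end.
    rewrite Hc. ring.
  - exists c, x, y, z. rewrite E1. exact HM.
Qed.

(** * Integral solutions of the right type *)

Lemma even_or_odd (n : Z) : (exists k, n = 2 * k) \/ (exists k, n = 2 * k + 1).
Proof.
  destruct (Z.eq_dec (n mod 2) 0); [left|right]; exists (n / 2);
    pose proof (Z.div_mod n 2); pose proof (Z.mod_pos_bound n 2); lia.
Qed.

Lemma mod3_cases (n : Z) :
  (exists k, n = 3 * k) \/ (exists k, n = 3 * k + 1) \/ (exists k, n = 3 * k - 1).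
Proof.
  pose proof (Z.div_mod n 3); pose proof (Z.mod_pos_bound n 3).
  assert (n mod 3 = 0 \/ n mod 3 = 1 \/ n mod 3 = 2) as [H1|[H1|H1]] by lia.
  - left. exists (n / 3). lia.
  - right; left. exists (n / 3). lia.
  - right; right. exists (n / 3 + 1). lia.
Qed.

Lemma mod4_odd_sign (a b : Z) : exists e k, (e = 1 \/ e = -1) /\ 2 * a + 1 = e * (2 * b + 1) + 4 * k.
Proof.
  destruct (even_or_odd (a - b)) as [[k H]|[k H]].
  - exists 1, k. lia.
  - exists (-1), (b + k + 1). lia.
Qed.

(* (R, A, B) = (x - 3y, x + y, 2z) satisfies R^2 + 7A^2 + 14B^2 = 24M; the witnesses are its images
   under rational similitudes of denominators 3 and 12. *)
Lemma ternary_seven (M : Z) :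
  (exists x y z, x * x + x * y + 2 * y * y + 7 * z * z = 3 * M) ->
  exists r q t, 3 * (r * r) + 7 * (q * q) + 14 * (t * t) = 8 * M.
Proof.
  intros (x & y & z & E).
  (* Modulo 3 the form is [x (x + y) - y^2 + z^2], which vanishes only if 3 divides [x (x + y)];
     then [z^2 = y^2], whence the sign [e]. The conjugation [x -> - x - y] exchanges the two
     cases. *)
  assert ((exists k, x = 3 * k) \/ (exists a, x + y = 3 * a)) as [[k ->]|[a Ha]].
  { destruct (mod3_cases x) as [[i ->]|[[i ->]|[i ->]]]; [left; now exists i| |];
    destruct (mod3_cases y) as [[j ->]|[[j ->]|[j ->]]]; 
    destruct (mod3_cases z) as [[l ->]|[[l ->]|[l ->]]]; try (exfalso; lia);
    right; exists (i + j); lia. }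
  - destruct (square_congr 3 y z (y * y + 2 * z * z - M + 3 * k * k + k * y))
      as (e & s & He & ->); [auto|lia|].
    exists (k - (e * z + 3 * s)), (- (k + s + e * z) + e * (2 * z)), (- (k + s + e * z)).
    destruct He as [-> | ->]; lia.
  - assert (x = 3 * a - y) by lia. subst x.
    destruct (square_congr 3 y z (y * y + 2 * z * z - M + 3 * a * a - a * y))
      as (e & s & He & ->); [auto|lia|].
    exists (- a - (e * z + 3 * s)), (- a + (s + e * z) - 2 * e * z), (- a + (s + e * z)).
    destruct He as [-> | ->]; lia.
Qed.

(* (r, q) -> (r - 5q, 3r + q) multiplies 3r^2 + 5q^2 by 16: it is multiplication of
   3r + q sqrt(-15) by 1 + sqrt(-15). *)
Lemma binary_quarter (E r q : Z) : 3 * (r * r) + 5 * (q * q) = 4 * (8 * E) ->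
  exists r q, 3 * (r * r) + 5 * (q * q) = 8 * E.
Proof.
  intros H. destruct (even_or_odd r) as [[a ->]|[a ->]]; destruct (even_or_odd q) as [[b ->]|[b ->]].
  - exists a, b. lia.
  - exfalso. lia.
  - exfalso. lia.
  (* For odd [r] and [q = e r + 4k] the equation forces [k] odd, and then the map above, conjugated
     if [e = -1], has both coordinates divisible by 8. *)
  - destruct (mod4_odd_sign b a) as (e & k & He & Hk).
    assert (H' : 3 * ((2 * a + 1) * (2 * a + 1))
       + 5 * ((e * (2 * a + 1) + 4 * k) * (e * (2 * a + 1) + 4 * k)) = 4 * (8 * E))
      by (rewrite <- Hk; exact H).
    clear H Hk b. destruct (even_or_odd k) as [[l ->]|[l ->]].
    + exfalso. destruct He as [-> | ->]; lia.
    + destruct He as [-> | ->].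
      * exists (- a - 3 - 5 * l), (a + l + 1). lia.
      * exists (a - 2 - 5 * l), (- a + l). lia.
Qed.

(** Induction by factors 4. For [E = 4F] an odd solution for [F] is multiplied by (1 + sqrt(-15)) /
    2, of norm 4, after a choice of the sign of [q] modulo 4 that keeps the result odd. If 4 does
    not divide [E], an even solution is rotated by (1 + sqrt(-15)) / 4, of norm 1. *)
Lemma binary_odd (E : Z) : 0 < E -> (exists r q, 3 * (r * r) + 5 * (q * q) = 8 * E) ->
  exists r q, 3 * ((2 * r + 1) * (2 * r + 1)) + 5 * ((2 * q + 1) * (2 * q + 1)) = 8 * E.
Proof.
  induction E as [E IH] using (well_founded_induction (Zwf_well_founded 0)).
  intros HE (r & q & H).
  destruct (even_or_odd r) as [[a ->]|[a ->]]; destruct (even_or_odd q) as [[b ->]|[b ->]];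
    [| exfalso; lia | exfalso; lia | now exists a, b].
  assert (H' : 3 * (a * a) + 5 * (b * b) = 2 * E) by lia. clear H.
  assert (Step : forall F, E = 4 * F ->
    exists r q, 3 * ((2 * r + 1) * (2 * r + 1)) + 5 * ((2 * q + 1) * (2 * q + 1)) = 8 * E).
  { intros F ->. destruct (IH F) as (r & q & H); [unfold Zwf; lia|lia|exists a, b; lia|].
    clear IH H' a b. destruct (mod4_odd_sign q (- r - 1)) as (e & k & He & Hk). rewrite Hk in H.
    destruct He as [-> | ->].
    - exists (3 * r + 1 - 5 * k), (r + k). lia.
    - exists (- 3 * r - 2 - 5 * k), (- r - 1 + k). lia. }
  clear IH.
  destruct (even_or_odd a) as [[c ->]|[c ->]]; destruct (even_or_odd b) as [[d ->]|[d ->]];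
    [| exfalso; lia | exfalso; lia |].
  - destruct (even_or_odd c) as [[i ->]|[i ->]]; destruct (even_or_odd d) as [[j ->]|[j ->]].
    + apply (Step (6 * i * i + 10 * j * j)). lia.
    + exists (i - 5 * j - 3), (3 * i + j). lia.
    + exists (i - 5 * j), (3 * i + j + 1). lia.
    + apply (Step (6 * i * i + 6 * i + 10 * j * j + 10 * j + 4)). lia.
  - destruct (even_or_odd (3 * c * c + 3 * c + 5 * d * d + 5 * d)) as [[l Hl]|[l Hl]].
    + apply (Step (l + 1)). lia.
    + exfalso.
      pose proof (even_or_odd c) as [[i ->]|[i ->]]; pose proof (even_or_odd d) as [[j ->]|[j ->]]; lia.
Qed.

(** * Rational similitudes selected by residue classes *)

Definition vec3 : Set := (Z * Z * Z)%type.

Definition dot (u v : vec3) : Z :=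
  let '(a, b, c) := u in let '(x, y, z) := v in a * x + b * y + c * z.

Definition form (v : vec3) : Z :=
  let '(x, y, z) := v in x * x + 5 * (y * y) + 10 * (z * z).

(* The rows r, q, t of similitudes from R^2 + 5A^2 + 10B^2 to 3r^2 + 5q^2 + 40t^2, found by search: when
   the former is 24N with N = 5 mod 8 prime to 3, one of them has t an odd multiple of 48 and r, q
   divisible by 3. *)
Definition similitudes : list (vec3 * vec3 * vec3) :=
  (((16, 0, 0), (0, -16, 32), (0, -8, -8)) ::
   ((16, 0, 0), (0, -16, -32), (0, -8, 8)) ::
   ((4, 20, -40), (-4, -20, -24), (-4, 4, 0)) ::
   ((4, -20, -40), (-4, 20, -24), (-4, -4, 0)) ::
   ((6, 30, 20), (-10, 14, -12), (-2, -2, 12)) ::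
   ((6, 30, -20), (-10, 14, 12), (-2, -2, -12)) ::
   ((6, -30, -20), (-10, -14, 12), (-2, 2, -12)) ::
   ((1, 5, 50), (-9, 19, -2), (-3, -7, 2)) ::
   ((1, 5, -50), (-9, 19, 2), (-3, -7, -2)) :: nil)%list.

Lemma similitude_form (r q t v : vec3) : In (r, q, t) similitudes ->
  3 * (dot r v * dot r v) + 5 * (dot q v * dot q v) + 40 * (dot t v * dot t v) = 768 * form v.
Proof.
  destruct v as [[x y] z]. intros H.
  repeat (destruct H as [H|H]; [injection H as <- <- <-; unfold dot, form; ring|]). destruct H.
Qed.

Definition good_at_2 (v : vec3) (s : vec3 * vec3 * vec3) : bool :=
  let '(r, q, t) := s in dot t v mod 32 =? 16.

Definition good_at_3 (v : vec3) (s : vec3 * vec3 * vec3) : bool :=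
  let '(r, q, t) := s in (dot r v mod 3 =? 0) && (dot q v mod 3 =? 0) && (dot t v mod 3 =? 0).

Definition range (n : nat) : list Z := map Z.of_nat (seq 0 n).

Definition check_at_3 (l : list (vec3 * vec3 * vec3)) : bool :=
  forallb (fun x => forallb (fun y => forallb (fun z =>
    if form (x, y, z) mod 3 =? 0 then
      if ((x =? 0) && (y =? 0) && (z =? 0))%bool then true else existsb (good_at_3 (x, y, z)) l
    else true) (range 3)) (range 3)) (range 3).

(** [24N = 56] modulo 64 when [N = 5] modulo 8, and the form modulo 64 depends only on [v] modulo
    32. The classes with [y = x] modulo 4 and [z = x] modulo 2 are those that the substitution for
    [(R, A, B)] produces. Running the check at 3 on the similitudes that survive at 2 yields a
    single one good at both. *)
Lemma check_at_2 :
  forallb (fun x => forallb (fun i => forallb (fun j =>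
    let v := (x, x mod 4 + 4 * i, x mod 2 + 2 * j) in
    if form v mod 64 =? 56 then check_at_3 (filter (good_at_2 v) similitudes) else true)
    (range 16)) (range 8)) (range 32) = true.
Proof. vm_compute. reflexivity. Qed.

Lemma forallb_range (n : nat) (P : Z -> bool) : forallb P (range n) = true ->
  forall x, 0 <= x < Z.of_nat n -> P x = true.
Proof.
  intros H x Hx. rewrite forallb_forall in H. apply H, in_map_iff.
  exists (Z.to_nat x). split; [lia|]. apply in_seq. lia.
Qed.

Lemma check_at_2_elim (x y z : Z) : 0 <= x < 32 -> 0 <= y < 32 -> 0 <= z < 32 ->
  (x - y) mod 4 = 0 -> (x - z) mod 2 = 0 -> form (x, y, z) mod 64 = 56 ->
  check_at_3 (filter (good_at_2 (x, y, z)) similitudes) = true.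
Proof.
  intros Hx Hy Hz H4 H2 HF.
  pose proof (forallb_range _ _ check_at_2 x Hx) as C. cbv beta in C.
  assert (Hy' : 0 <= y / 4 < 8) by divlia. assert (Hz' : 0 <= z / 2 < 16) by divlia.
  pose proof (forallb_range _ _ (forallb_range _ _ C (y / 4) Hy') (z / 2) Hz') as D.
  cbv beta zeta in D. clear C.
  replace (x mod 4 + 4 * (y / 4)) with y in D by divlia.
  replace (x mod 2 + 2 * (z / 2)) with z in D by divlia.
  rewrite HF in D. exact D.
Qed.

Lemma check_at_3_elim (l : list (vec3 * vec3 * vec3)) (x y z : Z) : check_at_3 l = true ->
  0 <= x < 3 -> 0 <= y < 3 -> 0 <= z < 3 -> form (x, y, z) mod 3 = 0 ->
  ~ (x = 0 /\ y = 0 /\ z = 0) -> exists s, In s l /\ good_at_3 (x, y, z) s = true.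
Proof.
  intros C Hx Hy Hz HF H0. apply existsb_exists.
  pose proof (forallb_range _ _ C x Hx) as D. cbv beta in D.
  pose proof (forallb_range _ _ (forallb_range _ _ D y Hy) z Hz) as D'.
  cbv beta in D'. rewrite HF in D'.
  destruct ((x =? 0) && (y =? 0) && (z =? 0))%bool eqn:E; [exfalso; lia|exact D'].
Qed.

Definition mod3v (m : Z) (v : vec3) : vec3 := let '(x, y, z) := v in (x mod m, y mod m, z mod m).

Lemma dot_mod (u v : vec3) (m : Z) : m <> 0 -> dot u (mod3v m v) mod m = dot u v mod m.
Proof.
  intros Hm. destruct u as [[a b] c], v as [[x y] z]. unfold dot, mod3v.
  rewrite (Z.div_mod x m), (Z.div_mod y m), (Z.div_mod z m) at 2 by assumption.
  rewrite <- (Z_mod_plus_full _ (a * (x / m) + b * (y / m) + c * (z / m))). f_equal. ring.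
Qed.

Lemma form_mod_32 (v : vec3) : form (mod3v 32 v) mod 64 = form v mod 64.
Proof.
  destruct v as [[x y] z]. unfold form, mod3v.
  pose proof (Z.div_mod x 32 ltac:(easy)) as Hx. pose proof (Z.div_mod y 32 ltac:(easy)) as Hy.
  pose proof (Z.div_mod z 32 ltac:(easy)) as Hz.
  set (i := x / 32) in *; set (j := y / 32) in *; set (k := z / 32) in *.
  set (a := x mod 32) in *; set (b := y mod 32) in *; set (c := z mod 32) in *.
  clearbody a b c i j k. subst x y z.
  rewrite <- (Z_mod_plus_full (a * a + _ + _) (i * a + 16 * i * i + 5 * (j * b + 16 * j * j)
    + 10 * (k * c + 16 * k * k))).
  f_equal. ring.
Qed.

Lemma form_mod_3 (v : vec3) : form (mod3v 3 v) mod 3 = form v mod 3.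
Proof.
  destruct v as [[x y] z]. unfold form, mod3v.
  pose proof (Z.div_mod x 3 ltac:(easy)) as Hx. pose proof (Z.div_mod y 3 ltac:(easy)) as Hy.
  pose proof (Z.div_mod z 3 ltac:(easy)) as Hz.
  set (i := x / 3) in *; set (j := y / 3) in *; set (k := z / 3) in *.
  set (a := x mod 3) in *; set (b := y mod 3) in *; set (c := z mod 3) in *.
  clearbody a b c i j k. subst x y z.
  rewrite <- (Z_mod_plus_full (a * a + _ + _) (2 * i * a + 3 * i * i + 5 * (2 * j * b + 3 * j * j)
    + 10 * (2 * k * c + 3 * k * k))).
  f_equal. ring.
Qed.

Lemma similitude_exists (x y z : Z) :
  (x - y) mod 4 = 0 -> (x - z) mod 2 = 0 -> form (x, y, z) mod 64 = 56 ->
  form (x, y, z) mod 3 = 0 -> ~ (x mod 3 = 0 /\ y mod 3 = 0 /\ z mod 3 = 0) ->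
  exists s, In s similitudes /\ good_at_2 (x, y, z) s = true /\ good_at_3 (x, y, z) s = true.
Proof.
  intros H4 H2 F2 F3 N3.
  assert (C : check_at_3 (filter (good_at_2 (mod3v 32 (x, y, z))) similitudes) = true).
  { apply check_at_2_elim; try (apply Z.mod_pos_bound; easy); try divlia.
    rewrite <- F2. apply (form_mod_32 (x, y, z)). }
  destruct (check_at_3_elim _ (x mod 3) (y mod 3) (z mod 3) C) as ([[r q] t] & Hs & G3);
    try (apply Z.mod_pos_bound; easy); try assumption.
  { rewrite <- F3. apply (form_mod_3 (x, y, z)). }
  apply filter_In in Hs as [Hs G2]. exists (r, q, t). split; [assumption|].
  unfold good_at_2, good_at_3 in *. split.
  - rewrite <- (dot_mod t (x, y, z) 32) by discriminate. exact G2.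
  - rewrite <- (dot_mod r (x, y, z) 3), <- (dot_mod q (x, y, z) 3), <- (dot_mod t (x, y, z) 3)
      by discriminate.
    exact G3.
Qed.

(** A good similitude, divided by 3, gives [3r^2 + 5q^2 = 4^5 (2N - 10T^2)] with [T] odd. Five uses
    of [binary_quarter] remove [4^5], and [binary_odd] makes the other two coordinates odd. The
    value is not 0 because 5 does not divide [N]; [(R, A, B)] is not 0 modulo 3 because 9 would then
    divide [24N]. *)
Lemma ternary_five (N : Z) : N mod 8 = 5 -> N mod 3 <> 0 -> N mod 5 <> 0 ->
  (exists c x y z, 3 * N = 2 * (c * c)
      + 5 * (x * x + y * y + 2 * z * z + x * y + y * z + x * z + c * (y + z))) ->
  exists r q t, 3 * ((2 * r + 1) * (2 * r + 1)) + 5 * ((2 * q + 1) * (2 * q + 1))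
    + 10 * ((2 * t + 1) * (2 * t + 1)) = 2 * N.
Proof.
  intros N8 N3 N5 (c & x & y & z & H).
  set (R := 4 * c + 5 * (y + z)). set (A := y - 3 * z). set (B := 2 * x + y + z).
  assert (HN : form (R, A, B) = 24 * N).
  { unfold form, R, A, B. replace (24 * N) with (8 * (3 * N)) by ring. rewrite H. ring. }
  destruct (similitude_exists R A B) as ([[r q] t] & Hs & G2 & G3).
  { replace (R - A) with ((c + y + 2 * z) * 4) by (unfold R, A; ring). apply Z_mod_mult. }
  { replace (R - B) with ((2 * c + 2 * y + 2 * z - x) * 2) by (unfold R, B; ring). apply Z_mod_mult. }
  { rewrite HN. divlia. }
  { rewrite HN. divlia. }
  { intros (HR & HA & HB). apply N3.
    apply multiple_of_mod0 in HR as [i Hi], HA as [j Hj], HB as [k Hk]; try easy.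
    assert (E : 9 * (i * i + 5 * (j * j) + 10 * (k * k)) = 24 * N).
    { rewrite <- HN. unfold form. rewrite Hi, Hj, Hk. ring. }
    divlia. }
  pose proof (similitude_form r q t (R, A, B) Hs) as F. rewrite HN in F.
  unfold good_at_2, good_at_3 in *.
  set (dr := dot r (R, A, B)) in *. set (dq := dot q (R, A, B)) in *. set (dt := dot t (R, A, B)) in *.
  clearbody dr dq dt. clear Hs r q t HN. clearbody R A B.
  assert (exists r, dr = 3 * r) as [r ->] by (apply multiple_of_mod0; lia).
  assert (exists q, dq = 3 * q) as [q ->] by (apply multiple_of_mod0; lia).
  assert (exists t, dt = 3 * (16 * (2 * t + 1))) as [t ->].
  { exists (dt / 96). divlia. }
  assert (F' : 3 * (r * r) + 5 * (q * q) = 1024 * (2 * N - 10 * ((2 * t + 1) * (2 * t + 1)))) by lia.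
  assert (exists E, 2 * N - 10 * ((2 * t + 1) * (2 * t + 1)) = 8 * E) as [E HE].
  { exists ((N - 5) / 4 - 5 * (t * (t + 1))). divlia. }
  rewrite HE in F'.
  destruct (binary_quarter (4 * (4 * (4 * (4 * E)))) r q) as (r1 & q1 & F1); [lia|].
  destruct (binary_quarter (4 * (4 * (4 * E))) r1 q1) as (r2 & q2 & F2); [lia|].
  destruct (binary_quarter (4 * (4 * E)) r2 q2) as (r3 & q3 & F3); [lia|].
  destruct (binary_quarter (4 * E) r3 q3) as (r4 & q4 & F4); [lia|].
  destruct (binary_quarter E r4 q4) as (r5 & q5 & F5); [lia|].
  assert (E <> 0). { intros ->. apply N5. divlia. }
  destruct (binary_odd E) as (r6 & q6 & F6).
  { pose proof (Z.square_nonneg r5). pose proof (Z.square_nonneg q5). lia. }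
  { now exists r5, q5. }
  exists r6, q6, t. lia.
Qed.

(** * Small values *)

Lemma p5_double (k : Z) : 2 * p5 k = k * (3 * k - 1).
Proof.
  unfold p5. assert (exists j, k * (3 * k - 1) = 2 * j) as [j ->].
  { pose proof (Z.div_mod k 2 ltac:(easy)) as H. pose proof (Z.mod_pos_bound k 2 ltac:(easy)).
    assert (k mod 2 = 0 \/ k mod 2 = 1) as [E|E] by lia; rewrite E in H.
    - exists ((k / 2) * (3 * k - 1)). rewrite H at 1. ring.
    - exists (k * (3 * (k / 2) + 1)). rewrite H at 2. ring. }
  rewrite (Z.mul_comm 2 j), Z.div_mul; lia.
Qed.

(* The bits of [pentagonal_shifts c K X] are the sums of c p5(k), k < K, and a bit of X. *)
Definition pentagonal_shifts (c : Z) (K : nat) (X : Z) : Z :=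
  fold_right (fun k acc => Z.lor (Z.shiftl X (c * p5 k)) acc) 0 (range K).

Lemma pentagonal_shifts_spec (c : Z) (K : nat) (X n : Z) :
  Z.testbit (pentagonal_shifts c K X) n = true ->
  exists k, 0 <= k /\ Z.testbit X (n - c * p5 k) = true.
Proof.
  unfold pentagonal_shifts. intros H.
  assert (Hk : forall k, In k (range K) -> 0 <= k).
  { intros k Hk. apply in_map_iff in Hk as (i & <- & _). lia. }
  destruct (Z_lt_le_dec n 0) as [Hn|Hn]; [now rewrite Z.testbit_neg_r in H|].
  induction (range K) as [|k l IH]; simpl in H; [now rewrite Z.testbit_0_l in H|].
  rewrite Z.lor_spec, Z.shiftl_spec in H by assumption. apply Bool.orb_prop in H as [H|H].
  - exists k. split; [apply Hk; now left|assumption].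
  - apply IH; [assumption|]. intros i Hi. apply Hk. now right.
Qed.

Definition ternary_bits (K L : nat) : Z :=
  pentagonal_shifts 2 L (pentagonal_shifts 1 K (pentagonal_shifts 1 K 1)).

Lemma ternary_bits_spec (K L : nat) (n : Z) : Z.testbit (ternary_bits K L) n = true ->
  exists w x y, 0 <= w /\ 0 <= x /\ 0 <= y /\ n = p5 w + p5 x + 2 * p5 y.
Proof.
  intros H. apply pentagonal_shifts_spec in H as (y & Hy & H).
  apply pentagonal_shifts_spec in H as (x & Hx & H).
  apply pentagonal_shifts_spec in H as (w & Hw & H).
  exists w, x, y. repeat split; try assumption.
  destruct (Z.eq_dec (n - 2 * p5 y - 1 * p5 x - 1 * p5 w) 0) as [E|E]; [lia|].
  destruct (Z_lt_le_dec (n - 2 * p5 y - 1 * p5 x - 1 * p5 w) 0) as [E'|E'].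
  - now rewrite Z.testbit_neg_r in H.
  - rewrite Z.bits_above_log2 in H; [discriminate|lia|change (Z.log2 1) with 0; lia].
Qed.

Lemma testbit_of_land (X a b n : Z) : Z.land (Z.shiftr X a) (Z.ones b) = Z.ones b ->
  0 <= a <= n -> n < a + b -> Z.testbit X n = true.
Proof.
  intros H Ha Hb. assert (T : Z.testbit (Z.ones b) (n - a) = true).
  { apply Z.ones_spec_low. lia. }
  rewrite <- H, Z.land_spec in T.
  rewrite Z.shiftr_spec in T by lia.
  apply Bool.andb_true_iff in T as [T _]. now replace (n - a + a) with n in T by ring.
Qed.

(** The ranges exhaust the terms below 8000, since [p5 74] and [2 * p5 53] exceed it. *)
Lemma ternary_run : Z.land (Z.shiftr (ternary_bits 75 54) 3794) (Z.ones 4206) = Z.ones 4206.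
Proof. vm_compute. reflexivity. Qed.

Lemma quaternary_run (delta : Z) : delta = 1 \/ delta = 2 ->
  Z.land (Z.shiftr (pentagonal_shifts (3 * delta) 4 (ternary_bits 75 54)) 0) (Z.ones 8000) = Z.ones 8000.
Proof. intros [-> | ->]; vm_compute; reflexivity. Qed.

Lemma small_case (delta n : Z) : delta = 1 \/ delta = 2 -> 0 <= n < 250000 ->
  exists w x y z : Z, 0 <= w /\ 0 <= x /\ 0 <= y /\ 0 <= z /\
    n = p5 w + p5 x + 2 * p5 y + 3 * delta * p5 z.
Proof.
  intros Hd Hn.
  assert (Combine : forall z, 0 <= z -> Z.testbit (ternary_bits 75 54) (n - 3 * delta * p5 z) = true ->
    exists w x y z : Z, 0 <= w /\ 0 <= x /\ 0 <= y /\ 0 <= z /\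
    n = p5 w + p5 x + 2 * p5 y + 3 * delta * p5 z).
  { intros z Hz H. apply ternary_bits_spec in H as (w & x & y & Hw & Hx & Hy & E).
    exists w, x, y, z. lia. }
  destruct (Z_lt_le_dec n 8000) as [H|H].
  - pose proof (testbit_of_land _ _ _ n (quaternary_run delta Hd) ltac:(lia) ltac:(lia)) as B.
    apply pentagonal_shifts_spec in B as (z & Hz & B). now apply (Combine z).
  (* Consecutive shifts differ by [3 delta (3k + 1) <= 6 * 697 = 4182], less than the run length
     4206, so the translates of the run overlap. At [k = 233] they pass 250000 already for
     [delta = 1]. *)
  - assert (L : forall k : nat, (k <= 233)%nat -> n < 8000 + 3 * delta * p5 (Z.of_nat k) ->
      exists z, 0 <= z /\ 3794 <= n - 3 * delta * p5 z < 8000).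
    { induction k as [|k IH]; intros Hk Hb.
      - exfalso. change (p5 (Z.of_nat 0)) with 0 in Hb. lia.
      - destruct (Z_lt_le_dec n (8000 + 3 * delta * p5 (Z.of_nat k))) as [H1|H1]; [apply IH; lia|].
        exists (Z.of_nat (S k)). pose proof (p5_double (Z.of_nat k)).
        pose proof (p5_double (Z.of_nat (S k))).
        rewrite Nat2Z.inj_succ in *. unfold Z.succ in *.
        split; [lia|]. destruct Hd as [-> | ->]; lia. }
    pose proof (p5_double (Z.of_nat 233)).
    destruct (L 233%nat) as (z & Hz & B); [lia|destruct Hd as [-> | ->]; lia|].
    apply (Combine z Hz), (testbit_of_land _ 3794 4206 _ ternary_run); lia.
Qed.

(** * From ternary forms to pentagonal sums *)

(* If, say, w < 0, then b < x + 2y + 3dz, whose square is at most (3 + 3d) (x^2 + 2y^2 + 3dz^2) by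
   Cauchy-Schwarz. *)
Lemma nonneg_of_sums (d w x y z b : Z) : d = 1 \/ d = 2 -> 0 <= b ->
  w + x + 2 * y + 3 * d * z = b ->
  (3 + 3 * d) * (w * w + x * x + 2 * (y * y) + 3 * d * (z * z)) <= b * b ->
  0 <= w /\ 0 <= x /\ 0 <= y /\ 0 <= z.
Proof.
  intros Hd Hb E H.
  assert (P : forall k m e : Z, 0 < e <= 6 -> k < 0 -> b - e * k = m ->
    b * b < m * m) by (intros; nia).
  pose proof (Z.square_nonneg (w - x)). pose proof (Z.square_nonneg (w - y)).
  pose proof (Z.square_nonneg (w - z)). pose proof (Z.square_nonneg (x - y)).
  pose proof (Z.square_nonneg (x - z)). pose proof (Z.square_nonneg (y - z)).
  pose proof (Z.square_nonneg w). pose proof (Z.square_nonneg x).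
  pose proof (Z.square_nonneg y). pose proof (Z.square_nonneg z).
  repeat split.
  - destruct (Z_lt_le_dec w 0) as [L|L]; [exfalso|exact L].
    pose proof (P w (x + 2 * y + 3 * d * z) 1 ltac:(lia) L ltac:(lia)).
    destruct Hd as [-> | ->]; lia.
  - destruct (Z_lt_le_dec x 0) as [L|L]; [exfalso|exact L].
    pose proof (P x (w + 2 * y + 3 * d * z) 1 ltac:(lia) L ltac:(lia)).
    destruct Hd as [-> | ->]; lia.
  - destruct (Z_lt_le_dec y 0) as [L|L]; [exfalso|exact L].
    pose proof (P y (w + x + 3 * d * z) 2 ltac:(lia) L ltac:(lia)).
    destruct Hd as [-> | ->]; lia.
  - destruct (Z_lt_le_dec z 0) as [L|L]; [exfalso|exact L].
    pose proof (P z (w + x + 2 * y) (3 * d) ltac:(lia) L ltac:(lia)).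
    destruct Hd as [-> | ->]; lia.
Qed.

Lemma pentagonal_sum (d n a b : Z) : d = 1 \/ d = 2 -> 0 <= b -> 3 * a = 2 * n + b ->
  (3 + 3 * d) * a <= b * b ->
  (exists w x y z, w + x + 2 * y + 3 * d * z = b /\
    w * w + x * x + 2 * (y * y) + 3 * d * (z * z) = a) ->
  exists w x y z : Z, 0 <= w /\ 0 <= x /\ 0 <= y /\ 0 <= z /\
    n = p5 w + p5 x + 2 * p5 y + 3 * d * p5 z.
Proof.
  intros Hd Hb Ha Hab (w & x & y & z & E1 & E2). exists w, x, y, z.
  destruct (nonneg_of_sums d w x y z b) as (Hw & Hx & Hy & Hz); try assumption; [now rewrite E2|].
  do 4 (split; [assumption|]).
  pose proof (p5_double w). pose proof (p5_double x). pose proof (p5_double y). pose proof (p5_double z).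
  destruct Hd as [-> | ->]; lia.
Qed.

(** The variables are [r = w + x + 2y - 4z], [q = w + x - 2y], [t = w - x], with
    [b - r = (4 + 3d) z]; the three congruences say that this substitution can be inverted over the
    integers. *)
Lemma sums_of_ternary (d a b r q t z k j : Z) : d = 1 \/ d = 2 ->
  3 * d * (r * r) + (4 + 3 * d) * (q * q + 2 * (t * t)) = 4 * ((4 + 3 * d) * a - b * b) ->
  b - r = (4 + 3 * d) * z -> r - q = 4 * k -> r + q - 2 * t = 4 * j ->
  exists w x y z, w + x + 2 * y + 3 * d * z = b /\
    w * w + x * x + 2 * (y * y) + 3 * d * (z * z) = a.
Proof.
  intros Hd E Hz Hk Hj. exists (r + z - 2 * k - j), (z + j), (z + k), z.
  assert (q = r - 4 * k) by lia. assert (t = r - 2 * k - 2 * j) by lia.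
  assert (b = r + (4 + 3 * d) * z) by lia. subst q t b.
  destruct Hd as [-> | ->]; split; lia.
Qed.

(** Modulo 7 the equation reads [r^2 = b^2], so a sign makes [r = b]. The equation leaves only equal
    parities of [r], [q], [t]; in the odd case the sign of [q] gives [q = r] modulo 4. *)
Lemma sums_delta1 (a b M : Z) : 7 * a - b * b = 2 * M ->
  (exists r q t, 3 * (r * r) + 7 * (q * q) + 14 * (t * t) = 8 * M) ->
  exists w x y z, w + x + 2 * y + 3 * 1 * z = b /\
    w * w + x * x + 2 * (y * y) + 3 * 1 * (z * z) = a.
Proof.
  intros HM (r0 & q & t & E).
  destruct (square_congr 7 b r0 (8 * a - b * b - r0 * r0 - 2 * (q * q) - 4 * (t * t)))
    as (e & z & He & Hb); [auto|lia|].
  assert (exists r, r = e * r0) as [r Hr] by now exists (e * r0).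
  assert (E' : 3 * (r * r) + 7 * (q * q) + 14 * (t * t) = 8 * M)
    by (destruct He as [-> | ->]; lia).
  rewrite <- Hr in Hb. clear r0 E He Hr.
  destruct (even_or_odd r) as [[i ->]|[i ->]]; destruct (even_or_odd q) as [[j ->]|[j ->]];
    destruct (even_or_odd t) as [[l ->]|[l ->]]; try (exfalso; lia).
  - assert (exists k, i - j = 2 * k) as [k Hk].
    { destruct (even_or_odd (i - j)) as [H|[k H]]; [exact H|exfalso].
      assert (i = j + 2 * k + 1) by lia. subst i. lia. }
    apply (sums_of_ternary 1 a b (2 * i) (2 * j) (2 * l) z k (i - k - l)); lia.
  - destruct (mod4_odd_sign i j) as (f & k & Hf & Hk).
    apply (sums_of_ternary 1 a b (2 * i + 1) (f * (2 * j + 1)) (2 * l + 1) z k (i - k - l));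
      destruct Hf as [-> | ->]; lia.
Qed.

Lemma sums_delta2 (a b N : Z) : 10 * a - b * b = N -> b mod 2 = 1 ->
  (exists r q t, 3 * ((2 * r + 1) * (2 * r + 1)) + 5 * ((2 * q + 1) * (2 * q + 1))
    + 10 * ((2 * t + 1) * (2 * t + 1)) = 2 * N) ->
  exists w x y z, w + x + 2 * y + 3 * 2 * z = b /\
    w * w + x * x + 2 * (y * y) + 3 * 2 * (z * z) = a.
Proof.
  intros HN Hb2 (r0 & q & t & E).
  destruct (square_congr 5 b (2 * r0 + 1) (b * b + (2 * r0 + 1) * (2 * r0 + 1)
      + 2 * ((2 * q + 1) * (2 * q + 1)) + 4 * ((2 * t + 1) * (2 * t + 1)) - 8 * a))
    as (e & s & He & Hb); [auto|lia|].
  assert (exists r, 2 * r + 1 = e * (2 * r0 + 1)) as [r Hr].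
  { destruct He as [-> | ->]; [exists r0 | exists (- r0 - 1)]; lia. }
  assert (E' : 3 * ((2 * r + 1) * (2 * r + 1)) + 5 * ((2 * q + 1) * (2 * q + 1))
    + 10 * ((2 * t + 1) * (2 * t + 1)) = 2 * N) by (rewrite Hr; destruct He as [-> | ->]; lia).
  rewrite <- Hr in Hb. clear r0 E He Hr.
  (* [b] and [2r + 1] are both odd, so their congruence modulo 5 holds modulo [4 + 3 * 2 = 10]. *)
  assert (exists z, s = 2 * z) as [z ->].
  { destruct (even_or_odd s) as [H|[z H]]; [exact H|exfalso; divlia]. }
  destruct (mod4_odd_sign r q) as (f & k & Hf & Hk).
  apply (sums_of_ternary 2 a b (2 * r + 1) (f * (2 * q + 1)) (2 * t + 1) z k (r - k - t));
    destruct Hf as [-> | ->]; lia.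
Qed.

(** With [A = q + 2t] and [B = q - t], [3 (q^2 + 2t^2) = A^2 + 2B^2]; and [x^2 + xy + 2y^2] takes
    the value [2 ((3x)^2 + 7A^2)] at [(-4A, 3x + A)]. *)
Lemma ternary_seven_of_rational (M : Z) :
  (exists x q t X, X <> 0 /\ 3 * (x * x) + 7 * (q * q + 2 * (t * t)) = 2 * M * (X * X)) ->
  exists r q t, 3 * (r * r) + 7 * (q * q) + 14 * (t * t) = 8 * M.
Proof.
  intros (x & q & t & X & HX & E). apply ternary_seven, integral_seven.
  exists (- 4 * (q + 2 * t)), (3 * x + q + 2 * t), (2 * (q - t)), (2 * X).
  split; [lia|]. replace (3 * M * (2 * X) * (2 * X)) with (6 * (2 * M * (X * X))) by ring.
  rewrite <- E. ring.
Qed.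

Lemma ternary_five_of_rational (N : Z) : N mod 8 = 5 -> N mod 3 <> 0 -> N mod 5 <> 0 ->
  (exists x q t X, X <> 0 /\ 3 * (x * x) + 5 * (q * q + 2 * (t * t)) = 2 * N * (X * X)) ->
  exists r q t, 3 * ((2 * r + 1) * (2 * r + 1)) + 5 * ((2 * q + 1) * (2 * q + 1))
    + 10 * ((2 * t + 1) * (2 * t + 1)) = 2 * N.
Proof.
  intros N8 N3 N5 (x & q & t & X & HX & E). apply ternary_five; try assumption.
  apply integral_five. exists (3 * x), (q + 2 * t), (q - t), X.
  split; [assumption|]. replace (6 * N * X * X) with (3 * (2 * N * (X * X))) by ring.
  rewrite <- E. ring.
Qed.

(* Among four candidates with common difference 12 at most one is divisible by p and at most two have
   3 | a - b^2, since a then increases by 4. *)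
Lemma choose_b (d p n : Z) : d = 1 /\ p = 7 \/ d = 2 /\ p = 5 -> 250000 <= n ->
  exists a b, 3 * a = 2 * n + b /\ 0 <= b /\
    (3 + 3 * d) * a <= b * b < (4 + 3 * d) * a /\ a mod 4 = 2 * d - 1 /\
    b mod p <> 0 /\ (a - b * b) mod 3 <> 0.
Proof.
  intros Hdp Hn.
  (* With [3a = 2n + b] the lower bound on [b * b] becomes [3b (3b - (3 + 3d)) >= 18 (d + 1) n], so
     the interval for [b] starts near [s / 3]. *)
  set (s := Z.sqrt (18 * (d + 1) * n)).
  assert (Hs : s * s <= 18 * (d + 1) * n < (s + 1) * (s + 1)).
  { apply Z.sqrt_spec. nia. }
  assert (Hs0 : 0 <= s) by apply Z.sqrt_nonneg. clearbody s.
  assert (Hs1 : 3000 <= s /\ (d = 2 -> 3600 <= s)) by (split; [|intros ->]; nia).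
  set (b1 := s / 3 + (4 + 3 * d)).
  assert (Hb1 : s - 2 + 3 * (4 + 3 * d) <= 3 * b1 <= s + 3 * (4 + 3 * d)) by (unfold b1; divlia).
  clearbody b1.
  assert (Interval : forall b, b1 <= b <= b1 + 47 ->
    (3 + 3 * d) * (2 * n + b) <= 3 * (b * b) < (4 + 3 * d) * (2 * n + b)).
  { intros b Hb.
    assert (L : (s + 1) * (s + 1) <= 3 * b * (3 * b - (3 + 3 * d))) by (apply Z.mul_le_mono_nonneg; lia).
    assert (U : 3 * b * (3 * b - (4 + 3 * d))
        <= (s + 3 * (4 + 3 * d) + 141) * (s + 2 * (4 + 3 * d) + 141))
      by (apply Z.mul_le_mono_nonneg; lia).
    assert (V : (3 + 3 * d) * ((s + 3 * (4 + 3 * d) + 141) * (s + 2 * (4 + 3 * d) + 141))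
        < (4 + 3 * d) * (s * s)).
    { destruct Hdp as [[-> _]|[-> _]]; [clear - Hs1|clear - Hs1]; nia. }
    destruct Hdp as [[-> _]|[-> _]]; split; lia. }
  (* [27 (2d - 1) - 14n] is the class modulo 12 of those [b] for which 3 divides [2n + b] and the
     quotient [a] is [2d - 1] modulo 4. An offset of at most 11 and three steps of 12 stay within
     [b1 + 47]. *)
  set (b0 := b1 + (54 * d - 27 - 14 * n - b1) mod 12).
  assert (Hb0 : b1 <= b0 <= b1 + 11) by (unfold b0; divlia).
  assert (exists i, b0 = 54 * d - 27 - 14 * n + 12 * i) as [i Hi].
  { exists (- ((54 * d - 27 - 14 * n - b1) / 12)). unfold b0. divlia. }
  clearbody b0. set (a0 := 18 * d - 9 - 4 * n + 4 * i).
  assert (exists j, 0 <= j <= 3 /\ (b0 + 12 * j) mod p <> 0 /\ (a0 - b0 * b0 + 4 * j) mod 3 <> 0)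
    as (j & Hj & Hp & H3).
  { generalize (a0 - b0 * b0). intros u. clear - Hdp.
    assert (Hb : forall j k, (b0 + 12 * j) mod p = 0 -> (b0 + 12 * k) mod p = 0 ->
        1 <= k - j <= 3 -> False)
      by (intros j k; destruct Hdp as [[-> ->]|[-> ->]]; divlia).
    assert (Hu : forall j k, (u + 4 * j) mod 3 = 0 -> (u + 4 * k) mod 3 = 0 ->
        1 <= k - j <= 2 -> False)
      by (intros j k; divlia).
    destruct (Z.eq_dec ((u + 4 * 1) mod 3) 0) as [U1|U1].
    - destruct (Z.eq_dec ((b0 + 12 * 0) mod p) 0) as [B0|B0].
      + exists 2. repeat split; try lia; intros C; [apply (Hb 0 2)|apply (Hu 1 2)]; auto; lia.
      + exists 0. repeat split; try lia; try assumption. intros C. apply (Hu 0 1); auto; lia.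
    - destruct (Z.eq_dec ((b0 + 12 * 1) mod p) 0) as [B1|B1]; [|exists 1; lia].
      destruct (Z.eq_dec ((u + 4 * 2) mod 3) 0) as [U2|U2].
      + exists 3. repeat split; try lia; intros C; [apply (Hb 1 3)|apply (Hu 2 3)]; auto; lia.
      + exists 2. repeat split; try lia; try assumption. intros C. apply (Hb 1 2); auto; lia. }
  exists (a0 + 4 * j), (b0 + 12 * j). pose proof (Interval (b0 + 12 * j) ltac:(lia)) as HI.
  replace (2 * n + (b0 + 12 * j)) with (3 * (a0 + 4 * j)) in HI by (unfold a0; lia).
  repeat split; try assumption.
  - unfold a0. lia.
  - lia.
  - lia.
  - lia.
  - unfold a0. divlia.
  - replace (a0 + 4 * j - (b0 + 12 * j) * (b0 + 12 * j))
      with (a0 - b0 * b0 + 4 * j + (- 8 * j * b0 - 48 * j * j) * 3) by ring.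
    rewrite Z_mod_plus_full. exact H3.
Qed.

(** 1, 2, 4 are the nonzero squares modulo 7, and [6M = 3 (7a - b^2) = (2b)^2] there. Modulo 3,
    [2M = a - b^2]. *)
Lemma residues_delta1 (a b : Z) : 6 * a <= b * b < 7 * a -> a mod 4 = 1 -> b mod 2 = 1 ->
  b mod 7 <> 0 -> (a - b * b) mod 3 <> 0 ->
  exists M, 7 * a - b * b = 2 * M /\ 0 < M /\ M mod 2 = 1 /\ M mod 3 <> 0 /\
    (6 * M mod 7 = 1 \/ 6 * M mod 7 = 2 \/ 6 * M mod 7 = 4).
Proof.
  intros H H4 H2 H7 H3.
  assert (exists i, a = 4 * i + 1) as [i Hi] by (exists (a / 4); divlia).
  assert (exists j, b = 2 * j + 1) as [j Hj] by (exists (b / 2); divlia).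
  exists (14 * i + 3 - 2 * (j * j + j)). subst a.
  assert (Hb : b * b = 4 * (j * j + j) + 1) by (subst b; ring).
  repeat split; [lia|lia|divlia|divlia|].
  replace (6 * _) with (21 * (4 * i + 1) - 3 * (b * b)) by lia. clear - H7.
  assert (exists k r, b = 7 * k + r /\ 1 <= r <= 6) as (k & r & -> & Hr)
    by (exists (b / 7), (b mod 7); divlia).
  assert (r = 1 \/ r = 2 \/ r = 3 \/ r = 4 \/ r = 5 \/ r = 6) as C by lia.
  clear H7 Hr. decompose [or] C; subst r; divlia.
Qed.

(** Modulo 5, [6N = - 6b^2 = (2b)^2]; modulo 8, [10a = 6] and [b^2 = 1]. *)
Lemma residues_delta2 (a b N : Z) : 9 * a <= b * b < 10 * a -> a mod 4 = 3 -> b mod 2 = 1 ->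
  b mod 5 <> 0 -> (a - b * b) mod 3 <> 0 -> N = 10 * a - b * b ->
  0 < N /\ N mod 8 = 5 /\ N mod 3 <> 0 /\ N mod 5 <> 0 /\
    (6 * N mod 5 = 1 \/ 6 * N mod 5 = 4).
Proof.
  intros H H4 H2 H5 H3 ->.
  assert (exists i, a = 4 * i + 3) as [i ->] by (exists (a / 4); divlia).
  split; [lia|]. split; [|split; [divlia|]].
  - assert (exists j, b = 2 * j + 1) as [j ->] by (exists (b / 2); divlia).
    clear. destruct (even_or_odd j) as [[l ->]|[l ->]]; divlia.
  - clear - H5.
    assert (exists k r, b = 5 * k + r /\ 1 <= r <= 4) as (k & r & -> & Hr)
      by (exists (b / 5), (b mod 5); divlia).
    assert (r = 1 \/ r = 2 \/ r = 3 \/ r = 4) as C by lia.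
    clear H5 Hr. decompose [or] C; subst r; divlia.
Qed.

Close Scope Z_scope.
Delimit Scope Z_scope with BZ.

From mathcomp Require Import all_boot all_order all_algebra.
From mathcomp Require Import ring lra zify.
Set Implicit Arguments. Unset Strict Implicit. Unset Printing Implicit Defensive.
Import Order.TTheory GRing.Theory Num.Theory.
Local Open Scope ring_scope.

(** * Real characters *)

Section Abel.
Variable R : realFieldType.
Implicit Types f g : nat -> R.

Lemma abel_identity f g a b : (a <= b)%N ->
  \sum_(a <= i < b.+1) f i * g i = (\sum_(a <= i < b.+1) f i) * g b
    + \sum_(a <= i < b) (\sum_(a <= j < i.+1) f j) * (g i - g i.+1).
Proof.
elim: b => [|b IHb].
  by rewrite leqn0 => /eqP ->; rewrite !big_nat1 big_geq // addr0.
rewrite leq_eqVlt => /orP[/eqP ->|ab].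
  by rewrite !big_nat1 big_geq // addr0.
have ab' : (a <= b)%N by rewrite -ltnS.
have E1 F : \sum_(a <= i < b.+2) F i = \sum_(a <= i < b.+1) F i + F b.+1 :> R.
  by rewrite big_nat_recr // leqW.
have E2 F : \sum_(a <= i < b.+1) F i = \sum_(a <= i < b) F i + F b :> R.
  by rewrite big_nat_recr.
rewrite E1 IHb // E1 (E2 (fun i => _ * (g i - _))).
set S := \sum_(a <= i < b.+1) f i; set T := \sum_(a <= i < b) _; ring.
Qed.

Lemma abel_bound f g a b K : 0 <= K ->
    (forall i, (a <= i)%N -> g i.+1 <= g i) -> (forall i, (a <= i)%N -> 0 <= g i) ->
    (forall i, `|\sum_(a <= j < i) f j| <= K) ->
  `|\sum_(a <= i < b) f i * g i| <= K * g a.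
Proof.
move=> K0 gd g0 fK; case: b => [|b].
  by rewrite big_geq // normr0 mulr_ge0 // g0.
case: (leqP a b) => ab; last by rewrite big_geq // normr0 mulr_ge0 // g0.
rewrite abel_identity //; apply: (le_trans (ler_normD _ _)).
have -> : K * g a = K * g b + \sum_(a <= i < b) K * (g i - g i.+1).
  rewrite -mulr_sumr -mulrDr; congr (_ * _).
  under eq_bigr do rewrite -opprB; rewrite sumrN telescope_sumr //; ring.
apply: lerD.
  by rewrite normrM (ger0_norm (g0 b ab)) ler_wpM2r // g0.
apply: (le_trans (ler_norm_sum _ _ _)); rewrite big_nat [leRHS]big_nat.
apply: ler_sum => i /andP[ai _].
have gi : 0 <= g i - g i.+1 by rewrite subr_ge0 gd.
by rewrite normrM (ger0_norm gi) ler_wpM2r.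
Qed.

End Abel.

Section RealCharacters.
Variables (R : archiRealFieldType) (N : nat).
Hypothesis N_gt0 : (0 < N)%N.

Definition real_char (f : nat -> R) :=
  [/\ f 1%N = 1, {morph f : m n / (m * n)%N >-> m * n},
      forall n, f (n + N)%N = f n & forall n, [\/ f n = 0, f n = 1 | f n = -1]].

Lemma real_charM f g : real_char f -> real_char g -> real_char (fun n => f n * g n).
Proof.
move=> [f1 fM fN fv] [g1 gM gN gv]; split.
- by rewrite f1 g1 mulr1.
- by move=> m n; rewrite fM gM; ring.
- by move=> n; rewrite fN gN.
- move=> n; case: (fv n) => ->; case: (gv n) => ->;
  rewrite ?mul0r ?mulr0 ?mul1r ?mulr1 ?mulN1r ?opprK; by [constructor 1|constructor 2|constructor 3].
Qed.

Lemma real_char_norm f n : real_char f -> `|f n| <= 1.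
Proof. by case=> _ _ _ /(_ n)[]->; rewrite ?normr0 ?normrN ?normr1 ?ler01. Qed.

Lemma periodic_mod (f : nat -> R) n : (forall n, f (n + N)%N = f n) -> f (n %% N)%N = f n.
Proof.
move=> fN; rewrite [in RHS](divn_eq n N) addnC.
by elim: (n %/ N)%N => [|k IH]; rewrite ?mul0n ?addn0 // mulSn addnCA addnC fN.
Qed.

Lemma real_char_exp f n k : real_char f -> f (n ^ k)%N = f n ^+ k.
Proof.
case=> f1 fM _ _; elim: k => [|k IH]; first by rewrite expn0 f1.
by rewrite expnS fM IH exprS.
Qed.

Definition nonprincipal f := \sum_(0 <= i < N) f i = 0 :> R.

(* A value -1 at [a] makes the complete sum invariant under multiplication by -1. *)
Lemma nonprincipal_of f a : coprime a N -> real_char f -> f a = -1 -> nonprincipal f.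
Proof.
move=> cop chf fa; rewrite /nonprincipal.
have [f1 fM fN _] := chf.
rewrite big_mkord.
pose h (i : 'I_N) : 'I_N := Ordinal (ltn_pmod (a * i) N_gt0).
have hinj : injective h.
  move=> i j /(congr1 val) /= /eqP hij; apply/val_inj => /=.
  wlog lij : i j hij / (i <= j)%N.
    move=> H; case: (leqP i j) => [/(H _ _ hij)//|/ltnW lji].
    by apply/esym/H => //; rewrite eq_sym.
  move: hij; rewrite eq_sym eqn_mod_dvd ?leq_mul2l ?lij ?orbT // -mulnBr Gauss_dvdr 1?coprime_sym //.
  rewrite -eqn_mod_dvd // => /eqP; rewrite !modn_small //.
have E : \sum_(i < N) f i = - \sum_(i < N) f i.
  rewrite {1}(reindex_inj hinj) /= -sumrN; apply: eq_bigr => i _.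
  by rewrite periodic_mod // fM fa mulN1r.
lra.
Qed.

Lemma nonprincipal_block f n : real_char f -> nonprincipal f ->
  \sum_(0 <= i < N) f (n + i)%N = 0.
Proof.
case=> _ _ fN _ f0; elim: n => [|n IH]; first exact: f0.
rewrite -[RHS]IH; clear IH; case: N N_gt0 fN => // M _ fN.
rewrite [RHS]big_nat_recl // [LHS]big_nat_recr //= addn0 addSnnS fN addrC; congr (_ + _).
by apply: eq_bigr => i _; rewrite addSnnS.
Qed.

Lemma nonprincipal_partial f a b : real_char f -> nonprincipal f ->
  `|\sum_(a <= i < b) f i| <= N%:R.
Proof.
move=> chf f0.
have key k c : `|\sum_(0 <= i < k) f (c + i)%N| <= N%:R.
  elim/ltn_ind: k c => k IH c; case: (leqP k N) => kN.
    apply: (le_trans (ler_norm_sum _ _ _)).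
    apply: (@le_trans _ _ (\sum_(0 <= i < k) 1)).
      by apply: ler_sum => i _; apply: real_char_norm.
    by rewrite sumr_const_nat subn0 ler_nat.
  rewrite (big_cat_nat (n := N)) ?(ltnW kN) //= nonprincipal_block // add0r.
  rewrite -{1}[N]add0n big_addn.
  under eq_bigr do rewrite [(_ + N)%N]addnC addnA.
  by apply: IH; rewrite ltn_subrL N_gt0 (ltn_trans _ kN).
case: (leqP a b) => ab; last by rewrite big_geq ?normr0 // ltnW.
rewrite -{1}[a]add0n big_addn; under eq_bigr do rewrite addnC; exact: key.
Qed.

End RealCharacters.

(** * Divisor sums of a real character *)

Lemma sum_multiples (R : nmodType) (G : nat -> R) D d : (0 < d)%N ->
  \sum_(1 <= m < (D %/ d).+1) G (d * m)%N = \sum_(1 <= n < D.+1 | (d %| n)%N) G n.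
Proof.
move=> d0; elim: D => [|D IH]; first by rewrite div0n !big_geq.
rewrite divnS // [RHS]big_mkcond /= [RHS]big_nat_recr //= -big_mkcond /= -IH.
case: (boolP (d %| D.+1)%N) => dD /=; last by rewrite add0n addr0.
rewrite add1n big_nat_recr //=; congr (_ + G _).
have := divnK dD; rewrite divnS // dD add1n mulnC //.
Qed.

Lemma sum_divisor_pairs (R : nmodType) (F : nat -> nat -> R) D :
  \sum_(1 <= d < D.+1) \sum_(1 <= m < (D %/ d).+1) F d (d * m)%N
  = \sum_(1 <= n < D.+1) \sum_(1 <= d < D.+1 | (d %| n)%N) F d n.
Proof.
rewrite (exchange_big_dep_nat predT) //= [RHS]big_nat [LHS]big_nat.
apply: eq_bigr => d /andP[d0 _]; rewrite (sum_multiples (F d)) //.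
Qed.

Section DivisorSum.
Variables (R : archiRealFieldType) (N : nat) (f : nat -> R).
Hypothesis chf : real_char N f.

(** For [B >= n > 0] this is the Dirichlet convolution of 1 and [f]; a range independent of [n]
    allows the interchange of summations. *)
Definition divisor_sum B n := \sum_(1 <= d < B.+1 | (d %| n)%N) f d.

Lemma divisor_sum_bound B n : (0 < n)%N -> (n <= B)%N ->
  divisor_sum B n = divisor_sum n n.
Proof.
move=> n0 nB; rewrite /divisor_sum (big_cat_nat (n := n.+1)) //=.
rewrite [X in _ + X]big_nat_cond [X in _ + X]big1 ?addr0 // => d /andP[/andP[nd _] dn].
by have := dvdn_leq n0 dn; rewrite leqNgt nd.
Qed.

Lemma dvdn_prime_step p k m d : prime p -> coprime p m -> (0 < d)%N ->
  (d %| p ^ k.+1 * m)%N && ~~ (p ^ k.+1 %| d)%N = (d %| p ^ k * m)%N.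
Proof.
move=> pp cpm d0; apply/andP/idP => [[dn ndiv]|dn].
  have [e cpe de] := pfactor_coprime pp d0.
  have lek : (logn p d <= k)%N by rewrite leqNgt -pfactor_dvdn.
  rewrite de mulnC dvdn_mul ?dvdn_exp2l //.
  have : (e %| p ^ k.+1 * m)%N by apply: dvdn_trans dn; rewrite [X in (_ %| X)%N]de dvdn_mulr.
  by rewrite Gauss_dvdr // coprime_sym coprimeXl.
split; first by apply: dvdn_trans dn _; rewrite expnS -mulnA dvdn_mull.
apply/negP => /dvdn_trans/(_ dn); rewrite expnSr dvdn_pmul2l ?expn_gt0 ?prime_gt0 //.
by apply/negP; rewrite -prime_coprime.
Qed.

(** Induction on [k]: the divisors of [p ^ k.+1 * m] are those of [p ^ k * m] together with
    [p ^ k.+1 * e] for [e] dividing [m]. *)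
Lemma divisor_sum_mul p k m : prime p -> coprime p m -> (0 < m)%N ->
  divisor_sum (p ^ k * m) (p ^ k * m) = (\sum_(0 <= i < k.+1) f p ^+ i) * divisor_sum m m.
Proof.
move=> pp cpm m0; have [f1 fM _ _] := chf; have p0 := prime_gt0 pp.
elim: k => [|k IH]; first by rewrite big_nat1 expr0 mul1r expn0 mul1n.
rewrite [in RHS]big_nat_recr //= mulrDl -IH {IH}.
rewrite {1}/divisor_sum (bigID (fun d => p ^ k.+1 %| d)%N) /= addrC; congr (_ + _).
  rewrite -(divisor_sum_bound (B := p ^ k.+1 * m)) ?muln_gt0 ?expn_gt0 ?p0 //; last first.
    by rewrite leq_mul2r leq_pexp2l ?orbT.
  rewrite /divisor_sum big_nat_cond [RHS]big_nat_cond; apply: eq_bigl => d.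
  by case: (posnP d) => [->//|d0]; rewrite dvdn_prime_step.
under eq_bigl do rewrite andbC.
rewrite big_mkcondr /= -(sum_multiples (fun n => if (n %| p ^ k.+1 * m)%N then f n else 0)); last first.
  by rewrite expn_gt0 p0.
rewrite mulKn ?expn_gt0 ?p0 // /divisor_sum mulr_sumr [RHS]big_mkcond /=.
apply: eq_bigr => e _; rewrite dvdn_pmul2l ?expn_gt0 ?p0 //.
by rewrite fM (real_char_exp _ _ chf).
Qed.

(** With [k] one more than an exponent this is the local factor of the divisor sum; squares have
    even exponents, hence the clause for odd [k]. *)
Lemma geometric_char p k : 0 <= \sum_(0 <= i < k) f p ^+ i /\
  (odd k -> 1 <= \sum_(0 <= i < k) f p ^+ i).
Proof.
have [_ _ _ /(_ p)[]->] := chf.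
- case: k => [|k]; first by rewrite big_geq.
  rewrite big_nat_recl // expr0 big1 ?addr0 ?ler01 // => i _; exact: expr0n.
- under eq_bigr do rewrite expr1n; rewrite sumr_const_nat subn0 ler0n; split=> //.
  by case: k => // k _; rewrite ler1n.
- suff -> : \sum_(0 <= i < k) (-1) ^+ i = (odd k)%:R :> R by case: (odd k); rewrite ?ler01.
  elim: k => [|k IH]; first by rewrite big_geq.
  rewrite big_nat_recr //= IH -signr_odd; case: (odd k); rewrite ?expr1 ?expr0 ?add0r ?subrr //.
Qed.

Lemma divisor_sum_ge0 n : (0 < n)%N -> 0 <= divisor_sum n n.
Proof.
elim/ltn_ind: n => n IH n0; case: (leqP n 1) => n1.
  have -> : n = 1%N by apply/eqP; rewrite eqn_leq n1 n0.
  by rewrite /divisor_sum big_mkcond big_nat1 /=; have [-> _ _ _] := chf; apply: ler01.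
have pp := pdiv_prime n1; have [m cpm nm] := pfactor_coprime pp n0.
have k0 : (0 < logn (pdiv n) n)%N by rewrite logn_gt0 mem_primes pp n0 pdiv_dvd.
have m0 : (0 < m)%N by move: n0; rewrite nm muln_gt0 => /andP[].
rewrite nm mulnC divisor_sum_mul //; apply: mulr_ge0; first by
  case: (geometric_char (pdiv n) (logn (pdiv n) n).+1).
by apply: IH => //; rewrite nm -{1}[m]muln1 ltn_pmul2l // -(expn0 (pdiv n)) ltn_exp2l // prime_gt1.
Qed.

Lemma divisor_sum_square j : (0 < j)%N -> 1 <= divisor_sum (j ^ 2) (j ^ 2).
Proof.
elim/ltn_ind: j => j IH j0; case: (leqP j 1) => j1.
  have -> : j = 1%N by apply/eqP; rewrite eqn_leq j1 j0.
  by rewrite /divisor_sum big_mkcond big_nat1 /=; have [-> _ _ _] := chf.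
have pp := pdiv_prime j1; have [m cpm jm] := pfactor_coprime pp j0.
set p := pdiv j in pp cpm jm *; set k := logn p j in jm.
have k0 : (0 < k)%N by rewrite logn_gt0 mem_primes pp j0 pdiv_dvd.
have m0 : (0 < m)%N by move: j0; rewrite jm muln_gt0 => /andP[].
have -> : (j ^ 2 = p ^ (2 * k) * m ^ 2)%N.
  by rewrite jm expnMn -expnM mulnC [(k * 2)%N]mulnC.
rewrite divisor_sum_mul ?coprimeXr ?expn_gt0 ?m0 //.
have jm1 : (m < j)%N by rewrite jm -{1}[m]muln1 ltn_pmul2l // -(expn0 p) ltn_exp2l // prime_gt1.
rewrite -[leLHS]mulr1; apply: ler_pM => //; rewrite ?ler01 //.
  by case: (geometric_char p (2 * k).+1) => _ -> //=; rewrite mul2n odd_double.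
exact: IH.
Qed.

End DivisorSum.

(** * Monotonicity of the Lambert kernel *)

Section GeometricSums.
Variables (R : realFieldType) (t : R).
Hypotheses (t0 : 0 < t) (t1 : t < 1).

Definition geom d := \sum_(0 <= i < d) t ^+ i.

Lemma geomS d : geom d.+1 = geom d + t ^+ d.
Proof. by rewrite /geom big_nat_recr. Qed.

Lemma geomSl d : geom d.+1 = 1 + t * geom d.
Proof.
rewrite /geom big_nat_recl // expr0 mulr_sumr; congr (_ + _).
by apply: eq_bigr => i _; rewrite exprS.
Qed.

Lemma geom_pow d : 1 - t ^+ d = (1 - t) * geom d.
Proof.
elim: d => [|d IH]; first by rewrite /geom big_geq // expr0 mulr0 subrr.
by rewrite geomS mulrDr -IH exprS; ring.
Qed.

Lemma geom_ge1 d : 1 <= geom d.+1.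
Proof.
rewrite geomSl lerDl mulr_ge0 ?(ltW t0) // sumr_ge0 // => i _.
by rewrite exprn_ge0 // ltW.
Qed.

Lemma geom_upper d : geom d <= d%:R.
Proof.
elim: d => [|d IH]; first by rewrite /geom big_geq.
by rewrite geomS -natr1 lerD // exprn_ile1 // ltW.
Qed.

Lemma geom_lower d : d%:R * t ^+ d <= geom d.
Proof.
rewrite /geom mulr_natl -[X in _ *+ X]subn0 -sumr_const_nat big_nat [leRHS]big_nat.
apply: ler_sum => i /andP[_ id]; by rewrite ler_wiXn2l ?(ltW t0) ?(ltW t1) ?(ltnW id).
Qed.

(** The inequality of the means at exponents averaging [d - 1/2], and [t < 1]. The explicit
    nonnegative expression in the proof avoids half-integral powers. *)
Lemma pow_pair_lower a b d : (a + b = d + d.-1)%N -> (0 < d)%N ->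
  2 * t ^+ d <= t ^+ a + t ^+ b.
Proof.
wlog ab : a b / (a <= b)%N.
  move=> H eab d0; case: (leqP a b) => [ab|/ltnW ba]; first exact: H.
  by rewrite addrC; apply: H; rewrite // addnC.
move=> eab d0.
have [c [ea eb]] : exists c, d = (a + c.+1)%N /\ b = (d + c)%N.
  by exists (d.-1 - a)%N; lia.
have tX k : 0 <= t ^+ k by rewrite exprn_ge0 // ltW.
have tX1 k : t ^+ k <= 1 by rewrite exprn_ile1 // ltW.
rewrite eb ea !exprD exprS.
have := tX a; have := tX c; have := tX1 c.
set u := t ^+ a; set w := t ^+ c => w1 w0 u0.
have H : 0 <= u * (1 - t * w) * (1 - w) + u * (w * (1 - t)).
  rewrite addr_ge0 // !mulr_ge0 // subr_ge0 //; last exact: ltW.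
  by rewrite mulr_ile1 // ltW.
lra.
Qed.

(** Reversing both indices pairs the exponent [i + j] with [2d - 1 - (i + j)], so [pow_pair_lower]
    applies to each of the [d * d.+1] terms. *)
Lemma geom_product_lower d : (0 < d)%N -> (d * d.+1)%:R * t ^+ d <= geom d * geom d.+1.
Proof.
move=> d0.
have E1 : geom d * geom d.+1 = \sum_(0 <= i < d) \sum_(0 <= j < d.+1) t ^+ (i + j).
  rewrite /geom mulr_suml; apply: eq_bigr => i _; rewrite mulr_sumr.
  by apply: eq_bigr => j _; rewrite exprD.
have E2 : geom d * geom d.+1 =
    \sum_(0 <= i < d) \sum_(0 <= j < d.+1) t ^+ ((d - i.+1) + (d.+1 - j.+1)).
  rewrite /geom mulr_suml big_nat_rev /= add0n; apply: eq_bigr => i _.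
  by rewrite mulr_sumr big_nat_rev /= add0n; apply: eq_bigr => j _; rewrite exprD.
have : \sum_(0 <= i < d) \sum_(0 <= j < d.+1) (2 * t ^+ d) <= 2 * (geom d * geom d.+1).
  rewrite [leRHS]mulrDl !mul1r {1}E1 E2 -big_split /= big_nat [leRHS]big_nat.
  apply: ler_sum => i /andP[_ id]; rewrite -big_split /= big_nat [leRHS]big_nat.
  apply: ler_sum => j /andP[_ jd]; apply: pow_pair_lower => //; lia.
by rewrite !sumr_const_nat !subn0 -mulrnA -[X in X <= _]mulr_natl mulrCA ler_pM2l ?ltr0n // mulnC.
Qed.

(* The Lambert kernel [t^d / (1 - t^d)], rescaled by [1 - t] and compared with [1/d]. *)
Definition lambert_gap d := d%:R^-1 - t ^+ d / geom d.

Lemma lambert_gap_ge0 d : (0 < d)%N -> 0 <= lambert_gap d.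
Proof.
move=> d0; rewrite subr_ge0 ler_pdivrMr; last first.
  by case: d d0 => // d _; apply: lt_le_trans (geom_ge1 d).
by rewrite mulrC ler_pdivlMr ?ltr0n // mulrC geom_lower.
Qed.

(** The two parts of the gap drop by [1 / (d (d + 1))] and [t^d / (geom d * geom d.+1)], which
    [geom_product_lower] compares. *)
Lemma lambert_gap_anti d : (0 < d)%N -> lambert_gap d.+1 <= lambert_gap d.
Proof.
move=> d0; have gp : 0 < geom d by case: d d0 => // d _; apply: lt_le_trans (geom_ge1 d).
have gp1 : 0 < geom d.+1 := lt_le_trans ltr01 (geom_ge1 d).
have dp : 0 < d%:R :> R by rewrite ltr0n.
have dp1 : 0 < d.+1%:R :> R by rewrite ltr0n.
have E1 : d%:R^-1 - d.+1%:R^-1 = ((d * d.+1)%:R)^-1 :> R.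
  by rewrite natrM -[d.+1%:R]natr1 in dp1 *; field; rewrite ?gt_eqF.
have E2 : t ^+ d / geom d - t ^+ d.+1 / geom d.+1 = t ^+ d / (geom d * geom d.+1).
  have g1 := geomSl d; rewrite g1 in gp1 *; by rewrite exprS; field; rewrite ?gt_eqF.
have H : t ^+ d / (geom d * geom d.+1) <= ((d * d.+1)%:R)^-1.
  rewrite ler_pdivrMr ?mulr_gt0 // mulrC ler_pdivlMr ?ltr0n ?muln_gt0 ?d0 //.
  by rewrite mulrC geom_product_lower.
move: H; rewrite -E1 -E2 /lambert_gap.
set a := d%:R^-1; set b := d.+1%:R^-1; set u := _ / _; set v := _ / geom d.+1; lra.
Qed.

End GeometricSums.

(** * Nonvanishing of the L-series at 1 *)

Section LAtOne.
Variables (R : archiRealFieldType) (N : nat) (f : nat -> R).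
Hypotheses (N_gt0 : (0 < N)%N) (chf : real_char N f) (npf : nonprincipal N f).

Definition harm n := \sum_(1 <= i < n.+1) f i / i%:R.

Lemma harm_cauchy a b : (a <= b)%N -> `|harm b - harm a| <= N%:R / a.+1%:R.
Proof.
move=> ab; have -> : harm b - harm a = \sum_(a.+1 <= i < b.+1) f i * i%:R^-1.
  by rewrite /harm [X in X - _](big_cat_nat (n := a.+1)) //= addrAC subrr add0r.
apply: (abel_bound (g := fun i => i%:R^-1)) => //.
- move=> i ai; rewrite lef_pV2 ?posrE ?ltr0n ?ler_nat //; exact: leq_trans ai.
- by move=> i _; rewrite invr_ge0.
- by move=> i; apply: nonprincipal_partial.
Qed.

Lemma sum_squares_le (F : nat -> R) J D : (forall n, (0 < n)%N -> 0 <= F n) -> (J ^ 2 <= D)%N ->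
  \sum_(1 <= j < J.+1) F (j ^ 2)%N <= \sum_(1 <= n < D.+1) F n.
Proof.
move=> F0; elim: J D => [|J IH] D JD.
  by rewrite big_geq // big_nat sumr_ge0 // => i /andP[i0 _]; apply: F0.
rewrite big_nat_recr //=.
have [k ek] : exists k, (J.+1 ^ 2 = k.+1)%N by exists (J.+1 ^ 2).-1; rewrite prednK ?expn_gt0.
have e1 : (J ^ 2 < J.+1 ^ 2)%N by rewrite ltn_exp2r.
rewrite ek in e1 JD *; rewrite [leRHS](big_cat_nat (n := k.+1)) //=; last exact: leqW.
apply: lerD; first exact: IH.
rewrite big_ltn //= lerDl big_nat sumr_ge0 // => i /andP[i0 _]; apply: F0.
by apply: leq_trans i0.
Qed.

(** The geometric series in [t ^ d] cut at [D %/ d] misses a tail whose first exponent exceeds [D];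
    rescaled, each of the [D] tails is at most [t ^ D.+1]. *)
Lemma lambert_split (t : R) D : 0 < t -> t < 1 ->
  `|\sum_(1 <= d < D.+1) f d * (t ^+ d / geom t d)
    - (1 - t) * \sum_(1 <= n < D.+1) divisor_sum f n n * t ^+ n| <= D%:R * t ^+ D.+1.
Proof.
move=> t0 t1.
have -> : \sum_(1 <= n < D.+1) divisor_sum f n n * t ^+ n
   = \sum_(1 <= d < D.+1) f d * \sum_(1 <= m < (D %/ d).+1) t ^+ (d * m).
  under [RHS]eq_bigr do rewrite mulr_sumr.
  rewrite (sum_divisor_pairs (fun d n => f d * t ^+ n)) big_nat [RHS]big_nat.
  apply: eq_bigr => n /andP[n0 nD]; rewrite -mulr_suml; congr (_ * _).
  by rewrite -(divisor_sum_bound f (B := D)).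
rewrite mulr_sumr -sumrB; apply: (le_trans (ler_norm_sum _ _ _)).
rewrite mulr_natl -[X in _ *+ X]subn0 -[X in _ *+ X]subSS -sumr_const_nat big_nat [leRHS]big_nat.
apply: ler_sum => d /andP[d0 dD].
have g1 : 1 <= geom t d by case: d d0 {dD} => // d _; apply: geom_ge1.
have gp : 0 < geom t d by apply: lt_le_trans g1.
set M := (D %/ d)%N.
have -> : f d * (t ^+ d / geom t d) - (1 - t) * (f d * \sum_(1 <= m < M.+1) t ^+ (d * m))
    = f d * (t ^+ (d * M.+1) / geom t d).
  have E : t ^+ d - (1 - t) * geom t d * (\sum_(1 <= m < M.+1) t ^+ (d * m)) = t ^+ (d * M.+1).
    rewrite -geom_pow; elim: M => [|M IH]; first by rewrite big_geq // mulr0 subr0 muln1.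
    rewrite big_nat_recr //= mulrDr opprD addrA IH [(d * M.+2)%N]mulnS exprD; ring.
  rewrite -E; field; exact: lt0r_neq0.
rewrite normrM -[leRHS]mul1r; apply: ler_pM => //; first exact: real_char_norm chf.
have tX k : 0 <= t ^+ k by rewrite exprn_ge0 // ltW.
rewrite ger0_norm ?divr_ge0 ?(ltW gp) // ler_pdivrMr //.
apply: (@le_trans _ _ (t ^+ D.+1)); last by rewrite ler_peMr.
rewrite ler_wiXn2l ?(ltW t0) ?(ltW t1) // mulnC; exact: ltn_ceil.
Qed.

(* Monsky: if [harm n] were [O(1 / n)], then [sum_d f d * t ^ d / (1 - t ^ d)] would stay bounded as
   [t -> 1]; but its coefficients are nonnegative and at least 1 at the squares. *)
Lemma harm_not_small : ~ (forall n, `|harm n| <= N%:R / n.+1%:R).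
Proof.
move=> small; pose K : R := N%:R.
have K0 : 0 <= K by rewrite ler0n.
(* Bernoulli gives [t ^ (J ^ 2) >= 1/2], so the squares up to [J ^ 2] contribute at least
   [J / 2 = N + 1] to the divisor sums, one more than the Abel bound [K = N] can absorb. What
   remains is that the error terms in [key] tend to 0 with [D]. *)
pose J := (2 * N + 2)%N; pose e : R := (2 * (J ^ 2)%:R)^-1; pose t := 1 - e.
have J1 : (1 <= J ^ 2)%N by rewrite expn_gt0 /J addn2.
have JR : 1 <= (J ^ 2)%:R :> R by rewrite ler1n.
have e0 : 0 < e by rewrite invr_gt0 mulr_gt0 // (lt_le_trans ltr01).
have eJ : e * (J ^ 2)%:R = 1 / 2 by rewrite /e; move: ((J ^ 2)%:R : R) JR => j j1; field; lra.
have e1 : e <= 1 / 2 by rewrite -eJ ler_peMr // ltW.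
have t0 : 0 < t by rewrite /t; lra.
have t1 : t < 1 by rewrite /t; lra.
have tX k : 0 <= t ^+ k by rewrite exprn_ge0 // ltW.
have key D : (J ^ 2 <= D)%N -> e <= K / D.+1%:R + D%:R * t ^+ D.+1.
  move=> JD.
  have S1 : `|\sum_(1 <= d < D.+1) f d * (t ^+ d / geom t d)| <= K / D.+1%:R + K * e.
    have -> : \sum_(1 <= d < D.+1) f d * (t ^+ d / geom t d)
        = harm D - \sum_(1 <= d < D.+1) f d * lambert_gap t d.
      by rewrite /harm -sumrB; apply: eq_bigr => d _; rewrite /lambert_gap; ring.
    apply: (le_trans (ler_normB _ _)); apply: lerD => //.
    have -> : e = lambert_gap t 1.
      by rewrite /lambert_gap /geom big_nat1 expr0 expr1 /t; field.
    apply: abel_bound => // [i i0|i i0|i]; first exact: lambert_gap_anti.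
      exact: lambert_gap_ge0.
    exact: nonprincipal_partial.
  have S2 := lambert_split D t0 t1.
  have S3 : J%:R / 2 <= \sum_(1 <= n < D.+1) divisor_sum f n n * t ^+ n.
    apply: le_trans (sum_squares_le (F := fun n => divisor_sum f n n * t ^+ n) _ JD); last first.
      by move=> n n0; rewrite mulr_ge0 // (divisor_sum_ge0 chf).
    have -> : J%:R / 2 = \sum_(1 <= j < J.+1) (1 / 2 : R).
      by rewrite sumr_const_nat subSS subn0 div1r -[RHS]mulr_natl.
    rewrite big_nat [leRHS]big_nat; apply: ler_sum => j /andP[j0 jJ].
    rewrite -[leLHS]mul1r; apply: ler_pM; rewrite ?ler01 ?(divisor_sum_square chf) //; first lra.
    apply: (@le_trans _ _ (t ^+ (J ^ 2))); last first.
      by rewrite ler_wiXn2l ?(ltW t0) ?(ltW t1) // leq_exp2r.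
    have gle := geom_upper t0 t1 (J ^ 2).
    have := geom_pow t (J ^ 2); have : e * geom t (J ^ 2) <= e * (J ^ 2)%:R.
      by rewrite ler_pM2l.
    have -> : 1 - t = e by rewrite /t; ring.
    lra.
  move: S1 S2 S3; have -> : 1 - t = e by rewrite /t; ring.
  set A := \sum_(1 <= d < D.+1) f d * _; set B := \sum_(1 <= n < D.+1) _.
  set X := D%:R * _; set Y := K / _.
  have -> : J%:R / 2 = K + 1 by rewrite /J natrD natrM /K; field.
  move=> /ler_normlP[_ S1] /ler_normlP[S2 _] S3.
  have : e * (K + 1) <= e * B by rewrite ler_pM2l.
  lra.
(* [D = 2E - 1] makes [t ^ D.+1] the square of [t ^ E <= 1 / (e E)], so that [D t ^ D.+1] is of
   order [1 / E]; [E > X] then contradicts [key]. *)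
pose X : R := (K + 2 / e ^+ 2) / e.
have X0 : 0 <= X by rewrite /X divr_ge0 ?(ltW e0) // addr_ge0 // divr_ge0 // exprn_ge0 // ltW.
have [E JltE XE] : exists2 E, (J ^ 2 < E)%N & X < E%:R.
  exists (maxn (J ^ 2) (Num.Def.archi_bound X)).+1; first by rewrite ltnS leq_maxl.
  apply: lt_le_trans (archi_boundP X0) _; rewrite ler_nat.
  by apply: leqW; exact: leq_maxr.
have E0 : 0 < E%:R :> R by apply: le_lt_trans XE.
have Epos : (0 < E)%N by rewrite -(ltr0n R).
have E2 : ((2 * E).-1.+1 = 2 * E)%N by rewrite prednK // muln_gt0.
have JE : (J ^ 2 <= (2 * E).-1)%N by rewrite -ltnS E2 (leq_trans JltE) // leq_pmull.
have e2 : 1 - t = e by rewrite /t; ring.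
have := key _ JE; rewrite E2; move: JltE JE => _ _; clearbody K e t.
have tE : t ^+ E <= 1 / (e * E%:R).
  rewrite ler_pdivlMr ?mulr_gt0 // mulrCA.
  have h1 := geom_lower t0 t1 E; have h2 := geom_pow t E; have h3 := tX E.
  rewrite e2 in h2; rewrite mulrC in h1.
  have : e * (t ^+ E * E%:R) <= e * geom t E by rewrite ler_pM2l.
  lra.
have tE2 : t ^+ (2 * E) <= (1 / (e * E%:R)) ^+ 2.
  by rewrite mulnC exprM lerXn2r ?nnegrE // divr_ge0 // mulr_ge0 ?ltW.
have DE : ((2 * E).-1)%:R <= 2 * E%:R :> R by rewrite -natrM ler_nat leq_pred.
have H : ((2 * E).-1)%:R * t ^+ (2 * E) <= 2 * E%:R * (1 / (e * E%:R)) ^+ 2.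
  by apply: ler_pM.
have H2 : K / (2 * E)%:R + 2 * E%:R * (1 / (e * E%:R)) ^+ 2 <= (K + 2 / e ^+ 2) / E%:R.
  have -> : 2 * E%:R * (1 / (e * E%:R)) ^+ 2 = (2 / e ^+ 2) / E%:R.
    by move: (E%:R : R) E0 => y y0; field; rewrite !gt_eqF.
  rewrite [leRHS]mulrDl; apply: lerD => //; apply: ler_wpM2l => //.
  by rewrite lef_pV2 ?posrE ?ltr0n ?muln_gt0 // ler_nat leq_pmull.
have H3 : (K + 2 / e ^+ 2) / E%:R < e.
  by rewrite ltr_pdivrMr //; move: XE; rewrite /X ltr_pdivrMr // [e * _]mulrC.
move=> H4; have := le_lt_trans (le_trans H4 (le_trans (lerD (lexx _) H) H2)) H3.
by rewrite ltxx.
Qed.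

(** Some [harm n0] exceeds in absolute value the Cauchy bound for all later differences. This states
    that the limit is not 0 without forming the limit. *)
Lemma harm_bounded_below : exists2 delta : R, 0 < delta &
  exists n0, forall n, (n0 <= n)%N -> delta <= `|harm n|.
Proof.
have [n0 Hn0] := not_all_ex_not _ _ harm_not_small.
have {}Hn0 : N%:R / n0.+1%:R < `|harm n0| by rewrite ltNge; apply/negP.
exists (`|harm n0| - N%:R / n0.+1%:R); first by rewrite subr_gt0.
exists n0 => n n0n; have := harm_cauchy n0n; rewrite distrC.
have := ler_normD (harm n0 - harm n) (harm n); rewrite subrK.
by set c := N%:R / _; lra.
Qed.

End LAtOne.

(** * Weighted sums over primes *)

Section Mertens.
Variables (R : archiRealFieldType) (lg : nat -> R).
(* The only properties of the logarithm that are used. *)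
Hypothesis lgM : forall m n, (0 < m)%N -> (0 < n)%N -> lg (m * n)%N = lg m + lg n.
Hypothesis lg_up : forall n, (0 < n)%N -> lg n.+1 - lg n <= n%:R^-1.
Hypothesis lg_lo : forall n, (0 < n)%N -> n.+1%:R^-1 <= lg n.+1 - lg n.

Lemma lg1 : lg 1 = 0.
Proof. by have := @lgM 1 1 isT isT; rewrite muln1; lra. Qed.

Lemma lg_mono m n : (0 < m)%N -> (m <= n)%N -> lg m <= lg n.
Proof.
move=> m0; elim: n => [|n IH]; first by rewrite leqn0; case: m m0.
rewrite leq_eqVlt => /orP[/eqP->//|mn]; apply: le_trans (IH mn) _.
have := lg_lo (leq_trans m0 mn); have : 0 <= n.+1%:R^-1 :> R by rewrite invr_ge0.
by set z := n.+1%:R^-1; lra.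
Qed.

Lemma lg_ge0 n : (0 < n)%N -> 0 <= lg n.
Proof. by move=> n0; rewrite -lg1 lg_mono. Qed.

Lemma lgX n k : (0 < n)%N -> lg (n ^ k) = k%:R * lg n.
Proof.
move=> n0; elim: k => [|k IH]; first by rewrite expn0 lg1 mul0r.
by rewrite expnS lgM ?expn_gt0 ?n0 // IH -natr1; ring.
Qed.

(** The sum of [F] against von Mangoldt's function. A cutoff [B] separate from [x] lets sums for
    different [x] share one range; the support of [F] does the truncation. *)
Definition prime_power_sum B (F : nat -> R) :=
  \sum_(0 <= p < B | prime p) \sum_(1 <= k < B) lg p * F (p ^ k)%N.
Local Notation LS := prime_power_sum.

Lemma pps_le B F G : (forall d, (0 < d)%N -> F d <= G d) -> LS B F <= LS B G.
Proof.
move=> FG; apply: ler_sum => p pp; apply: ler_sum => k _; apply: ler_wpM2l.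
  by rewrite lg_ge0 // prime_gt0.
by rewrite FG // expn_gt0 prime_gt0.
Qed.

Lemma pps_eq B F G : (forall d, (0 < d)%N -> F d = G d) -> LS B F = LS B G.
Proof.
move=> FG; apply: eq_bigr => p pp; apply: eq_bigr => k _.
by rewrite FG // expn_gt0 prime_gt0.
Qed.

Lemma ppsD B F G : LS B (fun d => F d + G d) = LS B F + LS B G.
Proof.
rewrite -big_split /=; apply: eq_bigr => p _; rewrite -big_split /=.
by apply: eq_bigr => k _; rewrite mulrDr.
Qed.

Lemma ppsZ B c F : LS B (fun d => c * F d) = c * LS B F.
Proof.
rewrite mulr_sumr; apply: eq_bigr => p _; rewrite mulr_sumr.
by apply: eq_bigr => k _; rewrite mulrCA.
Qed.

Lemma pps_norm B F : `|LS B F| <= LS B (fun d => `|F d|).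
Proof.
apply: (le_trans (ler_norm_sum _ _ _)); apply: ler_sum => p pp.
apply: (le_trans (ler_norm_sum _ _ _)); apply: ler_sum => k _.
by rewrite normrM [`|lg p|]ger0_norm // lg_ge0 // prime_gt0.
Qed.

Lemma sum_nat_indicator (L B : nat) : (L < B)%N -> \sum_(1 <= k < B) ((k <= L)%N)%:R = L%:R :> R.
Proof.
move=> LB; rewrite (big_cat_nat (n := L.+1)) //= big_nat [X in _ + X]big_nat.
rewrite [X in _ + X]big1 ?addr0; last by move=> k /andP[Lk _]; rewrite leqNgt Lk.
under eq_bigr => k /andP[_ kL] do rewrite -ltnS kL.
by rewrite -big_nat sumr_const_nat subSS subn0.
Qed.

Lemma lg_prime_powers n B : (0 < n)%N -> (n < B)%N ->
  lg n = LS B (fun d => ((d %| n)%N)%:R).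
Proof.
move=> n0 nB.
have -> : lg n = \sum_(0 <= p < n.+1 | prime p) lg p * (logn p n)%:R.
  have {1}-> : n = (\prod_(0 <= p < n.+1 | prime p) p ^ logn p n)%N.
    rewrite -{1}(part_pnat_id (pi := predT) (n := n)) /partn; last by apply/pnatP.
    rewrite big_mkcond [RHS]big_mkcond; apply: eq_bigr => p _ /=.
    by case: (boolP (prime p)) => // np; rewrite lognE (negbTE np) expn0.
  suff [] : (0 < \prod_(0 <= p < n.+1 | prime p) p ^ logn p n)%N /\
    lg (\prod_(0 <= p < n.+1 | prime p) p ^ logn p n)
     = \sum_(0 <= p < n.+1 | prime p) lg p * (logn p n)%:R by [].
  elim/big_rec2: _ => [|p s r pp [r0 IH]]; first by rewrite lg1.
  have p0 := prime_gt0 pp.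
  by rewrite muln_gt0 expn_gt0 p0 r0 lgM ?expn_gt0 ?p0 // lgX // IH mulrC.
rewrite /prime_power_sum (big_cat_nat (n := n.+1) (p := B)) //= [X in _ = _ + X]big_nat_cond.
rewrite [X in _ = _ + X]big1 ?addr0; last first.
  move=> p /andP[/andP[np _] pp]; rewrite big_nat big1 // => k /andP[k0 _].
  case: (boolP (p ^ k %| n)%N) => [/(dvdn_leq n0) pk|_]; last by rewrite mulr0.
  have : (p ^ 1 <= p ^ k)%N by rewrite leq_exp2l ?prime_gt1.
  by rewrite expn1 => /leq_trans/(_ pk); rewrite leqNgt np.
apply: eq_bigr => p pp; rewrite -mulr_sumr; congr (_ * _).
rewrite -[LHS](sum_nat_indicator (B := B)).
  by apply: eq_bigr => k _; rewrite pfactor_dvdn.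
apply: leq_ltn_trans nB; apply: ltnW; apply: leq_trans (ltn_expl _ (prime_gt1 pp)) _.
by apply: dvdn_leq => //; apply: pfactor_dvdnn.
Qed.

Lemma sum_lg_weighted (a : nat -> R) x B : (x < B)%N ->
  \sum_(1 <= n < x.+1) a n * lg n
  = LS B (fun d => \sum_(1 <= m < (x %/ d).+1) a (d * m)%N).
Proof.
move=> xB.
transitivity (\sum_(1 <= n < x.+1) \sum_(0 <= p < B | prime p) \sum_(1 <= k < B)
    lg p * (if (p ^ k %| n)%N then a n else 0)).
  rewrite big_nat [RHS]big_nat; apply: eq_bigr => n /andP[n0 nx].
  rewrite (@lg_prime_powers n B) ?(leq_ltn_trans _ xB) // mulr_sumr; apply: eq_bigr => p _.
  rewrite mulr_sumr; apply: eq_bigr => k _; case: ifP => _; rewrite ?mulr1 ?mulr0 //.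
  exact: mulrC.
rewrite exchange_big /=; apply: eq_bigr => p pp; rewrite exchange_big /=.
apply: eq_bigr => k _; rewrite -mulr_sumr -big_mkcond /= -(sum_multiples a) //.
by rewrite expn_gt0 prime_gt0.
Qed.

Definition lg_fact x := \sum_(1 <= n < x.+1) lg n.

Lemma lg_factE x : lg_fact x = lg (x`!).
Proof.
rewrite /lg_fact; elim: x => [|x IH]; first by rewrite big_geq // lg1.
by rewrite big_nat_recr //= IH factS lgM ?fact_gt0 // addrC.
Qed.

Lemma lg_fact_pps x B : (x < B)%N -> lg_fact x = LS B (fun d => (x %/ d)%:R).
Proof.
move=> xB; rewrite /lg_fact; under eq_bigr do rewrite -[lg _]mul1r.
rewrite (sum_lg_weighted (fun=> 1) xB); apply: pps_eq => d _.
by rewrite sumr_const_nat subSS subn0.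
Qed.

Lemma lg_fact_lower x : (0 < x)%N -> x%:R * lg x - x%:R <= lg_fact x.
Proof.
rewrite /lg_fact; elim: x => // x IH _; case: (posnP x) => [->|x0].
  by rewrite big_nat1 lg1; lra.
rewrite big_nat_recr //=; have {IH} := IH x0; have := lg_up x0.
rewrite -[x%:R^-1]div1r ler_pdivlMr ?ltr0n // -natr1.
set S := \sum_(_ <= _ < _) _; lra.
Qed.

Definition psi B x := LS B (fun d => ((d <= x)%N)%:R).

(** Chebyshev: [(2n) %/ d - 2 (n %/ d)] is never negative and is 1 for [n < d <= 2n], while the
    central binomial coefficient is at most [2 ^ (2n)] and [lg 2 <= 1]. *)
Lemma psi_double n B : (2 * n < B)%N -> psi B (2 * n) <= psi B n + (2 * n)%:R.
Proof.
move=> nB; have nB' : (n < B)%N by apply: leq_ltn_trans nB; rewrite leq_pmull.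
have H1 : psi B (2 * n) + 2 * lg_fact n <= psi B n + lg_fact (2 * n).
  rewrite (lg_fact_pps nB') (lg_fact_pps nB) -ppsZ -!ppsD; apply: pps_le => d d0.
  rewrite -!natrM -!natrD ler_nat; case: (leqP d n) => dn.
    have -> : (d <= 2 * n)%N by apply: leq_trans dn _; rewrite leq_pmull.
    by rewrite leq_add2l leq_divRL // -mulnA leq_mul2l leq_divM orbT.
  rewrite (divn_small dn) muln0 addn0 add0n; case: (leqP d (2 * n)) => // dn2.
  by rewrite divn_gt0.
have H2 : lg_fact (2 * n) - 2 * lg_fact n <= (2 * n)%:R.
  have n2 : (n <= 2 * n)%N by rewrite leq_pmull.
  have := bin_fact n2; rewrite !lg_factE => <-.
  have -> : (2 * n - n = n)%N by rewrite mul2n -addnn addnK.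
  have b0 : (0 < 'C(2 * n, n))%N by rewrite bin_gt0.
  rewrite !lgM ?muln_gt0 ?fact_gt0 //.
  have : lg 'C(2 * n, n) <= lg (2 ^ (2 * n)).
    apply: lg_mono => //; rewrite -[(2 ^ _)%N]/((1 + 1) ^ (2 * n))%N expnDn.
    rewrite (bigD1 (inord n)) //= inordK; last by rewrite ltnS.
    by rewrite !exp1n !muln1 leq_addr.
  rewrite lgX //; have := @lg_up 1 isT; rewrite lg1 invr1 subr0 => l2.
  have : (2 * n)%:R * lg 2 <= (2 * n)%:R by rewrite -[leRHS]mulr1 ler_wpM2l.
  lra.
lra.
Qed.

(** Repeated halving, rounded up; twice the half may be [x.+1], hence the condition on [B]. *)
Lemma psi_le x B : (x.+1 < B)%N -> psi B x <= 4 * x%:R.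
Proof.
elim/ltn_ind: x => x IH xB; case: (leqP x 1) => x1.
  apply: (@le_trans _ _ 0); last by rewrite mulr_ge0.
  rewrite /psi /prime_power_sum big1 // => p pp; rewrite big_nat big1 // => k /andP[k0 _].
  rewrite leqNgt (leq_ltn_trans x1) ?mulr0 //.
  by apply: leq_trans (prime_gt1 pp) _; rewrite -{1}[p]expn1 leq_exp2l ?prime_gt1.
pose n := uphalf x.
have [n1 n2 n3] : [/\ (n < x)%N, (x <= 2 * n)%N & (2 * n <= x.+1)%N].
  by rewrite /n; split; lia.
have H : psi B x <= psi B (2 * n).
  apply: pps_le => d _; rewrite ler_nat; case: (leqP d x) => // dx.
  by rewrite (leq_trans dx n2).
apply: le_trans H (le_trans (psi_double _) _); first exact: leq_ltn_trans n3 xB.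
have h := IH n n1 (leq_ltn_trans _ xB).
apply: le_trans (lerD (h _) (lexx _)) _; first by rewrite ltnS ltnW.
by rewrite -!natrM -natrD ler_nat; lia.
Qed.

(** Compares the lower bound for [lg_fact x] with its prime power expansion, in which [x %/ d] is at
    most [x / d]. *)
Lemma mertens_lower x B : (0 < x)%N -> (x < B)%N ->
  lg x - 1 <= LS B (fun d => ((d <= x)%N)%:R / d%:R).
Proof.
move=> x0 xB; have x0R : 0 < x%:R :> R by rewrite ltr0n.
rewrite -(ler_pM2l x0R) mulrBr mulr1 -ppsZ.
apply: le_trans (lg_fact_lower x0) _; rewrite (lg_fact_pps xB); apply: pps_le => d d0.
case: (leqP d x) => dx; last by rewrite divn_small // mul0r mulr0.
rewrite mulrA mulr1 ler_pdivlMr ?ltr0n // -natrM ler_nat; exact: leq_divM.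
Qed.

(** The quotient decreases once [lg n >= 1]; summing [lg_lo] gives [lg 4 >= 1/2 + 1/3 + 1/4 > 1]. *)
Lemma lg_div_anti n : (4 <= n)%N -> lg n.+1 / n.+1%:R <= lg n / n%:R.
Proof.
move=> n4; have n0 : (0 < n)%N by apply: leq_trans n4.
rewrite ler_pdivrMr ?ltr0n // mulrAC ler_pdivlMr ?ltr0n // -natr1.
have l4 : 1 <= lg n.
  apply: le_trans (lg_mono (m := 4) _ n4) => //.
  have := @lg_lo 1 isT; have := @lg_lo 2 isT; have := @lg_lo 3 isT; rewrite lg1.
  set a := 2%:R^-1; set b := 3%:R^-1; set c := 4%:R^-1.
  have -> : a = 1 / 2 by rewrite /a; field.
  have -> : b = 1 / 3 by rewrite /b; field.
  have -> : c = 1 / 4 by rewrite /c; field.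
  lra.
have := lg_up n0; rewrite -[n%:R^-1]div1r ler_pdivlMr ?ltr0n //; lra.
Qed.

(* The bounded sum of [f n * lg n / n] over [n <= x] is that of [Lambda d * f d / d * harm (x / d)].
   Replacing [harm (x / d)] by [harm x], which is bounded away from 0, costs O(1) by Chebyshev. *)
Lemma mertens_char N f : (0 < N)%N -> real_char N f -> nonprincipal N f ->
  exists C x0, forall x B, (x0 <= x)%N -> (x.+1 < B)%N ->
    `|LS B (fun d => ((d <= x)%N)%:R * f d / d%:R)| <= C.
Proof.
move=> N0 chf npf; have [delta d0 [x0 Hx0]] := harm_bounded_below N0 chf npf.
have [_ fM _ _] := chf.
pose C1 : R := \sum_(1 <= n < 4) lg n + N%:R * (lg 4 / 4%:R).
exists ((C1 + 4 * N%:R) / delta), x0.+1 => x B xx xB.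
have x0R : 0 < x%:R :> R by rewrite ltr0n (leq_trans _ xx).
have xB' : (x < B)%N by apply: ltnW.
have E1 : `|\sum_(1 <= n < x.+1) f n / n%:R * lg n| <= C1.
  have lgn n : (0 < n)%N -> `|f n / n%:R * lg n| <= lg n.
    move=> n0; rewrite !normrM [`|lg n|]ger0_norm ?lg_ge0 // -[leRHS]mul1r.
    apply: ler_wpM2r; first exact: lg_ge0.
    rewrite mulr_ile1 //; first exact: real_char_norm chf.
    by rewrite ger0_norm ?invr_ge0 // invf_le1 ?ltr0n // ler1n.
  have lgs a b : (0 < a)%N -> (b <= 4)%N ->
    `|\sum_(a <= n < b) f n / n%:R * lg n| <= \sum_(a <= n < b) lg n.
    move=> a0 _; apply: (le_trans (ler_norm_sum _ _ _)).
    rewrite big_nat [leRHS]big_nat; apply: ler_sum => n /andP[an _].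
    by apply: lgn; apply: leq_trans an.
  case: (leqP x.+1 4) => x4.
    apply: (le_trans (lgs _ _ _ x4)) => //.
    rewrite /C1 (big_cat_nat (n := x.+1) (p := 4)) //= -addrA lerDl addr_ge0 //.
      by rewrite big_nat sumr_ge0 // => i /andP[i1 _]; rewrite lg_ge0 // (leq_trans _ i1).
    by rewrite mulr_ge0 // divr_ge0 // lg_ge0.
  rewrite (big_cat_nat (n := 4)) //=; last exact: ltnW.
  apply: (le_trans (ler_normD _ _)); apply: lerD; first exact: lgs.
  under eq_bigr do rewrite -mulrA [_^-1 * _]mulrC.
  apply: (abel_bound (g := fun i => lg i / i%:R)) => //.
  - by move=> i i4; apply: lg_div_anti.
  - by move=> i i4; rewrite divr_ge0 // lg_ge0 // (leq_trans _ i4).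
  - by move=> i; apply: nonprincipal_partial.
have E2 : \sum_(1 <= n < x.+1) f n / n%:R * lg n
    = LS B (fun d => f d / d%:R * harm f (x %/ d)).
  rewrite (sum_lg_weighted (fun n => f n / n%:R) xB'); apply: pps_eq => d d0'.
  rewrite /harm mulr_sumr big_nat [RHS]big_nat; apply: eq_bigr => m /andP[m0 _].
  by rewrite fM natrM invfM; ring.
(* By [harm_cauchy] the replacement costs at most [N / (x %/ d + 1)] at [d], and dividing by [d]
   leaves less than [N / x]; then [psi_le] applies. *)
have E3 : `|LS B (fun d => f d / d%:R * harm f (x %/ d))
     - harm f x * LS B (fun d => ((d <= x)%N)%:R * f d / d%:R)| <= 4 * N%:R.
  rewrite -ppsZ -mulN1r -ppsZ -ppsD; apply: (le_trans (pps_norm _ _)).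
  apply: (@le_trans _ _ (N%:R / x%:R * psi B x)); last first.
    have := psi_le xB; rewrite mulrAC ler_pdivrMr // => H.
    have := ler_wpM2l (ler0n R N) H; lra.
  rewrite -ppsZ; apply: pps_le => d d0'; case: (leqP d x) => dx; last first.
    by rewrite divn_small // /harm big_geq // !(mul0r, mulr0) addr0 normr0.
  have -> : f d / d%:R * harm f (x %/ d) + -1 * (harm f x * (1 * f d / d%:R))
     = f d * (- (harm f x - harm f (x %/ d)) / d%:R) by ring.
  rewrite mulr1 normrM -[leRHS]mul1r; apply: ler_pM => //; first exact: real_char_norm chf.
  rewrite normrM normrN [`|d%:R^-1|]ger0_norm ?invr_ge0 // ler_pdivrMr ?ltr0n //.
  apply: le_trans (harm_cauchy N0 chf npf (leq_div _ _)) _.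
  rewrite -mulrA; apply: ler_wpM2l => //; rewrite ler_pdivlMl // ler_pdivrMr ?ltr0n //.
  by rewrite -natrM ler_nat mulnC ltnW // ltn_ceil.
have h := Hx0 x (ltnW xx); rewrite ler_pdivlMr // mulrC.
rewrite E2 in E1; move: E1 E3; set P := LS B _; set Q := LS B _ => E1 E3.
apply: (@le_trans _ _ `|harm f x * Q|).
  by rewrite normrM ler_wpM2r.
have -> : harm f x * Q = P - (P - harm f x * Q) by ring.
apply: (le_trans (ler_normB _ _)); exact: lerD.
Qed.

End Mertens.

From mathcomp Require Import cyclic.

(** * Primes with prescribed values of real characters *)

Section PrescribedCharacters.
Variables (R : archiRealFieldType) (lg : nat -> R) (N : nat).
Hypothesis lgM : forall m n, (0 < m)%N -> (0 < n)%N -> lg (m * n)%N = lg m + lg n.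
Hypothesis lg_up : forall n, (0 < n)%N -> lg n.+1 - lg n <= n%:R^-1.
Hypothesis lg_lo : forall n, (0 < n)%N -> n.+1%:R^-1 <= lg n.+1 - lg n.
Hypothesis N_gt0 : (0 < N)%N.
Local Notation LS := (prime_power_sum lg).
Local Notation fs := (seq ((nat -> R) * R)).

(* [l] pairs each character with the value prescribed for it; the weight is [2 ^ size l] on the
   prescribed class and [0] on the other classes prime to [N]. *)
Fixpoint weight (l : fs) (n : nat) : R :=
  if l is (f, e) :: l' then (1 + e * f n) * weight l' n else 1.

Fixpoint chars (l : fs) : Prop :=
  if l is (f, e) :: l' then [/\ real_char N f, e = 1 \/ e = -1 & chars l'] else True.

Fixpoint trivial_at (a : nat) (l : fs) : Prop :=
  if l is (f, _) :: l' then f a = 1 /\ trivial_at a l' else True.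

(** A triangular form of independence: the product of a character with any of the later ones is -1
    at [a], hence nonprincipal. *)
Fixpoint separated (l : fs) : Prop :=
  if l is (f, _) :: l' then
    (exists a, [/\ coprime a N, f a = -1 & trivial_at a l']) /\ separated l'
  else True.

Lemma weight_bound l n : chars l -> 0 <= weight l n <= 2 ^+ size l.
Proof.
elim: l => [|[f e] l IH] /=; first by rewrite ler01 lexx.
case=> chf he /IH/andP[w0 w1].
have /ler_normlP [f0 f1] := real_char_norm n chf.
have h : 0 <= 1 + e * f n <= 2 by case: he => ->; apply/andP; split; lra.
case/andP: h => h0 h1; rewrite mulr_ge0 //= exprS; exact: ler_pM.
Qed.

(** Expanding the weight one factor at a time multiplies [g] by characters that are 1 at [a], so
    each resulting character is still -1 there and [mertens_char] bounds its sum. *)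
Lemma character_sum_bound g l a : real_char N g -> chars l ->
    coprime a N -> g a = -1 -> trivial_at a l ->
  exists C x0, forall x B, (x0 <= x)%N -> (x.+1 < B)%N ->
    `|LS B (fun d => ((d <= x)%N)%:R * (g d * weight l d) / d%:R)| <= C.
Proof.
move=> chg chl cop ga; elim: l g chg ga chl => [|[f e] l IH] g chg ga /=.
  move=> _ _; have [C [x0 H]] := mertens_char lgM lg_up lg_lo N_gt0 chg (nonprincipal_of N_gt0 cop chg ga).
  exists C, x0 => x B xx xB; have := H x B xx xB; congr (`|_| <= _).
  by apply: pps_eq => d _; rewrite mulr1.
case=> chf he chl [fa la].
have [C1 [x1 H1]] := IH g chg ga chl la.
have gfa : g a * f a = -1 by rewrite ga fa mulr1.
have [C2 [x2 H2]] := IH _ (real_charM chg chf) gfa chl la.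
exists (C1 + C2), (maxn x1 x2) => x B; rewrite geq_max => /andP[xx1 xx2] xB.
have -> : LS B (fun d => ((d <= x)%N)%:R * (g d * ((1 + e * f d) * weight l d)) / d%:R)
   = LS B (fun d => ((d <= x)%N)%:R * (g d * weight l d) / d%:R)
   + e * LS B (fun d => ((d <= x)%N)%:R * ((g d * f d) * weight l d) / d%:R).
  by rewrite -ppsZ -ppsD; apply: pps_eq => d _; ring.
apply: (le_trans (ler_normD _ _)); apply: lerD; first exact: H1.
rewrite normrM; have -> : `|e| = 1 by case: he => ->; rewrite ?normrN normr1.
rewrite mul1r; exact: H2.
Qed.

Lemma weight_sum_lower l : chars l -> separated l ->
  exists C x0, forall x B, (x0 <= x)%N -> (x.+1 < B)%N ->
    lg x - C <= LS B (fun d => ((d <= x)%N)%:R * weight l d / d%:R).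
Proof.
elim: l => [|[f e] l IH] /=.
  move=> _ _; exists 1, 1%N => x B x1 xB.
  apply: le_trans (mertens_lower lgM lg_up lg_lo x1 (ltnW xB)) _.
  by apply: pps_le => // d _; rewrite mulr1.
case=> chf he chl [[a [cop fa la]] sl].
have [C1 [x1 H1]] := IH chl sl.
have [C2 [x2 H2]] := character_sum_bound chf chl cop fa la.
exists (C1 + C2), (maxn x1 x2) => x B; rewrite geq_max => /andP[xx1 xx2] xB.
have -> : LS B (fun d => ((d <= x)%N)%:R * ((1 + e * f d) * weight l d) / d%:R)
   = LS B (fun d => ((d <= x)%N)%:R * weight l d / d%:R)
   + e * LS B (fun d => ((d <= x)%N)%:R * (f d * weight l d) / d%:R).
  by rewrite -ppsZ -ppsD; apply: pps_eq => d _; ring.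
have h1 := H1 x B xx1 xB; have /ler_normlP [h2 h3] := H2 x B xx2 xB.
by case: he => ->; lra.
Qed.

Lemma real_char_coprime (f : nat -> R) n : real_char N f -> coprime n N -> f n = 1 \/ f n = -1.
Proof.
move=> chf cop; have [f1 fM fN fv] := chf; case: (fv n) => fn; [|by left|by right].
have := Euler_exp_totient cop => /(congr1 f).
rewrite !(periodic_mod (N := N)) // (real_char_exp _ _ chf) fn f1 expr0n.
by rewrite gtn_eqF ?totient_gt0 //= => /eqP; rewrite eq_sym oner_eq0.
Qed.

Lemma weight_zero (l : fs) f0 p k : chars l -> coprime p N ->
    (exists l1 l2, l = l1 ++ (f0, -1) :: l2) ->
    (exists f e l1 l2, l = l1 ++ (f, e) :: l2 /\ f p <> e) ->
  weight l (p ^ k) = 0.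
Proof.
have mem_zero (l1 : fs) f e l2 n : e * f n = -1 -> weight (l1 ++ (f, e) :: l2) n = 0.
  move=> h; elim: l1 => [|[f' e'] l1 IH] /=; first by rewrite h subrr mul0r.
  by rewrite IH mulr0.
have charsP (l1 : fs) f e l2 : chars (l1 ++ (f, e) :: l2) -> real_char N f /\ (e = 1 \/ e = -1).
  by elim: l1 => [|[f' e'] l1 IH] /= [].
move=> chl cop [l1 [l2 E0]] [f [e [l3 [l4 [E fe]]]]].
have [chf he] : real_char N f /\ (e = 1 \/ e = -1) by apply: (charsP l3 f e l4); rewrite -E.
have [chf0 _] : real_char N f0 /\ (-1 = 1 :> R \/ -1 = -1 :> R).
  by apply: (charsP l1 f0 _ l2); rewrite -E0.
case: (boolP (odd k)) => ok.
  rewrite E; apply: mem_zero; rewrite (real_char_exp _ _ chf).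
  case: (real_char_coprime chf cop) fe => ->; case: he => -> fe //; rewrite ?expr1n ?mul1r ?mulr1 //.
  by rewrite -signr_odd ok expr1.
rewrite E0; apply: mem_zero; rewrite (real_char_exp _ _ chf0) -[k]odd_double_half (negbTE ok) add0n.
rewrite -mul2n exprM; case: (real_char_coprime chf0 cop) => ->; rewrite ?sqrrN ?expr1n mulr1 //.
Qed.

Lemma geometric_le1 p B : (1 < p)%N -> \sum_(1 <= k < B) (p ^ k)%:R^-1 <= 1 :> R.
Proof.
move=> p1; have p2 : 2 <= p%:R :> R by rewrite ler_nat.
have H : \sum_(1 <= k < B.+1) (p ^ k)%:R^-1 <= 1 - (p ^ B)%:R^-1 :> R.
  elim: B => [|B IH]; first by rewrite big_geq // expn0 invr1 subrr.
  rewrite big_nat_recr //=; apply: le_trans (lerD IH (lexx _)) _.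
  rewrite expnS natrM invfM.
  have : 0 <= (p ^ B)%:R^-1 :> R by rewrite invr_ge0.
  have : p%:R^-1 <= 1 / 2 :> R by rewrite div1r lef_pV2 ?posrE // (lt_le_trans _ p2).
  set u := p%:R^-1; set v := (p ^ B)%:R^-1 => hu hv.
  have := ler_wpM2r hv hu; lra.
case: B H => [|B] H; first by rewrite big_geq.
apply: (@le_trans _ _ (\sum_(1 <= k < B.+2) (p ^ k)%:R^-1)).
  by rewrite [leRHS]big_nat_recr //= lerDl invr_ge0.
by apply: (le_trans H); rewrite gerBl invr_ge0.
Qed.

Theorem prime_with_prescribed_characters (l : fs) (f0 : nat -> R) : chars l -> separated l ->
    (exists l1 l2, l = l1 ++ (f0, -1) :: l2) ->
  exists p, [/\ prime p, coprime p N &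
    forall f e l1 l2, l = l1 ++ (f, e) :: l2 -> f p = e].
Proof.
move=> chl sl f0l; apply: NNPP => none.
have W0 p k : prime p -> coprime p N -> weight l (p ^ k) = 0.
  move=> pp cop; apply: (weight_zero _ chl cop f0l).
  apply: NNPP => h; apply: none; exists p; split=> // f e l1 l2 E.
  by apply: NNPP => fe; apply: h; exists f, e, l1, l2.
have [C [x0 H]] := weight_sum_lower chl sl.
pose K : R := 2 ^+ size l * \sum_(0 <= p < N.+1 | prime p) lg p.
have lg0 n : (0 < n)%N -> 0 <= lg n by apply: lg_ge0.
(* Primes above [N] are prime to [N], so without the desired prime only the primes up to [N]
   contribute, each at most [2 ^+ size l * lg p]. *)
have up x B : (N < B)%N -> LS B (fun d => ((d <= x)%N)%:R * weight l d / d%:R) <= K.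
  move=> NB; rewrite /prime_power_sum (big_cat_nat (n := N.+1)) //= [X in _ + X]big1_seq ?addr0; last first.
    move=> p /andP[pp]; rewrite mem_index_iota => /andP[Np _].
    rewrite big1 // => k _; rewrite W0 ?mulr0 ?mul0r ?mulr0 //.
    by rewrite prime_coprime //; apply: contraL Np => /(dvdn_leq N_gt0); rewrite ltnNge negbK.
  rewrite /K mulr_sumr; apply: ler_sum => p pp.
  rewrite -mulr_sumr mulrC; apply: ler_wpM2r; first by rewrite lg0 // prime_gt0.
  apply: (@le_trans _ _ (2 ^+ size l * \sum_(1 <= k < B) (p ^ k)%:R^-1)); last first.
    rewrite -[leRHS]mulr1; apply: ler_wpM2l; first by rewrite exprn_ge0.
    by apply: geometric_le1; apply: prime_gt1.
  rewrite mulr_sumr; apply: ler_sum => k _; apply: ler_wpM2r; first by rewrite invr_ge0.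
  have /andP[w0 w1] := weight_bound (p ^ k) chl.
  by case: (_ <= x)%N; rewrite ?mul1r ?mul0r // exprn_ge0.
(* At [x = 2 ^ M] the lower bound is [M lg 2 - C >= M / 2 - C], which must exceed [K]. *)
pose M := (maxn x0 (Num.Def.archi_bound (2 * `|K + C|))).+1.
have M1 : (x0 <= 2 ^ M)%N.
  by apply: leq_trans (ltnW (ltn_expl M (isT : 1 < 2)%N)); apply: leqW; apply: leq_maxl.
pose B := (maxn N (2 ^ M).+1).+1.
have B1 : ((2 ^ M).+1 < B)%N by rewrite ltnS leq_maxr.
have B2 : (N < B)%N by rewrite ltnS leq_maxl.
have := le_trans (H _ _ M1 B1) (up _ _ B2).
rewrite lgX //; have := @lg_lo 1 isT; rewrite (lg1 lgM) subr0 => l2.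
have : 2 * `|K + C| < M%:R.
  apply: lt_le_trans (archi_boundP _) _; first by rewrite mulr_ge0.
  by rewrite ler_nat; apply: leqW; apply: leq_maxr.
have hl : 1 / 2 <= lg 2 by rewrite div1r.
have := ler_wpM2l (ler0n R M) hl; have := ler_norm (K + C); lra.
Qed.

End PrescribedCharacters.

From mathcomp Require Import all_fingroup.

(** * Quadratic reciprocity *)

Definition leg (p n : nat) : int :=
  if (p %| n)%N then 0 else if (n ^ p./2 == 1 %[mod p])%N then 1 else -1.

Section Legendre.
Variable p : nat.
Hypotheses (pp : prime p) (p_odd : odd p).

Let p_gt0 : (0 < p)%N := prime_gt0 pp.
Let p_gt1 : (1 < p)%N := prime_gt1 pp.
Let p_gt2 : (2 < p)%N.
Proof. by move: p_odd p_gt1; case: p => [|[|[|]]]. Qed.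

Lemma double_half_prime : (p./2.*2 = p.-1)%N.
Proof. by rewrite -[in RHS](odd_double_half p) p_odd. Qed.

Let FpE (n : nat) : (n%:R == 0 :> 'F_p) = (p %| n)%N.
Proof. by rewrite -(dvdn_pcharf (pchar_Fp pp)). Qed.

Let Fp_eq (m n : nat) : (m%:R == n%:R :> 'F_p) = (m == n %[mod p])%N.
Proof.
apply/eqP/eqP => [|E]; last by rewrite -(Fp_nat_mod pp m) E Fp_nat_mod.
by move/(congr1 val); rewrite /= !val_Fp_nat.
Qed.

Lemma Fp_half_power (n : nat) : (n%:R ^+ p./2 : 'F_p) = (leg p n)%:~R.
Proof.
rewrite /leg; case: ifP => [pn|/negbT pn].
  have /eqP -> : n%:R == 0 :> 'F_p by rewrite FpE.
  by rewrite expr0n /= gtn_eqF // half_gt0.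
rewrite -Fp_eq natrX; case: eqP => // h1.
have : (n%:R ^+ p./2 - 1) * (n%:R ^+ p./2 + 1) == 0 :> 'F_p.
  rewrite -subr_sqr expr1n -exprM muln2 double_half_prime subr_eq0.
  rewrite -natrX -[1]/(1%:R) Fp_eq -(totient_prime pp) Euler_exp_totient //.
  by rewrite coprime_sym prime_coprime.
rewrite mulf_eq0 subr_eq0 addr_eq0 => /orP[/eqP//|/eqP->].
by rewrite rmorphN1.
Qed.

Lemma leg_cases n : [\/ leg p n = 0, leg p n = 1 | leg p n = -1].
Proof. by rewrite /leg; case: ifP => _; [constructor 1|case: ifP => _; [constructor 2|constructor 3]]. Qed.

Lemma leg_eq0 n : (leg p n == 0) = (p %| n)%N.
Proof. by rewrite /leg; case: ifP => // _; case: ifP. Qed.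

Lemma leg_mod n : leg p (n %% p) = leg p n.
Proof. by rewrite /leg /dvdn modn_mod modnXm. Qed.

Lemma Fp_sign_inj (a b : int) : [\/ a = 0, a = 1 | a = -1] -> [\/ b = 0, b = 1 | b = -1] ->
  a%:~R = b%:~R :> 'F_p -> a = b.
Proof.
have H (k : nat) : (0 < k < 3)%N -> k%:R != 0 :> 'F_p.
  move=> /andP[k0 k3]; rewrite FpE; apply/negP => /(dvdn_leq k0).
  by rewrite leqNgt (leq_ltn_trans _ p_gt2) // -ltnS.
have H1 : (1 : 'F_p) != 0 := H 1%N isT.
have H2 : (1 + 1 : 'F_p) != 0 := H 2%N isT.
case=> ->; case=> -> //; rewrite ?mulrN1z ?mulr1z ?mulr0z => /eqP;
  first [ by rewrite (negbTE H1) | by rewrite oppr_eq0 (negbTE H1)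
        | by rewrite eq_sym (negbTE H1) | by rewrite eq_sym oppr_eq0 (negbTE H1)
        | by rewrite -subr_eq0 opprK (negbTE H2) | by rewrite eq_sym -subr_eq0 opprK (negbTE H2)].
Qed.

Lemma legM m n : leg p (m * n) = leg p m * leg p n.
Proof.
apply: Fp_sign_inj; first exact: leg_cases.
  by case: (leg_cases m) => ->; case: (leg_cases n) => ->; by [constructor 1|constructor 2|constructor 3].
by rewrite intrM -!Fp_half_power // natrM exprMn.
Qed.

Lemma leg1 : leg p 1 = 1.
Proof. by rewrite /leg exp1n eqxx dvdn1 gtn_eqF. Qed.

Lemma leg_sqr n : ~~ (p %| n)%N -> leg p (n ^ 2) = 1.
Proof.
by rewrite -leg_eq0 -mulnn legM; case: (leg_cases n) => ->.
Qed.

Let half_pow_poly_roots (rs : seq 'F_p) :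
  uniq rs -> all (fun x => x ^+ p./2 == 1) rs -> (size rs <= p./2)%N.
Proof.
move=> us ars; have h0 : (0 < p./2)%N by rewrite half_gt0.
have sz : size ('X^(p./2) - 1 : {poly 'F_p}) = p./2.+1 by rewrite -polyC1 size_XnsubC.
rewrite -ltnS -sz; apply: max_poly_roots => //.
  by rewrite -size_poly_gt0 sz.
apply: sub_all ars => x /eqP hx.
by rewrite /root !hornerE hx subrr.
Qed.

Lemma leg_nonresidue : exists2 a, coprime a p & leg p a = -1.
Proof.
case: (boolP (all (fun a => leg p a == 1) (iota 1 p.-1))) => [H|/allPn[a]].
  have : (size [seq (a%:R : 'F_p) | a <- iota 1 p.-1] <= p./2)%N.
    apply: half_pow_poly_roots.
      rewrite map_inj_in_uniq ?iota_uniq // => a b; rewrite !mem_iota add1n (prednK p_gt0).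
      move=> /andP[_ ap] /andP[_ bp] /eqP; rewrite Fp_eq => /eqP.
      by rewrite !modn_small.
    apply/allP => x /mapP[a ha ->]; rewrite Fp_half_power.
    by have /eqP -> := allP H a ha.
  rewrite size_map size_iota -double_half_prime -addnn -{3}[p./2]addn0 leq_add2l leqn0.
  by rewrite -leqn0 leqNgt half_gt0 p_gt1.
rewrite mem_iota add1n (prednK p_gt0) => /andP[a0 ap] la; exists a.
  by rewrite coprime_sym prime_coprime // gtnNdvd.
case: (leg_cases a) la => // /eqP; first by rewrite leg_eq0 gtnNdvd.
by move=> ->.
Qed.

(** The [p./2] squares of [1, ..., p./2] already exhaust the roots of [X^(p./2) - 1], so a further
    root [n] is impossible. *)
Lemma leg_square_root n : leg p n = 1 -> exists x, x ^ 2 = n %[mod p].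
Proof.
move=> ln; case: (boolP (has (fun x => x ^ 2 == n %[mod p])%N (iota 1 p./2))) => [/hasP[x _ /eqP]|].
  by exists x.
rewrite -all_predC => /allP H.
have h2 : (p./2.*2 < p)%N by rewrite double_half_prime prednK.
have small a : a \in iota 1 p./2 -> (0 < a)%N /\ (a <= p./2)%N.
  by rewrite mem_iota add1n ltnS => /andP[].
have : (size ((n%:R : 'F_p) :: [seq (a%:R : 'F_p) ^+ 2 | a <- iota 1 p./2]) <= p./2)%N.
  apply: half_pow_poly_roots => /=.
    apply/andP; split.
      apply/mapP => -[a ha /eqP]; rewrite -natrX Fp_eq eq_sym => E.
      by have := H a ha; rewrite /= E.
    rewrite map_inj_in_uniq ?iota_uniq // => a b /small[a0 ah] /small[b0 bh] /eqP.
    rewrite eqf_sqr => /orP[]; first by rewrite Fp_eq !modn_small => [/eqP||]; lia.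
    rewrite -addr_eq0 -natrD FpE => /dvdn_leq; rewrite addn_gt0 a0 => /(_ isT); lia.
  rewrite Fp_half_power ln rmorph1 eqxx /=; apply/allP => _ /mapP[a /small[a0 ah] ->].
  rewrite -natrX Fp_half_power leg_sqr ?rmorph1 // gtnNdvd //; lia.
by rewrite /= size_map size_iota ltnn.
Qed.

Lemma leg_predp : leg p p.-1 = (-1) ^+ p./2.
Proof.
apply: Fp_sign_inj; first exact: leg_cases.
  by rewrite -signr_odd; case: (odd _); by [constructor 2|constructor 3].
rewrite -Fp_half_power rmorphXn /= rmorphN1; congr (_ ^+ _).
apply/eqP; rewrite -addr_eq0 -[1]/(1%:R) -natrD addn1 prednK // FpE; exact: dvdnn.
Qed.

(* Gauss's lemma: [fold_res a i] is the absolutely least residue of [a * i], up to sign. *)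
Definition big_res a i := (p./2 < (a * i) %% p)%N.
Definition fold_res a i := if big_res a i then (p - (a * i) %% p)%N else ((a * i) %% p)%N.

Lemma fold_resE a i : (fold_res a i)%:R = (-1) ^+ big_res a i * (a * i)%:R :> 'F_p.
Proof.
rewrite /fold_res; case: (big_res a i); rewrite ?expr0 ?expr1 ?mul1r ?Fp_nat_mod //.
rewrite natrB ?(ltnW (ltn_pmod _ _)) // Fp_nat_mod // pchar_Fp_0 // sub0r mulN1r //.
Qed.

Lemma fold_res_bij a : coprime a p ->
  perm_eq [seq fold_res a i | i <- iota 1 p./2] (iota 1 p./2).
Proof.
move=> cop; have h2 : (p./2.*2 = p.-1)%N := double_half_prime.
have small i : i \in iota 1 p./2 -> (0 < i)%N /\ (i <= p./2)%N.
  by rewrite mem_iota add1n ltnS => /andP[].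
have npi i : i \in iota 1 p./2 -> ~~ (p %| a * i)%N.
  move=> /small[i0 ih]; rewrite Gauss_dvdr 1?coprime_sym // gtnNdvd //; lia.
have ran i : i \in iota 1 p./2 -> fold_res a i \in iota 1 p./2.
  move=> /npi; rewrite /dvdn mem_iota /fold_res /big_res add1n ltnS.
  have := ltn_pmod (a * i) p_gt0; move: ((a * i) %% p)%N => r.
  by case: (ltnP p./2 r) => ? ? ?; apply/andP; split; lia.
have uq : uniq [seq fold_res a i | i <- iota 1 p./2].
  rewrite map_inj_in_uniq ?iota_uniq // => i j hi hj.
  have [i0 ih] := small _ hi; have [j0 jh] := small _ hj.
  have a0 : a%:R != 0 :> 'F_p by rewrite FpE -prime_coprime // coprime_sym.
  move/(congr1 (fun n => n%:R : 'F_p)); rewrite !fold_resE !natrM.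
  have [s ->] : exists b : bool, (-1) ^+ big_res a i * (a%:R * i%:R) = a%:R * ((-1) ^+ b * i%:R) :> 'F_p.
    by exists (big_res a i); rewrite mulrCA.
  rewrite [(-1) ^+ big_res a j * _]mulrCA => /(mulfI a0).
  have [b ->] : exists b : bool, (-1) ^+ s * i%:R = (-1) ^+ big_res a j * ((-1) ^+ b * i%:R) :> 'F_p.
    exists (s (+) big_res a j); rewrite mulrA -signr_addb; congr (_ ^+ _ * _).
    by rewrite addbC addbK.
  have s0 (k : bool) : (-1) ^+ k != 0 :> 'F_p by rewrite signr_eq0.
  move/(mulfI (s0 _)); case: b; rewrite ?expr1 ?expr0 ?mulN1r ?mul1r => /eqP.
    rewrite eq_sym -subr_eq0 opprK -natrD FpE => /dvdn_leq; rewrite addn_gt0 j0 => /(_ isT); lia.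
  rewrite Fp_eq !modn_small => [/eqP||]; lia.
apply: uniq_perm => //; first exact: iota_uniq.
have sub : {subset [seq fold_res a i | i <- iota 1 p./2] <= iota 1 p./2}.
  by move=> x /mapP[i hi ->]; apply: ran.
by have [] := uniq_min_size uq sub; rewrite ?size_map.
Qed.

Lemma gauss_lemma a : coprime a p ->
  leg p a = \prod_(i <- iota 1 p./2) (-1) ^+ big_res a i.
Proof.
move=> cop; apply: Fp_sign_inj; first exact: leg_cases.
  elim/big_ind: _ => [|x y|i _]; first by constructor 2.
    by case=> ->; case=> ->; by [constructor 1|constructor 2|constructor 3].
  by case: (big_res a i); by [constructor 2|constructor 3].
rewrite -Fp_half_power.
have h2 : (p./2.*2 = p.-1)%N := double_half_prime.
pose F := \prod_(i <- iota 1 p./2) (i%:R : 'F_p).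
have F0 : F != 0.
  rewrite prodf_seq_neq0; apply/allP => i; rewrite mem_iota add1n ltnS => /andP[i0 ih] /=.
  rewrite FpE gtnNdvd //; lia.
have E : F = (\prod_(i <- iota 1 p./2) (-1) ^+ big_res a i) * (a%:R ^+ p./2 * F).
  rewrite {1}/F -(perm_big _ (fold_res_bij cop)) big_map /=.
  under eq_bigr do rewrite fold_resE natrM.
  rewrite big_split /= big_split /=; congr (_ * (_ * _)).
  by elim: p./2 1%N => [|h IH] m; rewrite ?big_nil //= big_cons IH exprS.
have S2 : (\prod_(i <- iota 1 p./2) (-1) ^+ big_res a i) ^+ 2 = 1 :> 'F_p.
  by rewrite -prodrXl big1 // => i _; rewrite sqrr_sign.
have /(mulIf F0) <- : (\prod_(i <- iota 1 p./2) (-1) ^+ big_res a i) * F = a%:R ^+ p./2 * F.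
  by rewrite [in LHS]E mulrA -expr2 S2 mul1r.
rewrite rmorph_prod; apply: eq_bigr => i _; by rewrite rmorphXn /= rmorphN1.
Qed.

Lemma prod_sign_seq (I : Type) (r : seq I) (b : I -> bool) :
  \prod_(i <- r) (-1) ^+ b i = (-1) ^+ (\big[addb/false]_(i <- r) b i) :> int.
Proof.
by elim/big_rec2: _ => // i x y _ ->; rewrite signr_addb.
Qed.

Lemma eisenstein_lemma a : odd a -> coprime a p ->
  leg p a = (-1) ^+ (\sum_(i <- iota 1 p./2) (a * i) %/ p)%N.
Proof.
move=> oa cop; rewrite gauss_lemma // prod_sign_seq -[RHS]signr_odd; congr (_ ^+ (nat_of_bool _)).
rewrite (big_morph odd oddD (erefl _ : odd 0 = false)).
have E : \big[addb/false]_(i <- iota 1 p./2) odd (fold_res a i) = \big[addb/false]_(i <- iota 1 p./2) odd i.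
  by rewrite -[RHS](perm_big _ (fold_res_bij cop)) big_map.
(* Modulo 2, [i] is quotient plus remainder of [a * i], and folding changes the parity of the
   remainder exactly when it is big. The folded residues permute the [i], so both parity sums
   cancel. *)
have E2 : \big[addb/false]_(i <- iota 1 p./2) (odd (fold_res a i) (+) (big_res a i (+) odd (a * i %/ p)))
   = \big[addb/false]_(i <- iota 1 p./2) odd i.
  apply: eq_bigr => i _; have := congr1 odd (divn_eq (a * i) p).
  rewrite oddD !oddM oa p_odd andbT /= => ->.
  rewrite /fold_res; case: (big_res a i) => /=; last by rewrite addbC.
  rewrite oddB ?(ltnW (ltn_pmod _ _)) // p_odd.
  by case: (odd (a * i %% p)); case: (odd (a * i %/ p)).
move: E2; rewrite big_split /= big_split /= E -[RHS]addbF => /addbI.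
set x := \big[_/_]_(_ <- _) _; set y := \big[_/_]_(_ <- _) _.
by case: x; case: y.
Qed.

End Legendre.

Lemma index_iota1 H : iota 1 H = index_iota 1 H.+1.
Proof. by rewrite /index_iota subSS subn0. Qed.

Lemma sum_iota_leq K H : (K <= H)%N -> (\sum_(j <- iota 1 H) (j <= K))%N = K.
Proof.
elim: H => [|H IH] KH; first by rewrite big_nil; case: K KH.
rewrite index_iota1 big_nat_recr //= -index_iota1; move: KH; rewrite leq_eqVlt => /orP[/eqP ->|KH].
  rewrite leqnn big_seq (eq_bigr (fun=> 1%N)) -?big_seq ?sum1_size ?size_iota ?addn1 //.
  by move=> i; rewrite mem_iota add1n ltnS => /andP[_ iH]; rewrite leqW.
by rewrite IH // leqNgt KH addn0.
Qed.

Lemma lattice_count p q : prime p -> prime q -> odd p -> odd q -> p != q ->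
  (\sum_(i <- iota 1 p./2) (q * i) %/ p + \sum_(j <- iota 1 q./2) (p * j) %/ q = p./2 * q./2)%N.
Proof.
have H (a b : nat) : prime a -> odd a -> odd b ->
    (\sum_(i <- iota 1 a./2) (b * i) %/ a
     = \sum_(i <- iota 1 a./2) \sum_(j <- iota 1 b./2) (a * j <= b * i))%N.
  move=> pa oa ob; apply: eq_big_seq => i; rewrite mem_iota add1n ltnS => /andP[i0 ia].
  have a0 := prime_gt0 pa.
  rewrite -[LHS](@sum_iota_leq _ b./2); last first.
    rewrite -ltnS ltn_divLR //.
    have ea : (a = a./2.*2.+1)%N by rewrite -[LHS]odd_double_half oa.
    have eb : (b = b./2.*2.+1)%N by rewrite -[LHS]odd_double_half ob.
    move: ea eb ia; move: a./2 b./2 => s t -> -> ia; nia.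
  by apply: eq_bigr => j _; rewrite leq_divRL // mulnC.
move=> pp pq op oq npq; rewrite (H p q) // (H q p) // [X in (_ + X)%N]exchange_big /=.
rewrite -big_split /= -[RHS]/(p./2 * q./2)%N.
transitivity (\sum_(i <- iota 1 p./2) q./2)%N; last first.
  by rewrite big_const_seq count_predT size_iota iter_addn_0 mulnC.
apply: eq_big_seq => i; rewrite mem_iota add1n ltnS => /andP[i0 ip].
rewrite -big_split /= -[RHS](size_iota 1) -sum1_size.
apply: eq_big_seq => j; rewrite mem_iota add1n ltnS => /andP[j0 jq].
case: (ltngtP (p * j) (q * i)) => // E.
have : (p %| i)%N.
  by rewrite -(Gauss_dvdr i (_ : coprime p q)) -?E ?dvdn_mulr // prime_coprime // dvdn_prime2.
move/(dvdn_leq i0); have := odd_double_half p; rewrite op; lia.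
Qed.

Theorem quadratic_reciprocity p q : prime p -> prime q -> odd p -> odd q -> p != q ->
  leg p q * leg q p = (-1) ^+ (p./2 * q./2).
Proof.
move=> pp pq op oq npq.
have cop : coprime p q by rewrite prime_coprime // dvdn_prime2.
rewrite (eisenstein_lemma pp op oq) 1?coprime_sym // (eisenstein_lemma pq oq op) //.
by rewrite -exprD lattice_count.
Qed.

(** For [p = 8m + 3], [p./2 = 4m + 1], and [2i] exceeds it exactly for [2m < i <= 4m + 1]: an odd
    number, [2m + 1], of sign changes. *)
Lemma leg_2 p : prime p -> (p %% 8 = 3)%N -> leg p 2 = -1.
Proof.
move=> pp p3; have op : odd p by rewrite (divn_eq p 8) p3 oddD oddM andbF.
have ep : (p./2 = 2 * (2 * (p %/ 8)) + 1)%N.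
  by have := divn_eq p 8; rewrite p3; lia.
set k := (2 * (p %/ 8))%N in ep.
have ep' : (p = 2 * p./2 + 1)%N by have := odd_double_half p; rewrite op; lia.
have cop : coprime 2 p by rewrite coprime2n.
rewrite gauss_lemma //.
have -> : iota 1 p./2 = iota 1 k ++ iota (1 + k) k.+1 by rewrite -iotaD ep; congr iota; lia.
have H i : (0 < i)%N -> (i <= p./2)%N -> big_res p 2 i = (k < i)%N.
  move=> i0 ip; rewrite /big_res modn_small; last by lia.
  by rewrite ep; apply/idP/idP; lia.
rewrite big_cat big_seq big1 ?mul1r; last first.
  move=> i; rewrite mem_iota => /andP[i1 i2]; rewrite H; [|lia|lia].
  by have -> : (k < i)%N = false by apply/negbTE; rewrite -leqNgt; lia.
rewrite big_seq.
rewrite (eq_bigr (fun=> -1)); last first.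
  move=> i; rewrite mem_iota => /andP[i1 i2]; rewrite H; [|lia|lia].
  by move: i1; rewrite add1n => ->.
rewrite -big_seq big_const_seq count_predT size_iota.
have -> : iter k.+1 ( *%R (-1)) 1 = (-1) ^+ k.+1 :> int.
  by elim: k.+1 => // n IH; rewrite iterS IH exprS.
by rewrite -signr_odd /= oddM.
Qed.

(** [chi4] and [chi8] are the symbols of -1 and of 2; both are -1 only in the class 3 modulo 8. *)
Definition chi4 (n : nat) : int := nth 0 [:: 0; 1; 0; -1] (n %% 4).
Definition chi8 (n : nat) : int := nth 0 [:: 0; 1; 0; -1; 0; -1; 0; 1] (n %% 8).

Lemma chi4M m n : chi4 (m * n) = chi4 m * chi4 n.
Proof.
have H : all (fun i => all (fun j => chi4 (i * j) == chi4 i * chi4 j) (iota 0 4)) (iota 0 4) by [].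
have E k : chi4 k = chi4 (k %% 4) by rewrite /chi4 modn_mod.
rewrite (E m) (E n) E -modnMm -E; apply/eqP.
have /allP/(_ (m %% 4)%N) := H; rewrite mem_iota ltn_mod => /(_ isT).
by move/allP/(_ (n %% 4)%N); rewrite mem_iota ltn_mod => /(_ isT).
Qed.

Lemma chi8M m n : chi8 (m * n) = chi8 m * chi8 n.
Proof.
have H : all (fun i => all (fun j => chi8 (i * j) == chi8 i * chi8 j) (iota 0 8)) (iota 0 8) by [].
have E k : chi8 k = chi8 (k %% 8) by rewrite /chi8 modn_mod.
rewrite (E m) (E n) E -modnMm -E; apply/eqP.
have /allP/(_ (m %% 8)%N) := H; rewrite mem_iota ltn_mod => /(_ isT).
by move/allP/(_ (n %% 8)%N); rewrite mem_iota ltn_mod => /(_ isT).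
Qed.

Lemma chi4_cases n : [\/ chi4 n = 0, chi4 n = 1 | chi4 n = -1].
Proof.
rewrite /chi4; have := ltn_pmod n (isT : 0 < 4)%N; case: (n %% 4)%N => [|[|[|[|]]]] //= _;
by [constructor 1|constructor 2|constructor 3].
Qed.

Lemma chi8_cases n : [\/ chi8 n = 0, chi8 n = 1 | chi8 n = -1].
Proof.
rewrite /chi8; have := ltn_pmod n (isT : 0 < 8)%N; case: (n %% 8)%N => [|[|[|[|[|[|[|[|]]]]]]]] //= _;
by [constructor 1|constructor 2|constructor 3].
Qed.

Lemma chi48 n : chi4 n = -1 -> chi8 n = -1 -> (n %% 8 = 3)%N.
Proof.
have -> : chi4 n = chi4 (n %% 8) by rewrite /chi4 modn_dvdm.
rewrite /chi8; have := ltn_pmod n (isT : 0 < 8)%N.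
by case: (n %% 8)%N => [|[|[|[|[|[|[|[|]]]]]]]].
Qed.

Lemma chinese_one d d' c : coprime d d' -> coprime c d ->
  exists a, [/\ coprime a (d * d'), a = c %[mod d] & a = 1 %[mod d']].
Proof.
move=> dd' cd; exists (chinese d d' c 1).
have E1 := chinese_modl dd' c 1; have E2 := chinese_modr dd' c 1.
split=> //; rewrite coprimeMr -coprime_modl E1 coprime_modl cd -coprime_modl E2 coprime_modl.
exact: coprime1n.
Qed.

Lemma leg_congr p a b : a = b %[mod p] -> leg p a = leg p b.
Proof. by move=> E; rewrite -leg_mod E leg_mod. Qed.

Section ChooseThePrime.
Variables (R : archiRealFieldType) (lg : nat -> R).
Hypothesis lgM : forall m n, (0 < m)%N -> (0 < n)%N -> lg (m * n)%N = lg m + lg n.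
Hypothesis lg_up : forall n, (0 < n)%N -> lg n.+1 - lg n <= n%:R^-1.
Hypothesis lg_lo : forall n, (0 < n)%N -> n.+1%:R^-1 <= lg n.+1 - lg n.

Definition to_real (g : nat -> int) (n : nat) : R := (g n)%:~R.

Lemma real_char_int N (g : nat -> int) : g 1%N = 1 -> {morph g : m n / (m * n)%N >-> m * n} ->
    (forall n, g (n + N)%N = g n) -> (forall n, [\/ g n = 0, g n = 1 | g n = -1]) ->
  real_char N (to_real g).
Proof.
move=> g1 gM gN gv; split.
- by rewrite /to_real g1.
- by move=> m n; rewrite /to_real gM intrM.
- by move=> n; rewrite /to_real gN.
- by move=> n; rewrite /to_real; case: (gv n) => ->; [constructor 1|constructor 2|constructor 3].
Qed.

Lemma periodic_dvdn (T : Type) (g : nat -> T) d N : (d %| N)%N ->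
  (forall n, g (n %% d)%N = g n) -> forall n, g (n + N)%N = g n.
Proof. by move=> /dvdnP[k ->] gd n; rewrite -gd addnC modnMDl gd. Qed.

Lemma to_real_inj (g : nat -> int) n (a : int) : to_real g n = a%:~R -> g n = a.
Proof. by move/intr_inj. Qed.

(* Each odd prime of [Q] divides the modulus [8 * M] exactly once. *)
Lemma prime_with_prescribed_symbols (Q : seq nat) M (E : nat -> int) :
    (0 < M)%N -> odd M -> uniq Q ->
    (forall p, p \in Q -> prime p /\ exists2 M', M = (p * M')%N & coprime p M') ->
    (forall p, p \in Q -> E p = 1 \/ E p = -1) ->
  exists l, [/\ prime l, coprime l (8 * M), (l %% 8 = 3)%N & forall p, p \in Q -> leg p l = E p].
Proof.
move=> M0 oM uQ QM EQ; set N := (8 * M)%N.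
have N0 : (0 < N)%N by rewrite muln_gt0.
have oddQ p : p \in Q -> odd p.
  by move=> /QM[_ [M' eM _]]; move: oM; rewrite eM oddM => /andP[].
have c8 n : odd n -> coprime 8 n by move=> on; rewrite -[8%N]/(2 ^ 3)%N coprimeXl // coprime2n.
have c8M := c8 M oM.
pose lQ s := [seq (to_real (leg p), (E p)%:~R : R) | p <- s].
pose l := (to_real chi4, -1) :: (to_real chi8, -1) :: lQ Q.
have ch4 : real_char N (to_real chi4).
  apply: real_char_int => //; [exact: chi4M| |exact: chi4_cases].
  by apply: (@periodic_dvdn _ _ 4) => [|n]; rewrite ?/chi4 ?modn_mod // dvdn_mulr.
have ch8 : real_char N (to_real chi8).
  apply: real_char_int => //; [exact: chi8M| |exact: chi8_cases].
  by apply: (@periodic_dvdn _ _ 8) => [|n]; rewrite ?/chi8 ?modn_mod // dvdn_mulr.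
have chl p : p \in Q -> real_char N (to_real (leg p)).
  move=> pQ; have [pp [M' eM _]] := QM p pQ; have op := oddQ p pQ.
  apply: real_char_int; [exact: leg1|exact: legM| |exact: leg_cases].
  by apply: (@periodic_dvdn _ _ p) => [|n]; rewrite ?leg_mod // /N eM mulnCA dvdn_mulr.
have chars_lQ s : {subset s <= Q} -> chars N (lQ s).
  elim: s => //= p s IH sQ; split.
  - by apply: chl; apply: sQ; rewrite mem_head.
  - by case: (EQ p (sQ _ (mem_head _ _))) => ->; [left|right; rewrite mulrN1z].
  - by apply: IH => x xs; apply: sQ; rewrite inE xs orbT.
have triv a s : {subset s <= Q} -> (forall p, p \in s -> a = 1 %[mod p]) -> trivial_at a (lQ s).
  elim: s => //= p s IH sQ H; split.
    have pQ := sQ _ (mem_head p s); have [pp _] := QM p pQ.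
    by rewrite /to_real (leg_congr (H p (mem_head _ _))) leg1.
  by apply: IH => x xs; [apply: sQ|apply: H]; rewrite inE xs orbT.
have sep_lQ s : {subset s <= Q} -> uniq s -> separated N (lQ s).
  elim: s => //= p s IH sQ /andP[ps us].
  have sQ' : {subset s <= Q} by move=> x xs; apply: sQ; rewrite inE xs orbT.
  split; last exact: IH.
  have pQ := sQ _ (mem_head p s); have [pp [M' eM cpM']] := QM p pQ; have op := oddQ p pQ.
  have [c cp lc] := leg_nonresidue pp op.
  have cp8 : coprime p (8 * M') by rewrite coprimeMr cpM' andbT coprime_sym c8.
  have [a [aN ac a1]] := chinese_one cp8 cp.
  exists a; split; first by rewrite /N eM mulnCA.
    by rewrite /to_real (leg_congr ac) lc mulrN1z.
  apply: triv => // q qs; have [qq [M2 eM2 _]] := QM q (sQ' _ qs).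
  have qM' : (q %| 8 * M')%N.
    have : (q %| p * M')%N by rewrite -eM eM2 dvdn_mulr.
    rewrite Gauss_dvdr; first by move=> h; rewrite dvdn_mull.
    rewrite prime_coprime // dvdn_prime2 //; apply: contra ps => /eqP <- //.
  by have /(congr1 (modn^~ q)) := a1; rewrite !modn_dvdm.
have at_res (c : nat) : coprime c 8 -> exists a, [/\ coprime a N, a = c %[mod 8] & trivial_at a (lQ Q)].
  move=> c8'; have [a [aN ac a1]] := chinese_one c8M c8'; exists a; split=> //.
  apply: triv => // q qQ; have [qq [M2 eM2 _]] := QM q qQ.
  have qM : (q %| M)%N by rewrite eM2 dvdn_mulr.
  by have /(congr1 (modn^~ q)) := a1; rewrite !modn_dvdm.
have chars_l : chars N l.
  by split=> //=; [right|split=> //; [right|apply: chars_lQ]].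
have sep_l : separated N l.
  (* In the class 7 [chi4] is -1 and [chi8] is 1; in the class 3 [chi8] is -1. Both points are 1
     modulo every prime of [Q]. *)
  have [a [aN a8 aQ]] := at_res 7%N isT; have [b [bN b8 bQ]] := at_res 3%N isT.
  split; last split; [exists a|exists b|exact: sep_lQ]; split=> //.
  - by rewrite /to_real /chi4 -(@modn_dvdm 8) // a8 mulrN1z.
  - by split=> //; rewrite /to_real /chi8 a8.
  - by rewrite /to_real /chi8 b8 mulrN1z.
have f0l : exists l1 l2, l = l1 ++ (to_real chi4, -1) :: l2.
  by exists [::], ((to_real chi8, -1) :: lQ Q).
have [p [pp copp H]] := prime_with_prescribed_characters lgM lg_up lg_lo N0 chars_l sep_l f0l.
exists p; split=> //.
  apply: chi48; apply: to_real_inj; rewrite mulrN1z.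
    by apply: (H _ _ [::] ((to_real chi8, -1) :: lQ Q)).
  by apply: (H _ _ [:: (to_real chi4, -1)] (lQ Q)).
move=> q qQ; apply: to_real_inj.
have [s1 [s2 eQ]] : exists s1 s2, Q = s1 ++ q :: s2.
  by case/splitPr: qQ => s1 s2; exists s1, s2.
apply: (H _ _ ((to_real chi4, -1) :: (to_real chi8, -1) :: lQ s1) (lQ s2)).
by rewrite /l /lQ eQ map_cat.
Qed.

End ChooseThePrime.

(** * Legendre's equation *)

Lemma nat_sqrt n : exists x, (x ^ 2 <= n < x.+1 ^ 2)%N.
Proof.
elim: n => [|n [x /andP[h1 h2]]]; first by exists 0%N.
case: (leqP (x.+1 ^ 2) n.+1) => h; last by exists x; rewrite h (leq_trans h1).
exists x.+1; rewrite h /=; apply: leq_ltn_trans h2 _.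
by rewrite ltn_exp2r.
Qed.

Lemma sqr_subz_le (k l n : nat) : (k <= n)%N -> (l <= n)%N ->
  (k%:Z - l%:Z) ^+ 2 <= (n ^ 2)%N%:Z.
Proof.
move=> kn ln; rewrite -subr_ge0.
have -> : (n ^ 2)%N%:Z - (k%:Z - l%:Z) ^+ 2 = (n%:Z - (k%:Z - l%:Z)) * (n%:Z + (k%:Z - l%:Z)).
  by rewrite -mulnn PoszM; ring.
by rewrite mulr_ge0 //; lia.
Qed.

Lemma dvdz_combination (d u v al u' v' : nat) : (u + al * v = u' + al * v' %[mod d])%N ->
  (d %| (u%:Z - u'%:Z) + al%:Z * (v%:Z - v'%:Z))%Z.
Proof.
move=> E; have -> : (u%:Z - u'%:Z) + al%:Z * (v%:Z - v'%:Z)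
  = (u + al * v)%N%:Z - (u' + al * v')%N%:Z by rewrite !PoszD !PoszM; ring.
by rewrite -eqz_mod_dvd; apply/eqP; rewrite !modz_nat E.
Qed.

(** Pigeonhole: the box with sides the integral square roots of [bc], [ac], [ab] has more than [abc]
    points, and there are [abc] classes. Differences keep the bounds. *)
Lemma small_solution (a b c al be ga : nat) : (0 < a)%N -> (0 < b)%N -> (0 < c)%N ->
  exists x y z : int, [/\ [\/ x != 0, y != 0 | z != 0],
    [/\ x ^+ 2 <= (b * c)%:Z, y ^+ 2 <= (a * c)%:Z & z ^+ 2 <= (a * b)%:Z],
    (c %| x + al%:Z * y)%Z, (a %| y + be%:Z * z)%Z & (b %| z + ga%:Z * x)%Z].
Proof.
move=> a0 b0 c0.
have [X /andP[X1 X2]] := nat_sqrt (b * c); have [Y /andP[Y1 Y2]] := nat_sqrt (a * c).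
have [Z /andP[Z1 Z2]] := nat_sqrt (a * b).
pose f (u : 'I_X.+1 * 'I_Y.+1 * 'I_Z.+1) : 'I_c * 'I_a * 'I_b :=
  (Ordinal (ltn_pmod (u.1.1 + al * u.1.2) c0), Ordinal (ltn_pmod (u.1.2 + be * u.2) a0),
   Ordinal (ltn_pmod (u.2 + ga * u.1.1) b0)).
have : ~ injective f.
  move=> /leq_card; rewrite !card_prod !card_ord => H.
  have : ((X.+1 * Y.+1 * Z.+1) ^ 2 <= (c * a * b) ^ 2)%N by rewrite leq_exp2r.
  rewrite leqNgt => /negP; apply.
  have -> : ((c * a * b) ^ 2 = (b * c) * (a * c) * (a * b))%N by ring.
  by rewrite !expnMn; apply: ltn_mul => //; apply: ltn_mul.
move/injectiveP; rewrite /injectiveb => /dinjectivePn[[[x y] z] _ [[[x' y'] z']]].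
rewrite inE /= => /andP[ne _] [] E1 E2 E3.
exists (x%:Z - x'%:Z), (y%:Z - y'%:Z), (z%:Z - z'%:Z).
split.
- case: (altP (x =P x')) => [ex|nx]; last by constructor 1; rewrite subr_eq0 eqz_nat.
  case: (altP (y =P y')) => [ey|ny]; last by constructor 2; rewrite subr_eq0 eqz_nat.
  constructor 3; rewrite subr_eq0 eqz_nat; apply: contraNneq ne => /val_inj ez.
  by rewrite ex ey ez.
- split; [apply: le_trans (@sqr_subz_le _ _ X _ _) _|apply: le_trans (@sqr_subz_le _ _ Y _ _) _|
    apply: le_trans (@sqr_subz_le _ _ Z _ _) _] => //; by rewrite -ltnS.
- exact: dvdz_combination.
- exact: dvdz_combination.
- exact: dvdz_combination.
Qed.

(* A small solution of the congruences gives [a x^2 + b y^2 - c z^2 = 0], or [= a b c], and in the latter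
   case [a (xz + by)^2 + b (yz - ax)^2 = c (z^2 + ab)^2]. *)
Theorem legendre (a b c al be ga : nat) : (0 < a)%N -> (0 < b)%N -> (0 < c)%N ->
    coprime a b -> coprime a c -> coprime b c ->
    (forall x, x ^ 2 <> b * c)%N -> (forall x, x ^ 2 <> a * b)%N ->
    (c %| a * al ^ 2 + b)%N -> b * be ^ 2 = c %[mod a] -> c * ga ^ 2 = a %[mod b] ->
  exists x y z : int, z != 0 /\ a%:Z * x ^+ 2 + b%:Z * y ^+ 2 = c%:Z * z ^+ 2.
Proof.
move=> a0 b0 c0 cab cac cbc nbc nab hc ha hb.
have [x [y [z [nz [x2 y2 z2] dc da db]]]] := small_solution al be ga a0 b0 c0.
pose V := a%:Z * x ^+ 2 + b%:Z * y ^+ 2 - c%:Z * z ^+ 2.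
have dvda : (a %| V)%Z.
  have /dvdzP[k ek] := da.
  have /eqP : ((b * be ^ 2)%N%:Z = c%:Z %[mod a])%Z by rewrite !modz_nat ha.
  rewrite eqz_mod_dvd => /dvdzP[h eh].
  have -> : V = (x ^+ 2 + h * z ^+ 2 + k * (b%:Z * (y - be%:Z * z))) * a%:Z.
    have ey : y = k * a%:Z - be%:Z * z by rewrite -ek; ring.
    have ec : c%:Z = b%:Z * be%:Z ^+ 2 - h * a%:Z by rewrite -eh PoszM -rmorphXn /=; ring.
    rewrite /V ec ey; ring.
  exact: dvdz_mull.
have dvdb : (b %| V)%Z.
  have /dvdzP[k ek] := db.
  have /eqP : ((c * ga ^ 2)%N%:Z = a%:Z %[mod b])%Z by rewrite !modz_nat hb.
  rewrite eqz_mod_dvd => /dvdzP[h eh].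
  have -> : V = (y ^+ 2 - h * x ^+ 2 - k * (c%:Z * (z - ga%:Z * x))) * b%:Z.
    have ez : z = k * b%:Z - ga%:Z * x by rewrite -ek; ring.
    have ea : a%:Z = c%:Z * ga%:Z ^+ 2 - h * b%:Z by rewrite -eh PoszM -rmorphXn /=; ring.
    rewrite /V ea ez; ring.
  exact: dvdz_mull.
have dvdc : (c %| V)%Z.
  have /dvdzP[k ek] := dc.
  have /dvdzP[h eh] : (c %| (a * al ^ 2 + b)%N%:Z)%Z by [].
  have -> : V = (h * y ^+ 2 - z ^+ 2 + k * (a%:Z * (x - al%:Z * y))) * c%:Z.
    have ex : x = k * c%:Z - al%:Z * y by rewrite -ek; ring.
    have eb : b%:Z = h * c%:Z - a%:Z * al%:Z ^+ 2 by rewrite -eh PoszD PoszM -rmorphXn /=; ring.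
    rewrite /V eb ex; ring.
  exact: dvdz_mull.
have /dvdzP[k ek] : ((a * b * c)%N %| V)%Z.
  rewrite !PoszM Gauss_dvdz; last by rewrite -PoszM coprimezE /= coprimeMl cac cbc.
  by rewrite Gauss_dvdz ?dvda ?dvdb ?dvdc.
(* Since [bc] and [ab] are not squares, the bounds on [x] and [z] are strict, so
   [- abc < V < 2abc]. *)
have x2' : x ^+ 2 < (b * c)%:Z.
  rewrite lt_neqAle x2 andbT; apply/eqP => E; apply: (nbc `|x|%N).
  by have := congr1 absz E; rewrite abszX.
have z2' : z ^+ 2 < (a * b)%:Z.
  rewrite lt_neqAle z2 andbT; apply/eqP => E; apply: (nab `|z|%N).
  by have := congr1 absz E; rewrite abszX.
have ax : a%:Z * x ^+ 2 < (a * b * c)%:Z by rewrite -mulnA PoszM ltr_pM2l.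
have bY : b%:Z * y ^+ 2 <= (a * b * c)%:Z.
  by rewrite [(a * b)%N]mulnC -mulnA PoszM ler_pM2l.
have cz : c%:Z * z ^+ 2 < (a * b * c)%:Z by rewrite mulnC PoszM ltr_pM2l.
have s1 : 0 <= a%:Z * x ^+ 2 by rewrite mulr_ge0 // sqr_ge0.
have s2 : 0 <= b%:Z * y ^+ 2 by rewrite mulr_ge0 // sqr_ge0.
have s3 : 0 <= c%:Z * z ^+ 2 by rewrite mulr_ge0 // sqr_ge0.
have k01 : k = 0 \/ k = 1.
  move: ek; rewrite /V; move: (a%:Z * x ^+ 2) (b%:Z * y ^+ 2) (c%:Z * z ^+ 2) ax bY cz s1 s2 s3.
  have : 0 < (a * b * c)%:Z by rewrite ltz_nat !muln_gt0 a0 b0.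
  move: (a * b * c)%:Z => n n0 u v w un vn wn u0 v0 w0 E.
  have kn : -1 < k by rewrite -(ltr_pM2r n0) -E; lra.
  have kn2 : k < 2 by rewrite -(ltr_pM2r n0) -E; lra.
  by clear -kn kn2; lia.
case: k01 => ek0; rewrite ek0 in ek.
  exists x, y, z; split; last by apply/eqP; rewrite -subr_eq0 -/V ek mul0r.
  apply/eqP => z0.
  have V0 : a%:Z * x ^+ 2 + b%:Z * y ^+ 2 = 0.
    by move: ek; rewrite /V z0 expr0n /= mulr0 subr0 mul0r.
  have x0 : x = 0.
    have : a%:Z * x ^+ 2 = 0 by lra.
    by move/eqP; rewrite mulf_eq0 sqrf_eq0 eqz_nat gtn_eqF //= => /eqP.
  have y0 : y = 0.
    have : b%:Z * y ^+ 2 = 0 by lra.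
    by move/eqP; rewrite mulf_eq0 sqrf_eq0 eqz_nat gtn_eqF //= => /eqP.
  by case: nz; rewrite ?x0 ?y0 ?z0 eqxx.
exists (x * z + b%:Z * y), (y * z - a%:Z * x), (z ^+ 2 + (a * b)%:Z); split.
  by rewrite gt_eqF // ltr_wpDl ?sqr_ge0 // ltz_nat muln_gt0 a0.
have E : a%:Z * x ^+ 2 + b%:Z * y ^+ 2 = c%:Z * (z ^+ 2 + (a * b)%:Z).
  by move: ek; rewrite /V mul1r !PoszM => /eqP; rewrite subr_eq => /eqP ->; ring.
have -> : a%:Z * (x * z + b%:Z * y) ^+ 2 + b%:Z * (y * z - a%:Z * x) ^+ 2
   = (a%:Z * x ^+ 2 + b%:Z * y ^+ 2) * (z ^+ 2 + (a * b)%:Z) by rewrite PoszM; ring.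
by rewrite E; ring.
Qed.

Lemma squarefree_decomposition m : (0 < m)%N ->
  exists m0 s, m = (m0 * s ^ 2)%N /\ forall p, prime p -> ~~ (p ^ 2 %| m0)%N.
Proof.
elim/ltn_ind: m => m IH m0.
case: (boolP (has (fun p => p ^ 2 %| m)%N (primes m))) => [/hasP[p]|/hasPn H].
  rewrite mem_primes => /and3P[pp _ _] /dvdnP[k ek].
  have p1 := prime_gt1 pp.
  have k0 : (0 < k)%N by move: m0; rewrite ek muln_gt0 => /andP[].
  have [|//|m1 [s [e1 H1]]] := IH k.
    by rewrite ek -{1}[k]muln1 ltn_pmul2l // -(exp1n 2) ltn_exp2r.
  by exists m1, (s * p)%N; rewrite ek e1 expnMn mulnA.
exists m, 1%N; rewrite exp1n muln1; split=> // p pp; apply/negP => pm.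
have : p \in primes m by rewrite mem_primes pp m0 (dvdn_trans _ pm) // dvdn_exp.
by move/H; rewrite pm.
Qed.

Lemma squarefree_prime_factor d p : (forall p, prime p -> ~~ (p ^ 2 %| d)%N) -> prime p ->
  (p %| d)%N -> exists2 d', d = (p * d')%N & coprime p d'.
Proof.
move=> sf pp /dvdnP[d' ed]; exists d'; first by rewrite ed mulnC.
rewrite prime_coprime //; apply: contra (sf p pp) => pd'.
by rewrite ed -mulnn dvdn_mul.
Qed.

Lemma square_root_mod n d : (0 < d)%N -> (forall p, prime p -> ~~ (p ^ 2 %| d)%N) ->
    (forall p, prime p -> (p %| d)%N -> exists x, x ^ 2 = n %[mod p])%N ->
  exists x, (x ^ 2 = n %[mod d])%N.
Proof.
elim/ltn_ind: d => d IH d0 sf H; case: (leqP d 1) => d1.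
  have -> : d = 1%N by apply/eqP; rewrite eqn_leq d1 d0.
  by exists 0%N; rewrite !modn1.
have pp := pdiv_prime d1; set p := pdiv d in pp.
have [d' ed cop] := squarefree_prime_factor sf pp (pdiv_dvd d).
have d'0 : (0 < d')%N by move: d0; rewrite ed muln_gt0 => /andP[].
have [|//|q qq|q qq qd'|y ey] := IH d'.
- by rewrite ed -{1}[d']mul1n ltn_pmul2r // prime_gt1.
- by apply: contra (sf q qq) => h; rewrite ed dvdn_mull.
- by apply: H => //; rewrite ed dvdn_mull.
have [x ex] := H p pp (pdiv_dvd d).
exists (chinese p d' x y); rewrite ed; apply/eqP; rewrite chinese_remainder //.
rewrite -modnXm chinese_modl // modnXm ex eqxx /=.
by rewrite -[X in X == _]modnXm chinese_modr // modnXm ey.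
Qed.

Lemma chi4_odd n : odd n -> chi4 n = (-1) ^+ n./2.
Proof.
move=> on; have en := odd_double_half n; rewrite on /= in en.
rewrite -signr_odd -{1}en /chi4; have := odd_double_half n./2.
move: (odd n./2) (n./2)./2 => b k <-; rewrite doubleD addnA addnC.
have -> : (k.*2.*2 = k * 4)%N by rewrite -!mul2n; ring.
by rewrite modnMDl; case: b.
Qed.

Lemma prime_divisor_ind (Pr : nat -> Prop) : Pr 1%N ->
    (forall p d, prime p -> (0 < d)%N -> Pr d -> Pr (p * d)%N) -> forall d, (0 < d)%N -> Pr d.
Proof.
move=> P1 PM; elim/ltn_ind => d IH d0; case: (leqP d 1) => d1.
  by have -> : d = 1%N by apply/eqP; rewrite eqn_leq d1 d0.
have pp := pdiv_prime d1; have /dvdnP[k ek] := pdiv_dvd d.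
have k0 : (0 < k)%N by move: d0; rewrite {1}ek muln_gt0 => /andP[].
rewrite ek mulnC; apply: PM => //; apply: IH => //.
by rewrite [X in (_ < X)%N]ek -{1}[k]muln1 ltn_pmul2l // prime_gt1.
Qed.

Lemma leg_pm1 p n : coprime p n -> prime p -> leg p n = 1 \/ leg p n = -1.
Proof.
move=> cop pp; case: (leg_cases p n) => [/eqP|->|->]; [|by left|by right].
by rewrite leg_eq0 -[(_ %| _)%N]negbK -prime_coprime // cop.
Qed.

Section AuxiliaryPrime.
Variables (R : archiRealFieldType) (lg : nat -> R).
Hypothesis lgM : forall m n, (0 < m)%N -> (0 < n)%N -> lg (m * n)%N = lg m + lg n.
Hypothesis lg_up : forall n, (0 < n)%N -> lg n.+1 - lg n <= n%:R^-1.
Hypothesis lg_lo : forall n, (0 < n)%N -> n.+1%:R^-1 <= lg n.+1 - lg n.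

(** These are the local conditions for [3x^2 + P l y^2 = 2 m0 z^2]. The symbols of [l] at 3 and at
    the primes of [m0] are prescribed, the condition at [P] is the hypothesis, and the one at [l]
    follows from it by reciprocity. [p.-1] stands for -1. *)
Lemma auxiliary_prime P m0 : P = 7%N \/ P = 5%N /\ chi4 m0 = 1 ->
    odd m0 -> coprime 3 m0 -> (forall p, prime p -> ~~ (p ^ 2 %| m0)%N) -> leg P (6 * m0) = 1 ->
  exists l, [/\ prime l, (l %% 8 = 3)%N, coprime l (3 * P * m0),
    leg 3 l = leg 3 (P * 2 * m0) /\ leg l (6 * m0) = 1 &
    forall p, prime p -> (p %| m0)%N -> leg p (p.-1 * (3 * P) * l) = 1].
Proof.
move=> hP om0 c3 sf hleg.
have m00 : (0 < m0)%N by case: m0 om0 {hP c3 sf hleg}.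
have [pP oP P3] : [/\ prime P, odd P & coprime 3 P] by case: hP => [->|[->]].
have cPm : coprime P m0.
  rewrite prime_coprime // -leg_eq0; apply/eqP => h.
  by move: hleg; rewrite legM // h mulr0.
pose Q := 3%N :: primes m0.
pose E p : int := if p == 3%N then leg 3 (P * 2 * m0) else leg p (p.-1 * (3 * P)).
have Qprime p : p \in Q -> prime p by rewrite inE mem_primes => /orP[/eqP->|/and3P[]].
have Qm p : p \in Q -> p = 3%N \/ (p %| m0)%N.
  by rewrite inE mem_primes => /orP[/eqP->|/and3P[_ _ h]]; [left|right].
have odd_div p : (p %| m0)%N -> odd p by move=> /dvdnP[k ek]; move: om0; rewrite ek oddM => /andP[].
have n3 p : (p %| m0)%N -> prime p -> coprime p 3.
  by move=> pm pp; rewrite coprime_sym (coprime_dvdr pm).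
have nP p : (p %| m0)%N -> prime p -> coprime p P.
  by move=> pm pp; rewrite coprime_sym (coprime_dvdr pm).
have npred p : prime p -> coprime p p.-1 by move=> pp; rewrite coprimenP // prime_gt0.
have [l [pl cl l3 lQ]] : exists l, [/\ prime l, coprime l (8 * (3 * P * m0)), (l %% 8 = 3)%N &
    forall p, p \in Q -> leg p l = E p].
  apply: (prime_with_prescribed_symbols lgM lg_up lg_lo).
  - by rewrite !muln_gt0 m00 (prime_gt0 pP).
  - by rewrite !oddM oP om0.
  - by rewrite /= primes_uniq andbT mem_primes m00 /= -prime_coprime.
  - move=> p pQ; have pp := Qprime p pQ; split=> //; case: (Qm p pQ) => [->|pm].
      by exists (P * m0)%N; rewrite ?mulnA // coprimeMr P3.
    have [d' ed cop] := squarefree_prime_factor sf pp pm.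
    exists (3 * P * d')%N; first by rewrite ed mulnCA.
    by rewrite !coprimeMr cop nP ?n3.
  - move=> p pQ; have pp := Qprime p pQ; rewrite /E; case: eqP => [_|p3].
      by apply: leg_pm1 => //; rewrite !coprimeMr P3 c3.
    case: (Qm p pQ) => // pm; apply: leg_pm1 => //.
    by rewrite !coprimeMr npred // n3 // nP.
have cl' : coprime l (3 * P * m0) by move: cl; rewrite coprimeMr => /andP[].
have ol : odd l by rewrite (divn_eq l 8) l3 oddD oddM andbF.
have [cl3 clP clm] : [/\ coprime l 3, coprime l P & coprime l m0].
  by move: cl'; rewrite !coprimeMr => /andP[/andP[-> ->] ->].
have ol2 : odd l./2.
  have -> : (l./2 = 2 * (2 * (l %/ 8)) + 1)%N by have := divn_eq l 8; rewrite l3; lia.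
  by rewrite oddD oddM.
have neq a b : prime a -> coprime a b -> a != b.
  by move=> pa cab; apply: contraTneq cab => <-; rewrite /coprime gcdnn gtn_eqF // prime_gt1.
have lE p : prime p -> (p %| m0)%N -> leg p l = leg p (p.-1 * (3 * P)).
  move=> pp pm; rewrite lQ ?inE ?mem_primes ?pp ?m00 ?pm ?orbT // /E.
  by case: eqP => // p3; have := n3 p pm pp; rewrite p3.
(* reciprocity moves each symbol [(p/l)] to the moduli [3], [P] and [4] *)
pose T n := leg 3 n * leg P n * chi4 n ^+ (1 + P./2).
have TM a b : T (a * b)%N = T a * T b by rewrite /T !legM // chi4M exprMn; ring.
have symb p : prime p -> (p %| m0)%N -> leg l p = T p.
  move=> pp pm; have op := odd_div p pm; have c4 := chi4_odd op.
  have clp : coprime l p := coprime_dvdr pm clm.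
  have h1 : leg l p * leg p l = chi4 p.
    rewrite quadratic_reciprocity ?(neq l p) // c4 -signr_odd oddM ol2 signr_odd //.
  have h2 : leg p 3 * leg 3 p = chi4 p.
    by rewrite quadratic_reciprocity ?(neq p 3) ?n3 // c4 muln1.
  have h3 : leg p P * leg P p = chi4 p ^+ P./2.
    by rewrite quadratic_reciprocity ?(neq p P) ?nP // c4 exprM.
  have h4 : leg p l = chi4 p * (leg p 3 * leg p P) by rewrite lE // !legM // leg_predp // -c4.
  have h5 : chi4 p = 1 \/ chi4 p = -1.
    by rewrite c4 -signr_odd; case: odd; [right|left].
  have h6 : leg 3 p = 1 \/ leg 3 p = -1 by apply: leg_pm1 => //; rewrite coprime_sym n3.
  have h7 : leg P p = 1 \/ leg P p = -1 by apply: leg_pm1 => //; rewrite coprime_sym nP.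
  have h8 : leg p 3 = chi4 p * leg 3 p.
    by rewrite -h2 -mulrA; case: h6 => ->; rewrite ?mulrNN !mulr1.
  have h9 : leg p P = chi4 p ^+ P./2 * leg P p.
    by rewrite -h3 -mulrA; case: h7 => ->; rewrite ?mulrNN !mulr1.
  have h10 : leg l p = chi4 p * leg p l.
    have : leg p l = 1 \/ leg p l = -1 by apply: leg_pm1; rewrite // coprime_sym.
    by rewrite -h1 -mulrA; case=> ->; rewrite ?mulrNN !mulr1.
  rewrite h10 h4 h8 h9 /T exprD expr1.
  have -> : chi4 p * (chi4 p * (chi4 p * leg 3 p * (chi4 p ^+ P./2 * leg P p)))
     = (chi4 p * chi4 p) * (leg 3 p * leg P p * (chi4 p * chi4 p ^+ P./2)) by ring.
  by case: h5 => ->; rewrite ?mulrNN !mul1r.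
have legm : leg l m0 = T m0.
  have H d : (0 < d)%N -> (d %| m0)%N -> leg l d = T d.
    move: d; apply: prime_divisor_ind => [_|p d pp d0 IH pd]; first by rewrite /T !leg1 // expr1n.
    rewrite legM // TM IH ?symb //; first by rewrite (dvdn_trans _ pd) // dvdn_mulr.
    by rewrite (dvdn_trans _ pd) // dvdn_mull.
  by apply: H.
have l3E : leg 3 l = leg 3 (P * 2 * m0) by rewrite lQ // inE.
have leg32 : leg 3 2 = -1 by rewrite /leg.
have hl3 : leg l 3 = - leg 3 l.
  have : leg l 3 * leg 3 l = -1.
    by rewrite quadratic_reciprocity ?(neq l 3) // -signr_odd oddM ol2.
  have : leg 3 l = 1 \/ leg 3 l = -1 by apply: leg_pm1; rewrite // coprime_sym.
  by case=> ->; rewrite ?mulr1 ?mulrN1 // => /oppr_inj ->; rewrite opprK.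
have leg3m : leg 3 m0 = 1 \/ leg 3 m0 = -1 by apply: leg_pm1.
have legPm : leg P m0 = 1 \/ leg P m0 = -1 by apply: leg_pm1.
exists l; split=> //; last first.
  move=> p pp pm; have op := odd_div p pm; rewrite legM // lE //.
  have : leg p (p.-1 * (3 * P)) = 1 \/ leg p (p.-1 * (3 * P)) = -1.
    by apply: leg_pm1 => //; rewrite !coprimeMr npred // n3 // nP.
  by case=> ->.
split=> //; have e6 : leg l 6 = - leg l 3 by rewrite -[6%N]/(2 * 3)%N legM // leg_2 // mulN1r.
rewrite legM // e6 hl3 opprK l3E !legM // leg32 legm /T.
have hx : chi4 m0 = 1 \/ chi4 m0 = -1 by rewrite chi4_odd // -signr_odd; case: odd; [right|left].
(* [chi4 m0] enters with exponent 4 for [P = 7] and 3 for [P = 5], hence the condition on [chi4] in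
   the second case. *)
case: hP => [eP|[eP c1]]; move: hleg legPm; rewrite eP legM //.
  have -> : leg 7 6 = -1 by rewrite /leg.
  have -> : leg 3 7 = 1 by rewrite /leg.
  have -> : chi4 m0 ^+ (1 + 7./2) = 1 by case: hx => ->.
  by case: leg3m => ->; case: (leg_cases 7 m0) => ->.
have -> : leg 5 6 = 1 by rewrite /leg.
have -> : leg 3 5 = -1 by rewrite /leg.
rewrite c1 expr1n; by case: leg3m => ->; case: (leg_cases 5 m0) => ->.
Qed.

End AuxiliaryPrime.

Lemma nonsquare_prime_mul p n x : prime p -> coprime p n -> (x ^ 2 <> p * n)%N.
Proof.
move=> pp cop E; have : (p %| x ^ 2)%N by rewrite E dvdn_mulr.
rewrite Euclid_dvdX //= andbT => /dvdnP[k ek].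
have : (p * (k * k * p) == p * n)%N by rewrite -E ek; apply/eqP; ring.
rewrite eqn_pmul2l ?prime_gt0 // => /eqP en.
by move: cop; rewrite prime_coprime // -en dvdn_mull.
Qed.

Lemma multiple_in_class c d y : coprime c d -> exists z, (c * z = y %[mod d])%N.
Proof.
move=> cop; have := chinese_modl cop 0 y; rewrite mod0n => /eqP /dvdnP[z ez].
by exists z; rewrite mulnC -ez chinese_modr.
Qed.

Lemma dvdn_add_mod d m n k : (m = n %[mod d])%N -> (d %| n + k)%N -> (d %| m + k)%N.
Proof. by move=> E; rewrite /dvdn -modnDml -E modnDml. Qed.

Lemma modn_cancel d c a b : coprime d c -> (c * a = c * b %[mod d])%N -> (a = b %[mod d])%N.
Proof.
move=> cop; wlog ab : a b / (a <= b)%N.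
  move=> H; case: (leqP a b) => [/H//|/ltnW ba E].
  by apply/esym/H => //; exact/esym.
move/eqP; rewrite eq_sym eqn_mod_dvd ?leq_mul2l ?ab ?orbT // -mulnBr Gauss_dvdr //.
by rewrite -eqn_mod_dvd // => /eqP.
Qed.

Lemma leg3_congr a b : coprime 3 a -> leg 3 a = leg 3 b -> (a = b %[mod 3])%N.
Proof.
rewrite prime_coprime // /dvdn => a3; rewrite -(leg_mod 3 a) -(leg_mod 3 b).
have := ltn_pmod a (isT : 0 < 3)%N; have := ltn_pmod b (isT : 0 < 3)%N.
by move: (a %% 3)%N (b %% 3)%N a3 => [|[|[|]]] // [|[|[|]]].
Qed.

Section RationalPoint.
Variables (R : archiRealFieldType) (lg : nat -> R).
Hypothesis lgM : forall m n, (0 < m)%N -> (0 < n)%N -> lg (m * n)%N = lg m + lg n.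
Hypothesis lg_up : forall n, (0 < n)%N -> lg n.+1 - lg n <= n%:R^-1.
Hypothesis lg_lo : forall n, (0 < n)%N -> n.+1%:R^-1 <= lg n.+1 - lg n.

(** Legendre's theorem for [q^2 + 2t^2 = l w^2]: -1 and 2 are both nonresidues modulo [l], so -2 is
    a residue. *)
Lemma prime_norm_m2 l : prime l -> (l %% 8 = 3)%N ->
  exists q t w : int, w != 0 /\ q ^+ 2 + 2 * t ^+ 2 = l%:Z * w ^+ 2.
Proof.
move=> pl l3; have ol : odd l by rewrite (divn_eq l 8) l3 oddD oddM andbF.
have ol2 : odd l./2.
  have -> : (l./2 = 2 * (2 * (l %/ 8)) + 1)%N by have := divn_eq l 8; rewrite l3; lia.
  by rewrite oddD oddM.
have l0 := prime_gt0 pl.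
have [x ex] : exists x, (x ^ 2 = l.-1 * 2 %[mod l])%N.
  by apply: leg_square_root => //; rewrite legM // leg_predp // leg_2 // -signr_odd ol2.
have [q [t [w [w0 E]]]] : exists q t w : int, w != 0 /\
    1%:Z * q ^+ 2 + 2%:Z * t ^+ 2 = l%:Z * w ^+ 2.
  apply: (legendre (al := x) (be := 0) (ga := 1)); rewrite ?coprime1n ?coprime2n //.
  - by move=> y; rewrite mulnC; apply: nonsquare_prime_mul; rewrite // coprime_sym coprime2n.
  - by case=> [|[|y]]; rewrite // mul1n -mulnn !mulSn; lia.
  - rewrite mul1n; apply: dvdn_add_mod ex _.
    by rewrite -{2}[2%N]mul1n -mulnDl addn1 prednK // dvdn_mulr.
  - by rewrite !modn1.
  - by rewrite exp1n muln1 (divn_eq l 8) l3 -[8%N]/(4 * 2)%N mulnA modnMDl.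
by exists q, t, w; split=> //; rewrite -E mul1r.
Qed.

(** The equation of the auxiliary prime is solved for the squarefree part [m0] of [m]; then [l] is
    replaced by [(q^2 + 2t^2) / w^2], and [w] and [s] are cleared. *)
Theorem rational_point P m : P = 7%N \/ P = 5%N /\ chi4 m = 1 ->
    odd m -> coprime 3 m -> leg P (6 * m) = 1 ->
  exists x q t X : int, X != 0 /\
    3 * x ^+ 2 + P%:Z * (q ^+ 2 + 2 * t ^+ 2) = 2 * m%:Z * X ^+ 2.
Proof.
move=> hP om c3 hleg.
have [pP oP P3] : [/\ prime P, odd P & coprime 3 P] by case: hP => [->|[->]].
have m_gt0 : (0 < m)%N by case: m om {hP c3 hleg}.
have [m0 [s [em sf]]] := squarefree_decomposition m_gt0.
have [om0 os] : odd m0 /\ odd s by move: om; rewrite em oddM oddX /= => /andP[].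
have m00 : (0 < m0)%N by case: m0 om0 {em sf}.
have c30 : coprime 3 m0 by move: c3; rewrite em coprimeMr => /andP[].
have hP0 : P = 7%N \/ P = 5%N /\ chi4 m0 = 1.
  case: hP => [->|[-> h]]; [by left|right; split=> //].
  move: h; rewrite em chi4M -mulnn chi4M (chi4_odd os) -signr_odd.
  by case: (odd s./2); rewrite ?mulrNN mul1r mulr1.
have hleg0 : leg P (6 * m0) = 1.
  move: hleg; rewrite em mulnA legM // -mulnn [leg P (s * s)]legM //.
  by case: (leg_cases P s) => ->; rewrite ?mulrNN ?mulr1 ?mulr0.
have [l [pl l3 cl [l3E lE] lm]] := auxiliary_prime lgM lg_up lg_lo hP0 om0 c30 sf hleg0.
have ol : odd l by rewrite (divn_eq l 8) l3 oddD oddM andbF.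
have [cl3 clP clm] : [/\ coprime l 3, coprime l P & coprime l m0].
  by move: cl; rewrite !coprimeMr => /andP[/andP[-> ->] ->].
have cPm : coprime P m0.
  rewrite prime_coprime // -leg_eq0; apply/eqP => h.
  by move: hleg0; rewrite legM // h mulr0.
have [l0 P0] : (0 < l)%N /\ (0 < P)%N by rewrite !prime_gt0.
have c3l : coprime 3 l by rewrite coprime_sym.
have c3m : coprime 3 (2 * m0) by rewrite coprimeMr.
have cmPl : coprime (2 * m0) (P * l).
  by rewrite coprimeMr !coprimeMl !coprime2n oP ol /= coprime_sym cPm coprime_sym.
(* Condition modulo [2 m0]: [3 al] has to be odd and a square root of [-3 P l] modulo [m0]. *)
have [al hal] : exists al, (2 * m0 %| 3 * al ^ 2 + P * l)%N.
  have [y ey] : exists y, (y ^ 2 = m0.-1 * (3 * P) * l %[mod m0])%N.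
    apply: square_root_mod => // p pp pm; apply: leg_square_root => //.
      by move: pm => /dvdnP[k ek]; move: om0; rewrite ek oddM => /andP[].
    rewrite -(lm p pp pm); apply: leg_congr; rewrite -!mulnA.
    rewrite -modnMml -[in RHS]modnMml; congr ((_ * _) %% _)%N.
    apply/eqP; rewrite -(eqn_modDr 1) !addn1 !prednK ?(prime_gt0 pp) // modnn.
    exact: pm.
  have c2m : coprime 2 m0 by rewrite coprime2n.
  have [z ez] := multiple_in_class (chinese 2 m0 1 y) c3m.
  exists z; rewrite -(@Gauss_dvdr _ 3) 1?coprime_sym //.
  have -> : (3 * (3 * z ^ 2 + P * l) = (3 * z) ^ 2 + 3 * P * l)%N by ring.
  have ez2 : (3 * z = 1 %[mod 2])%N.
    by have /(congr1 (modn^~ 2)) := ez; rewrite !modn_dvdm ?dvdn_mulr // chinese_modl.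
  have ezm : (3 * z = y %[mod m0])%N.
    by have /(congr1 (modn^~ m0)) := ez; rewrite !modn_dvdm ?dvdn_mull // chinese_modr.
  rewrite Gauss_dvd //; apply/andP; split.
    by rewrite (@dvdn_add_mod _ _ 1) // ?dvdn2 ?oddD ?oddM ?oP ?ol // -modnXm ez2.
  apply: (@dvdn_add_mod _ _ (m0.-1 * (3 * P) * l)); first by rewrite -modnXm ezm modnXm.
  rewrite -[(m0.-1 * _ * _)%N]mulnA -{2}[(3 * P * l)%N]mul1n -mulnDl addn1 prednK //.
  exact: dvdn_mulr.
(* Condition modulo [P l]: [2 m0 ga] has to be a square root of [6 m0], glued from roots modulo [P]
   and [l]. *)
have [ga hga] : exists ga, (2 * m0 * ga ^ 2 = 3 %[mod P * l])%N.
  have [w1 ew1] := leg_square_root pP oP hleg0.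
  have [w2 ew2] := leg_square_root pl ol lE.
  have cPl : coprime P l by rewrite coprime_sym.
  have [z ez] := multiple_in_class (chinese P l w1 w2) cmPl.
  exists z; apply: (@modn_cancel _ (2 * m0)); first by rewrite coprime_sym.
  have -> : (2 * m0 * (2 * m0 * z ^ 2) = (2 * m0 * z) ^ 2)%N by ring.
  have -> : (2 * m0 * 3 = 6 * m0)%N by ring.
  apply/eqP; rewrite -modnXm ez modnXm chinese_remainder //.
  by rewrite -modnXm chinese_modl // modnXm ew1 -[X in _ && (X == _)]modnXm
    chinese_modr // modnXm ew2 !eqxx.
have hbe : (P * l * 1 ^ 2 = 2 * m0 %[mod 3])%N.
  have E := leg3_congr c3l l3E; rewrite exp1n muln1 -modnMmr E modnMmr.
  have -> : (P * (P * 2 * m0) = P ^ 2 * (2 * m0))%N by ring.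
  have e : (P ^ 2 %% 3 = 1)%N by case: hP => [->|[->]].
  by rewrite -[LHS]modnMml e mul1n.
have [x [y [z [z0 E]]]] : exists x y z : int, z != 0 /\
    3%:Z * x ^+ 2 + (P * l)%N%:Z * y ^+ 2 = (2 * m0)%N%:Z * z ^+ 2.
  apply: (legendre (al := al) (be := 1) (ga := ga)) => //.
  - by rewrite muln_gt0 P0.
  - by rewrite muln_gt0.
  - by rewrite coprimeMr P3.
  - by rewrite coprime_sym.
  - move=> x; have -> : (P * l * (2 * m0) = l * (P * (2 * m0)))%N by ring.
    by apply: nonsquare_prime_mul; rewrite // !coprimeMr clP clm coprimen2 ol.
  - move=> x; have -> : (3 * (P * l) = l * (3 * P))%N by ring.
    by apply: nonsquare_prime_mul; rewrite // !coprimeMr clP cl3.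
have [q [t [w [w0 E2]]]] := prime_norm_m2 pl l3.
exists (x * w * s%:Z), (q * y * s%:Z), (t * y * s%:Z), (z * w).
rewrite mulf_neq0 //; split=> //.
have -> : 2 * m%:Z * (z * w) ^+ 2 = (2 * m0)%N%:Z * z ^+ 2 * (w * s%:Z) ^+ 2.
  by rewrite em -mulnn !PoszM; ring.
rewrite -E (_ : (P * l)%N%:Z = P%:Z * l%:Z) //.
transitivity (3 * x ^+ 2 * (w * s%:Z) ^+ 2 + P%:Z * (l%:Z * w ^+ 2) * (y * s%:Z) ^+ 2).
  by rewrite -E2; ring.
ring.
Qed.

End RationalPoint.

From mathcomp Require Import reals exp Rstruct ssrZ.

(** * The natural logarithm as an instance of [lg] *)

Section LogOfNat.
Variable R : realType.

Definition log_nat (n : nat) : R := ln n%:R.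

Lemma log_natM (m n : nat) : (0 < m)%N -> (0 < n)%N -> log_nat (m * n) = log_nat m + log_nat n.
Proof. by move=> m0 n0; rewrite /log_nat natrM lnM ?posrE ?ltr0n. Qed.

Lemma log_nat_up (n : nat) : (0 < n)%N -> log_nat n.+1 - log_nat n <= n%:R^-1.
Proof.
move=> n0; have n0R : 0 < n%:R :> R by rewrite ltr0n.
have i0 : 0 < n%:R^-1 :> R by rewrite invr_gt0.
have -> : log_nat n.+1 = log_nat n + ln (1 + n%:R^-1).
  rewrite /log_nat -lnM ?posrE // ?addr_gt0 // mulrDr mulr1 mulfV ?natr1 //.
  exact: lt0r_neq0.
rewrite addrAC subrr add0r le_ln1Dx //; lra.
Qed.

Lemma log_nat_lo (n : nat) : (0 < n)%N -> n.+1%:R^-1 <= log_nat n.+1 - log_nat n.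
Proof.
move=> n0; have n0R : 0 < n%:R :> R by rewrite ltr0n.
have n1R : 0 < n.+1%:R :> R by rewrite ltr0n.
have i1 : n.+1%:R^-1 < 1 :> R by rewrite invf_lt1 // ltr1n.
have -> : log_nat n = log_nat n.+1 + ln (1 + - n.+1%:R^-1).
  rewrite /log_nat -lnM ?posrE // ?subr_gt0 // mulrBr mulr1 mulfV; last exact: lt0r_neq0.
  by rewrite -natr1 addrK.
have : ln (1 + - n.+1%:R^-1) <= - n.+1%:R^-1 :> R by rewrite le_ln1Dx // ltrN2.
set a := n.+1%:R^-1; set b := log_nat _; lra.
Qed.

End LogOfNat.

Definition rational_point_nat :=
  @rational_point Rdefinitions.R (@log_nat _) (@log_natM _) (@log_nat_up _) (@log_nat_lo _).



(** * Transfer of the rational point to [Z] *)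

Lemma of_nat_modn n d : (0 < d)%N -> Z.of_nat (n %% d) = (Z.of_nat n mod Z.of_nat d)%BZ.
Proof.
move=> d0; have e := divn_eq n d; have l := ltn_pmod n d0.
apply: (@Z.mod_unique _ _ (Z.of_nat (n %/ d))); nia.
Qed.

Lemma modn_of_Z n d r : (0 < d)%N -> (Z.of_nat n mod Z.of_nat d = Z.of_nat r)%BZ -> (n %% d = r)%N.
Proof. by move=> d0; rewrite -of_nat_modn // => /Nat2Z.inj. Qed.

Lemma rational_point_Z (P m : Z) :
    (P = 7 /\ (6 * m mod 7 = 1 \/ 6 * m mod 7 = 2 \/ 6 * m mod 7 = 4)
     \/ P = 5 /\ m mod 4 = 1 /\ (6 * m mod 5 = 1 \/ 6 * m mod 5 = 4))%BZ ->
    (0 < m)%BZ -> (m mod 2 = 1)%BZ -> (m mod 3 <> 0)%BZ ->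
  exists x q t X : Z, (X <> 0 /\ 3 * (x * x) + P * (q * q + 2 * (t * t)) = 2 * m * (X * X))%BZ.
Proof.
move=> HP m0 m2 m3.
have [n en] : exists n : nat, m = Z.of_nat n by exists (Z.to_nat m); rewrite Z2Nat.id //; lia.
have [p ep] : exists p : nat, P = Z.of_nat p.
  by case: HP => -[-> _]; [exists 7 | exists 5].
have zM x y : Z_of_int (x * y) = (Z_of_int x * Z_of_int y)%BZ by lia.
have zD x y : Z_of_int (x + y) = (Z_of_int x + Z_of_int y)%BZ by lia.
subst m P.
have M k : Z.of_nat (k * n) = (Z.of_nat k * Z.of_nat n)%BZ by lia.
have [] := @rational_point_nat p n.
- case: HP => -[hp h]; [left; lia | right; split; first lia].
  by rewrite /chi4 (@modn_of_Z n 4 1) //; case: h.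
- by rewrite -[odd n]negbK -dvdn2 /dvdn (@modn_of_Z n 2 1).
- rewrite prime_coprime // /dvdn; apply/eqP => /(congr1 Z.of_nat); rewrite of_nat_modn //.
- case: HP => -[hp h].
    have -> : p = 7%N by lia.
    have E r : (Z.of_nat (6 * n) mod 7 = Z.of_nat r)%BZ -> (6 * n %% 7 = r)%N.
      exact: (@modn_of_Z _ 7).
    rewrite M // in E; rewrite -leg_mod.
    by case: h => [|[|]] h; [rewrite (E 1%N) | rewrite (E 2%N) | rewrite (E 4%N)].
  have -> : p = 5%N by lia.
  have E r : (Z.of_nat (6 * n) mod 5 = Z.of_nat r)%BZ -> (6 * n %% 5 = r)%N.
    exact: (@modn_of_Z _ 5).
  rewrite M // in E; rewrite -leg_mod.
  by case: h => _ [|] h; [rewrite (E 1%N) | rewrite (E 4%N)].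
move=> x [q [t [X [X0 /(congr1 Z_of_int)]]]].
rewrite !expr2 !(zM, zD) => E; exists (Z_of_int x), (Z_of_int q), (Z_of_int t), (Z_of_int X).
split; first by case: (X) X0 => //= -[].
by move: E; rewrite /=.
Qed.

Unset Implicit Arguments.
Open Scope Z_scope.

Theorem theorem1p3 (delta : Z) (Hdelta : delta = 1 \/ delta = 2) (n : Z) (Hn : 0 <= n) :
  exists w x y z : Z, 0 <= w /\ 0 <= x /\ 0 <= y /\ 0 <= z /\
    n = p5 w + p5 x + 2 * p5 y + 3 * delta * p5 z.
Proof.
destruct (Z_lt_le_dec n 250000) as [Hs|Hl]; first exact (small_case delta n Hdelta (conj Hn Hs)).
destruct Hdelta as [-> | ->].
- destruct (choose_b 1 7 n)
    as (a & b & E & Hb & Hab & H4 & H7 & H3); [auto|exact Hl|].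
  assert (H2 : b mod 2 = 1) by (clear - E H4; divlia).
  apply (pentagonal_sum 1 n a b (or_introl Logic.eq_refl) Hb E (proj1 Hab)).
  destruct (residues_delta1 a b Hab H4 H2 H7 H3) as (M & EM & M0 & M2 & M3 & M7).
  apply (sums_delta1 a b M EM), ternary_seven_of_rational.
  apply (@rational_point_Z 7 M); [left; split; [reflexivity|exact M7]|exact M0|exact M2|exact M3].
- destruct (choose_b 2 5 n)
    as (a & b & E & Hb & Hab & H4 & H5 & H3); [auto|exact Hl|].
  assert (H2 : b mod 2 = 1) by (clear - E H4; divlia).
  apply (pentagonal_sum 2 n a b (or_intror Logic.eq_refl) Hb E (proj1 Hab)).
  destruct (residues_delta2 a b _ Hab H4 H2 H5 H3 Logic.eq_refl) as (N0 & N8 & N3 & N5 & N5').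
  apply (sums_delta2 a b _ Logic.eq_refl H2), ternary_five_of_rational; try assumption.
  apply rational_point_Z; [right; repeat split; [clear - N8; divlia|exact N5']|exact N0| |exact N3].
  clear - N8; divlia.
Qed.
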